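(* Let $K$ and $H$ be complex Hilbert spaces with $\dim K<\infty$, and let $\mathcal{B}$ be the open unit ball of the space $L(K,H)$ of bounded linear operators from $K$ to $H$ (with the operator norm). A finite set $\mathcal{E}$ of commuting holomorphic maps of $\mathcal{B}$ (into itself) has a common fixed point in $\mathcal{B}$ if and only if $\mathcal{E}$ has a non-empty invariant set separated from the boundary of $\mathcal{B}$.
   Context: A set $F\subset\mathcal{B}$ is invariant for $\mathcal{E}$ if $g(F)\subset F$ for all $g\in\mathcal{E}$. A subset of $\mathcal{B}$ is separated from the boundary if there is $r<1$ such that all its elements have norm at most $r$. *)

(* Defs.v *)
From HB Require Import structures.
From mathcomp Require Import all_boot all_order all_algebra.
From mathcomp Require Import sesquilinear complex.
From mathcomp Require Import all_classical all_reals all_analysis.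
Set Implicit Arguments.
Unset Strict Implicit.
Unset Printing Implicit Defensive.
Import Order.TTheory GRing.Theory Num.Theory.
Import numFieldNormedType.Exports.
Local Open Scope classical_set_scope.
Local Open Scope ring_scope.
Local Open Scope complex_scope.

(* MathComp normed modules have norms valued in their scalar field, so over
   R[i] a norm is a nonnegative element of R[i]. Inner products are linear in
   the first argument and conjugate-linear in the second. *)
HB.mixin Record isHilbert (R : realType) V & CompleteNormedModule R[i] V := {
  inner : {dot V for (@Num.conj R[i])} ;
  normr_inner : forall x : V, `|x| ^+ 2 = inner x x
}.

#[short(type="hilbertType")]
HB.structure Definition Hilbert (R : realType) :=
  {V of CompleteNormedModule R[i] V & isHilbert R V}.

Definition finite_dimensional (F : fieldType) (V : lmodType F) : Prop :=
  exists (n : nat) (e : 'I_n -> V),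
    forall v, exists c : 'I_n -> F, v = \sum_(i < n) c i *: e i.

Section BoundedOperators.
Context {R : realType} (K H : normedModType R[i]).

Definition bounded_linear (f : K -> H) : Prop :=
  linear f /\ exists M : R, forall x, `|f x| <= M%:C * `|x|.

Definition bounded_linear_pred : {pred K -> H} :=
  [pred f : K -> H | `[< bounded_linear f >]].

Record boundedOp := BoundedOp {
  boundedOp_fun :> K -> H ;
  _ : boundedOp_fun \in bounded_linear_pred
}.

HB.instance Definition _ := [isSub for boundedOp_fun].
HB.instance Definition _ := [Choice of boundedOp by <:].

Fact bounded_linear_submod_closed : submod_closed bounded_linear_pred.
Proof.
split.
  apply/asboolP; split; first by move=> a x y; rewrite scaler0 addr0.
  by exists 0 => x; rewrite normr0 mul0r.
move=> a f g /asboolP[lf [M fM]] /asboolP[lg [N gN]]; apply/asboolP; split.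
  move=> b x y; rewrite !fctE /= lf lg scalerDr scalerA.
  rewrite scalerDr scalerA [a * b]mulrC.
  by rewrite -!addrA; congr (_ + _); rewrite addrCA.
exists (complex.Re `|a| * M + N) => x; rewrite !fctE.
have -> : (complex.Re `|a| * M + N)%:C = `|a| * M%:C + N%:C.
  by rewrite rmorphD rmorphM /=; congr (_ * _ + _); exact: RRe_real.
rewrite mulrDl (le_trans (ler_normD _ _))// lerD// normrZ -mulrA.
by rewrite ler_wpM2l.
Qed.

HB.instance Definition _ := GRing.isSubmodClosed.Build _ _ bounded_linear_pred
  bounded_linear_submod_closed.
HB.instance Definition _ := [SubChoice_isSubLmodule of boundedOp by <:].

Definition opnorm_set (f : boundedOp) : set R :=
  [set r | exists x : K, `|x| <= 1 /\ `|f x| = r%:C].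

Definition opnorm (f : boundedOp) : R := sup (opnorm_set f).

Let normE (V : normedModType R[i]) (v : V) : `|v| = (complex.Re `|v|)%:C.
Proof. by apply/esym; exact: RRe_real. Qed.

Fact boundedOpP (f : boundedOp) : bounded_linear f.
Proof. by case: f => f /= /asboolP. Qed.

Let opnorm_set_sup (f : boundedOp) : has_sup (opnorm_set f).
Proof.
have [lf [M fM]] := boundedOpP f; split.
  exists (complex.Re `|f 0|), 0; split; first by rewrite normr0.
  exact: normE.
exists `|M| => r [x [x1 fx]]; rewrite -lecR -fx (le_trans (fM x))//.
have M0 : M%:C <= `|M|%:C by rewrite lecR ler_norm.
rewrite (le_trans (ler_wpM2r _ M0))// -[leRHS]mulr1 ler_wpM2l//.
by rewrite lecR.
Qed.

Let opnorm_ub (f : boundedOp) x : `|x| <= 1 -> `|f x| <= (opnorm f)%:C.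
Proof.
move=> x1; rewrite normE lecR; apply: sup_upper_bound.
  exact: opnorm_set_sup.
by exists x; split => //; exact: normE.
Qed.

Let opnorm_le (f : boundedOp) (M : R) :
  (forall x, `|x| <= 1 -> `|f x| <= M%:C) -> opnorm f <= M.
Proof.
move=> fM; apply: ge_sup; first by case: (opnorm_set_sup f).
by move=> r [x [x1 fx]]; rewrite -lecR -fx fM.
Qed.

Let opnorm_ge0 (f : boundedOp) : 0 <= opnorm f.
Proof.
by rewrite -lecR (le_trans (normr_ge0 (f 0)))// opnorm_ub// normr0.
Qed.

Fact opnormD (f g : boundedOp) :
  (opnorm (f + g))%:C <= (opnorm f)%:C + (opnorm g)%:C.
Proof.
rewrite -rmorphD lecR; apply: opnorm_le => x x1.
rewrite rmorphD /= (le_trans (ler_normD _ _))//.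
by rewrite lerD// opnorm_ub.
Qed.

Let opnormZ_le (a : R[i]) (f : boundedOp) :
  (opnorm (a *: f))%:C <= `|a| * (opnorm f)%:C.
Proof.
rewrite (normE (a : R[i]^o)) -rmorphM lecR; apply: opnorm_le => x x1.
rewrite rmorphM /= -(normE (a : R[i]^o)).
change (`|a *: f x| <= `|a| * (opnorm f)%:C).
by rewrite normrZ ler_wpM2l// opnorm_ub.
Qed.

Fact opnormZ (a : R[i]) (f : boundedOp) :
  (opnorm (a *: f))%:C = `|a| * (opnorm f)%:C.
Proof.
apply/eqP; rewrite eq_le opnormZ_le /=.
have [->|a0] := eqVneq a 0; first by rewrite normr0 mul0r lecR.
have := opnormZ_le a^-1 (a *: f).
rewrite scalerA mulVf// scale1r normfV.
by rewrite ler_pdivlMl ?normr_gt0.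
Qed.

Fact opnorm_eq0 (f : boundedOp) : (opnorm f)%:C = 0 -> f = 0.
Proof.
move=> f0; apply/val_inj/funext => x /=.
have [lf _] := boundedOpP f.
have fZ a y : f (a *: y) = a *: f y.
  have f00 : f 0 = 0 by have := lf (-1) 0 0; rewrite !scaleN1r oppr0 addr0 addNr.
  by have := lf a y 0; rewrite f00 !addr0.
have [->|x0] := eqVneq x 0.
  by rewrite -(scale0r (0 : K)) fZ scale0r.
have := @opnorm_ub f (`|x|^-1 *: x); rewrite f0 normrZ normfV normr_id.
rewrite mulVf ?normr_eq0// => /(_ (lexx _)).
rewrite normr_le0 fZ scaler_eq0 invr_eq0 normr_eq0 (negbTE x0) /=.
by move/eqP.
Qed.

HB.instance Definition _ := @Lmodule_isNormed.Build R[i] boundedOp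
  (fun f => (opnorm f)%:C) opnormD opnormZ opnorm_eq0.

End BoundedOperators.

Section HolomorphicMaps.
Context {R : realType}.

Definition open_unit_ball (V : normedModType R[i]) : set V :=
  [set x | `|x| < 1].

(* Maps out of D are total functions whose values outside D are irrelevant:
   when D is open, differentiability at a point of D depends only on the values
   on D. The derivative is linear over R[i], so this is Frechet holomorphy. *)
Definition holomorphic_on (V W : normedModType R[i]) (D : set V)
    (f : V -> W) : Prop :=
  forall x, D x -> differentiable f x.

Definition holomorphic_self_map (V : normedModType R[i]) (D : set V)
    (f : V -> V) : Prop :=
  {homo f : x / D x} /\ holomorphic_on D f.

Definition commuting_on (V : Type) (D : set V) (E : set (V -> V)) : Prop :=
  forall f g, E f -> E g -> forall x, D x -> f (g x) = g (f x).

Definition invariant_set (V : Type) (E : set (V -> V)) (F : set V) : Prop :=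
  forall g, E g -> g @` F `<=` F.

Definition separated_from_boundary (V : normedModType R[i]) (F : set V) :
    Prop :=
  exists r : R, r < 1 /\ forall x, F x -> `|x| <= r%:C.

End HolomorphicMaps.

Arguments open_unit_ball {R} V.

(* Main.v *)
Require Import Defs.
From HB Require Import structures.
From mathcomp Require Import all_boot all_order all_algebra.
From mathcomp Require Import sesquilinear complex.
From mathcomp Require Import all_classical all_reals all_analysis.
From mathcomp Require Import ring lra.
Import Order.TTheory GRing.Theory Num.Theory.
Import numFieldNormedType.Exports.
Set Implicit Arguments.
Unset Strict Implicit.
Unset Printing Implicit Defensive.
Local Open Scope classical_set_scope.
Local Open Scope ring_scope.
Local Open Scope complex_scope.
Local Notation Re := complex.Re.
Local Notation Im := complex.Im.

(** A common fixed point is by itself an invariant set. For the converse, the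
    ball B of L(K,H) is treated as a hyperbolic space in which holomorphic maps
    are nonexpansive, and the fixed point is found as in the theory of commuting
    nonexpansive maps, by means of asymptotic radii, weak compactness and an
    Opial property.

    The pseudo-hyperbolic distance of x and y enters only through the relation
    [phclose s x y], which says that for all k and l in K
    |k|^2 - |x k|^2 + |l|^2 - |y l|^2 + 2 s Re (<k,l> - <x k, y l>) >= 0
    and means that the distance is at most the square root of 1 - s^2; thus s
    near 1 is a small distance. The form on the left is [gap]. It is concave in
    y, which makes the hyperbolic balls convex ([phclose_convex]) and midpoints
    strictly closer than end points ([phclose_mid]), and it is bounded away from
    zero near s = 0 on smaller balls, which makes the bounded sets of B those
    separated from its boundary ([phclose_small], [phclose_bounded]).

    Three facts carry the proof.

    Schwarz-Pick ([schwarz_pick]): a holomorphic map g of B into itself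
    preserves [phclose s]. Two points of B lie on a holomorphic disc whose
    radius is governed by their distance ([geodesic_disc]). Composed with g it
    becomes a contraction-valued holomorphic function, and the Pick inequality
    between two of its values ([two_point_pick]) is [phclose] for their images.
    That inequality comes from integrating over the unit circle and evaluating
    with [cauchy_formula]; as holomorphy is complex differentiability at each
    point, the latter rests on Goursat's argument ([goursat]).

    Weak compactness ([weak_limit], [weak_limit_mem]): on an ultrafilter
    containing a bounded set the operators converge weakly, and closed convex
    sets contain the limit.

    Opial ([opial]): if the members of an ultrafilter are asymptotically within
    a given positive distance of one another, they are asymptotically within a
    strictly smaller distance of their weak limit. This is where the finite
    dimension of K is essential: the forms |z k - p k|^2 converge uniformly on
    the unit ball of K.

    Let F be an invariant set separated from the boundary. The points y of B
    such that some composite g of the given maps sends F into a fixed hyperbolic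
    ball around y form an invariant set, still separated from the boundary. It
    is convex because the maps commute: g1 g2 serves for both y1 and y2
    ([centers_convex]). By Zorn's lemma and weak compactness there is a minimal
    non-empty closed convex invariant set D ([minimal_admissible]). The same
    construction inside D, with minimality, shows that the asymptotic radius of
    D, the infimum over g of the radius of g(D) around y, does not depend on the
    point y of D. If it is zero then D is a single point, which is fixed by all
    the maps. If it is positive, let a slightly smaller radius, a point z of D
    and a composite g vary: the points of g(D) farther from z than this radius
    form a filter base, since a point far from the midpoint of z1 and z2 and
    almost within the asymptotic radius of both is far from both. An ultrafilter
    refining it has a weak limit p in D, its members are asymptotically within
    the asymptotic radius of every point of D, and so by Opial closer than that
    to p; but by construction they are not ([minimal_fixed]). *)

(** * Integrals over segments *)

Section SegmentIntegral.
Context {R : realType}.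
Implicit Types (f g : R -> R) (a b c : R).

Definition segint a b f : R := \int[lebesgue_measure]_(x in `[a, b]) f x.

Definition cont_on a b f := forall x, a <= x <= b -> {for x, continuous f}.

Lemma cont_onS a b a' b' f :
  a <= a' -> b' <= b -> cont_on a b f -> cont_on a' b' f.
Proof.
move=> aa' bb' cf x /andP[ax xb]; apply: cf.
by rewrite (le_trans aa' ax) (le_trans xb bb').
Qed.

Lemma cont_on_integrable a b f : cont_on a b f ->
  lebesgue_measure.-integrable `[a, b] (EFin \o f).
Proof.
move=> cf; apply: continuous_compact_integrable; first exact: segment_compact.
apply: continuous_in_subspaceT => x; rewrite inE /= in_itv /= => xab.
exact: cf.
Qed.

Lemma cont_onB a b f g : cont_on a b f -> cont_on a b g ->
  cont_on a b (fun x => f x - g x).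
Proof. by move=> cf cg x xab; apply: cvgB; [exact: cf | exact: cg]. Qed.

Lemma cont_onD a b f g : cont_on a b f -> cont_on a b g ->
  cont_on a b (fun x => f x + g x).
Proof. by move=> cf cg x xab; apply: cvgD; [exact: cf | exact: cg]. Qed.

Lemma cont_onM a b f g : cont_on a b f -> cont_on a b g ->
  cont_on a b (fun x => f x * g x).
Proof. by move=> cf cg x xab; apply: cvgM; [exact: cf | exact: cg]. Qed.

Lemma cont_on_cst a b k : cont_on a b (fun=> k).
Proof. by move=> x _; exact: cst_continuous. Qed.

Lemma segintB a b f g : cont_on a b f -> cont_on a b g ->
  segint a b (fun x => f x - g x) = segint a b f - segint a b g.
Proof.
move=> /cont_on_integrable cf /cont_on_integrable cg.
by rewrite /segint RintegralB.
Qed.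

Lemma segintD a b f g : cont_on a b f -> cont_on a b g ->
  segint a b (fun x => f x + g x) = segint a b f + segint a b g.
Proof.
move=> /cont_on_integrable cf /cont_on_integrable cg.
by rewrite /segint RintegralD.
Qed.

Lemma segintZ a b k f : cont_on a b f ->
  segint a b (fun x => k * f x) = k * segint a b f.
Proof.
by move=> /cont_on_integrable cf; rewrite /segint RintegralZl.
Qed.

Lemma segint_cst a b k : a <= b -> segint a b (fun=> k) = k * (b - a).
Proof.
move=> ab; rewrite /segint Rintegral_cst//= lebesgue_measure_itv/= lte_fin.
case: ltP => [//|ba]; have -> : b = a by apply/eqP; rewrite eq_le ab ba.
by rewrite subrr.
Qed.

Lemma le_segint a b f g : cont_on a b f -> cont_on a b g ->
  (forall x, a <= x <= b -> f x <= g x) -> segint a b f <= segint a b g.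
Proof.
move=> /cont_on_integrable cf /cont_on_integrable cg fg.
by apply: le_Rintegral => // x /=; rewrite in_itv/=; exact: fg.
Qed.

Lemma eq_segint a b f g : (forall x, a <= x <= b -> f x = g x) ->
  segint a b f = segint a b g.
Proof.
by move=> fg; apply: eq_Rintegral => x; rewrite inE/= in_itv/=; exact: fg.
Qed.

Lemma segint_norm_le a b f C : a <= b -> cont_on a b f ->
  (forall x, a <= x <= b -> `|f x| <= C) -> `|segint a b f| <= C * (b - a).
Proof.
move=> ab cf fC; have cC := @cont_on_cst a b.
rewrite ler_norml -mulNr -!segint_cst//; apply/andP; split;
  by apply: le_segint => // x /fC; rewrite ler_norml => /andP[].
Qed.

Lemma segint_split a c b f : a <= c <= b -> cont_on a b f ->
  segint a b f = segint a c f + segint c b f.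
Proof.
move=> /andP[ac cb] cf; rewrite /segint.
have cfi := cont_on_integrable cf.
have := @Rintegral_itvB R f (BLeft a) (BRight b) c cfi.
rewrite !bnd_simp => /(_ ac cb).
rewrite Rintegral_itv_obnd_cbnd; last first.
  apply: integrableS cfi => //; apply: subset_itvr; rewrite bnd_simp.
  by rewrite (le_trans ac)//.
by move=> <-; rewrite addrC subrK.
Qed.

End SegmentIntegral.

(** * Goursat's lemma for closed forms on a rectangle *)

Section Goursat.
Context {R : realType}.
Variables (p q : R -> R -> R) (s0 s1 t0 t1 : R).
Hypotheses (s01 : s0 <= s1) (t01 : t0 <= t1).
Hypothesis cq : forall s, s0 <= s <= s1 -> cont_on t0 t1 (q s).
Hypothesis cp : forall t, t0 <= t <= t1 -> cont_on s0 s1 (p^~ t).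

Let J a b u v := segint u v (fun t => q b t - q a t) -
                 segint a b (fun s => p s v - p s u).

Let J_split a b u v m w : s0 <= a -> a <= m -> m <= b -> b <= s1 ->
    t0 <= u -> u <= w -> w <= v -> v <= t1 ->
  J a b u v = (J a m u w + J m b u w) + (J a m w v + J m b w v).
Proof.
move=> sa am mb bs tu uw wv vt.
have ms : s0 <= m <= s1 by rewrite (le_trans sa am) (le_trans mb bs).
have as_ : s0 <= a <= s1.
  by rewrite sa (le_trans am)//; case/andP: ms.
have bs_ : s0 <= b <= s1.
  by rewrite bs andbT (le_trans _ mb)//; case/andP: ms.
have wt : t0 <= w <= t1 by rewrite (le_trans tu uw) (le_trans wv vt).
have ut : t0 <= u <= t1.
  by rewrite tu (le_trans uw)//; case/andP: wt.
have vt_ : t0 <= v <= t1.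
  by rewrite vt andbT (le_trans _ wv)//; case/andP: wt.
have /andP[sm ms1] := ms; have /andP[tw wt1] := wt.
have cq' s x y : s0 <= s <= s1 -> t0 <= x -> y <= t1 -> cont_on x y (q s).
  by move=> /cq c xx yy; exact: cont_onS c.
have cp' t x y : t0 <= t <= t1 -> s0 <= x -> y <= s1 -> cont_on x y (p^~ t).
  by move=> /cp c xx yy; exact: cont_onS c.
rewrite /J !segintB; try by [apply: cq' | apply: cp'].
rewrite (@segint_split _ u w v (q b)) ?uw//; last by apply: cq'.
rewrite (@segint_split _ u w v (q a)) ?uw//; last by apply: cq'.
rewrite (@segint_split _ a m b (p^~ v)) ?am//; last by apply: cp'.
rewrite (@segint_split _ a m b (p^~ u)) ?am//; last by apply: cp'.
ring.
Qed.

Let D n := (s1 - s0) / 2 ^+ n.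
Let E n := (t1 - t0) / 2 ^+ n.
Let Q n (c : R * R) := J c.1 (c.1 + D n) c.2 (c.2 + E n).

(* A quarter of the rectangle with corner c on which the boundary integral is at
   least a quarter of the one over the whole rectangle. *)
Let next n (c : R * R) : R * R :=
  let d := D n.+1 in let e := E n.+1 in
  if `|Q n c| / 4 <= `|Q n.+1 c| then c else
  if `|Q n c| / 4 <= `|Q n.+1 (c.1 + d, c.2)| then (c.1 + d, c.2) else
  if `|Q n c| / 4 <= `|Q n.+1 (c.1, c.2 + e)| then (c.1, c.2 + e) else
  (c.1 + d, c.2 + e).

Let corner := fix corner n := if n is m.+1 then next m (corner m) else (s0, t0).

Let DS n : D n = D n.+1 + D n.+1.
Proof. by rewrite /D exprS; field; rewrite expf_neq0// pnatr_eq0. Qed.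
Let ES n : E n = E n.+1 + E n.+1.
Proof. by rewrite /E exprS; field; rewrite expf_neq0// pnatr_eq0. Qed.
Let D_ge0 n : 0 <= D n.
Proof. by rewrite divr_ge0 ?subr_ge0// exprn_ge0. Qed.
Let E_ge0 n : 0 <= E n.
Proof. by rewrite divr_ge0 ?subr_ge0// exprn_ge0. Qed.

Let next_bnd n c : let c' := next n c in
  [/\ c.1 <= c'.1, c'.1 + D n.+1 <= c.1 + D n,
      c.2 <= c'.2 & c'.2 + E n.+1 <= c.2 + E n].
Proof.
have d := D_ge0 n.+1; have e := E_ge0 n.+1; have := DS n; have := ES n.
rewrite /next; case: ifP => _ /=; [|case: ifP => _ /=; [|case: ifP => _ /=]];
 move=> ? ?; split; lra.
Qed.

Let corner_bnd n : let c := corner n in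
  [/\ s0 <= c.1, c.1 + D n <= s1, t0 <= c.2 & c.2 + E n <= t1].
Proof.
elim: n => [/=|n [i1 i2 i3 i4]].
  by rewrite /D /E expr0 !divr1; split; lra.
have [j1 j2 j3 j4] := next_bnd n (corner n).
by rewrite [corner _]/=; split; lra.
Qed.

Let next_Q n : `|Q n (corner n)| / 4 <= `|Q n.+1 (corner n.+1)|.
Proof.
rewrite [corner n.+1]/= /next.
case: ifP => // /negbT h1; case: ifP => // /negbT h2.
case: ifP => // /negbT h3; move: h1 h2 h3; rewrite -!ltNge => h1 h2 h3.
have [i1 i2 i3 i4] := corner_bnd n.
have d := D_ge0 n.+1; have e := E_ge0 n.+1; have dd := DS n; have ee := ES n.
set c := corner n in i1 i2 i3 i4 h1 h2 h3 *.
have qE : Q n c = (Q n.+1 c + Q n.+1 (c.1 + D n.+1, c.2)) +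
   (Q n.+1 (c.1, c.2 + E n.+1) + Q n.+1 (c.1 + D n.+1, c.2 + E n.+1)).
  rewrite {1}/Q (@J_split _ _ _ _ (c.1 + D n.+1) (c.2 + E n.+1)); try lra.
  by rewrite /Q/= dd ee !addrA.
have : `|Q n c| <= `|Q n.+1 c| + `|Q n.+1 (c.1 + D n.+1, c.2)| +
   (`|Q n.+1 (c.1, c.2 + E n.+1)| + `|Q n.+1 (c.1 + D n.+1, c.2 + E n.+1)|).
  rewrite {1}qE (le_trans (ler_normD _ _))// lerD//; exact: ler_normD.
lra.
Qed.

Let corner_Q n : `|J s0 s1 t0 t1| / 4 ^+ n <= `|Q n (corner n)|.
Proof.
elim: n => [|n ih].
  rewrite expr0 divr1 /Q/= /D /E expr0 !divr1.
  by rewrite !(addrC _ (_ - _)) !subrK.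
apply: le_trans (next_Q n); rewrite exprSr invfM mulrA.
by rewrite ler_pM2r// invr_gt0.
Qed.

Let corner_mono n m : (n <= m)%N ->
  let c := corner n in let c' := corner m in
  [/\ c.1 <= c'.1, c'.1 + D m <= c.1 + D n,
      c.2 <= c'.2 & c'.2 + E m <= c.2 + E n].
Proof.
elim: m => [|m ih]; first by rewrite leqn0 => /eqP->.
rewrite leq_eqVlt => /predU1P[-> //|/ih[i1 i2 i3 i4]].
have [j1 j2 j3 j4] := next_bnd m (corner m).
by rewrite [corner m.+1]/=; split; lra.
Qed.

Let nested_limit (x d : nat -> R) :
  (forall n m, (n <= m)%N -> x n <= x m /\ x m + d m <= x n + d n) ->
  (forall n, 0 <= d n) ->
  exists y, forall n, x n <= y <= x n + d n.
Proof.
move=> h d0.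
have hub n : ubound (range x) (x n + d n).
  move=> _ [m _ <-]; case: (leP n m) => nm; last move/ltW in nm.
    by have [? ?] := h _ _ nm; have := d0 m; lra.
  by have [? ?] := h _ _ nm; have := d0 n; lra.
exists (sup (range x)) => n; apply/andP; split.
  apply: ub_le_sup; last by exists n.
  by exists (x 0 + d 0).
by apply: ge_sup; [exists (x 0), 0%N|exact: hub].
Qed.

(** Closed forms integrate to zero around a rectangle even when the partial
    derivatives [c] of [q] in the first variable and of [p] in the second are
    not known to be continuous: halving the sides repeatedly keeps a quarter of
    the boundary integral in some quarter of the rectangle, while at the point
    these quarters shrink to the integral is small compared with the area. *)
Lemma goursat :
  (forall s t, s0 <= s <= s1 -> t0 <= t <= t1 ->
    exists c, forall e, 0 < e -> exists2 d, 0 < d & forall a b u v,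
      s0 <= a -> a <= s <= b -> b <= s1 -> t0 <= u -> u <= t <= v -> v <= t1 ->
      b - a < d -> v - u < d ->
      (forall t', u <= t' <= v ->
        `|q b t' - q a t' - c * (b - a)| <= e * ((b - a) + (v - u))) /\
      (forall s', a <= s' <= b ->
        `|p s' v - p s' u - c * (v - u)| <= e * ((b - a) + (v - u)))) ->
  segint t0 t1 (fun t => q s1 t - q s0 t) =
  segint s0 s1 (fun s => p s t1 - p s t0).
Proof.
move=> Hd; apply/eqP; rewrite -subr_eq0 -normr_le0.
rewrite -[X in `|X|]/(J s0 s1 t0 t1).
have [x xP] := @nested_limit (fun n => (corner n).1) D
  (fun n m nm => let: And4 a b _ _ := corner_mono nm in conj a b) D_ge0.
have [y yP] := @nested_limit (fun n => (corner n).2) E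
  (fun n m nm => let: And4 _ _ a b := corner_mono nm in conj a b) E_ge0.
have xs : s0 <= x <= s1.
  by have := xP 0%N; rewrite /= /D expr0 divr1; lra.
have yt : t0 <= y <= t1.
  by have := yP 0%N; rewrite /= /E expr0 divr1; lra.
have [c Hc] := Hd x y xs yt.
apply/ler_addgt0Pr => e e0; rewrite add0r.
set S := (s1 - s0) + (t1 - t0).
have S0 : 0 <= S by rewrite /S; lra.
pose e' := e / (S ^+ 2 + 1).
have S2 : 0 < S ^+ 2 + 1 by rewrite ltr_wpDl// sqr_ge0.
have e'0 : 0 < e' by rewrite divr_gt0.
have [d d0 Hdd] := Hc e' e'0.
have [n nS] : exists n, S / 2 ^+ n < d.
  have [n _ /(_ n (leqnn n))] :=
    near_infty_natSinv_expn_lt (PosNum (divr_gt0 d0 (ltr_wpDl S0 ltr01))).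
  rewrite /= ltr_pdivlMr ?ltr_wpDl// => nd; exists n; apply: le_lt_trans nd.
  by rewrite div1r mulrC ler_wpM2l ?invr_ge0 ?exprn_ge0// lerDl.
have [i1 i2 i3 i4] := corner_bnd n.
have Dd : D n + E n = S / 2 ^+ n by rewrite /D /E -mulrDl.
have Dn := D_ge0 n; have En := E_ge0 n.
have xn := xP n; have yn := yP n.
set c0 := corner n in i1 i2 i3 i4 xn yn.
have [||||||||Hq Hp] := Hdd c0.1 (c0.1 + D n) c0.2 (c0.2 + E n); try lra.
have Jc : `|Q n c0| <= e' * (S / 2 ^+ n) ^+ 2.
  have ca : s0 <= c0.1 <= s1 by lra.
  have cb : s0 <= c0.1 + D n <= s1 by lra.
  have cu : t0 <= c0.2 <= t1 by lra.
  have cv : t0 <= c0.2 + E n <= t1 by lra.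
  have q1 := cont_onS i3 i4 (cq cb); have q2 := cont_onS i3 i4 (cq ca).
  have p1 := cont_onS i1 i2 (cp cv); have p2 := cont_onS i1 i2 (cp cu).
  have qc := cont_onB q1 q2; have pc := cont_onB p1 p2.
  have B1 : `|segint c0.2 (c0.2 + E n) (fun t => q (c0.1 + D n) t - q c0.1 t - c * D n)|
      <= e' * (S / 2 ^+ n) * E n.
    have := @segint_norm_le _ c0.2 (c0.2 + E n) 
      (fun t => q (c0.1 + D n) t - q c0.1 t - c * D n) (e' * (S / 2 ^+ n)).
    rewrite [X in _ -> _ -> _ -> _ <= _ * X](_ : _ = E n); last lra.
    apply; [lra|by apply: cont_onB => //; exact: cont_on_cst|].
    by move=> t /Hq; rewrite -Dd !(addrC c0.1) !addrK !(addrC c0.2) !addrK.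
  have B2 : `|segint c0.1 (c0.1 + D n) (fun s => p s (c0.2 + E n) - p s c0.2 - c * E n)|
      <= e' * (S / 2 ^+ n) * D n.
    have := @segint_norm_le _ c0.1 (c0.1 + D n) 
      (fun s => p s (c0.2 + E n) - p s c0.2 - c * E n) (e' * (S / 2 ^+ n)).
    rewrite [X in _ -> _ -> _ -> _ <= _ * X](_ : _ = D n); last lra.
    apply; [lra|by apply: cont_onB => //; exact: cont_on_cst|].
    by move=> t /Hp; rewrite -Dd !(addrC c0.1) !addrK !(addrC c0.2) !addrK.
  rewrite segintB// in B1; last exact: cont_on_cst.
  rewrite segintB// in B2; last exact: cont_on_cst.
  rewrite !segint_cst in B1 B2; try lra.
  rewrite [leRHS](_ : _ = e' * (S / 2 ^+ n) * E n + e' * (S / 2 ^+ n) * D n).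
    2: by rewrite -Dd; ring.
  apply: le_trans (lerD B1 B2); rewrite (le_trans _ (ler_normB _ _))//.
  rewrite le_eqVlt; apply/orP; left; apply/eqP; congr `|_|; rewrite /Q/J; ring.
have := le_trans (corner_Q n) Jc.
rewrite expr_div_n -exprM mulnC exprM (_ : 2 ^+ 2 = 4 :> R); last by rewrite -natrX.
rewrite mulrA ler_pM2r ?invr_gt0 ?exprn_gt0// => /le_trans; apply.
by rewrite /e' mulrAC ler_pdivrMr// ler_wpM2l ?(ltW e0)// lerDl.
Qed.

End Goursat.

(** * Real-valued norms and the topology they give *)

(** The complex numbers as a normed module under their own name, so that maps
    defined on the plane can be differentiated. *)
HB.instance Definition _ (R : realType) :=
  NormedModule.copy R[i] (R[i] : numFieldType).

Lemma ler_of_sqr (R : realDomainType) (x y : R) :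
  0 <= y -> x ^+ 2 <= y ^+ 2 -> x <= y.
Proof.
by move=> y0; case: (leP 0 x) => [x0|/ltW/le_trans->//]; rewrite ler_pXn2r// nnegrE.
Qed.

Section RealNorm.
Context {R : realType}.

(** Norms take their values in [R[i]]; the estimates are made in [R]. *)
Definition nrm (V : normedZmodType R[i]) (v : V) : R := Re `|v|.

Lemma nrmE (V : normedZmodType R[i]) (v : V) : `|v| = (nrm v)%:C.
Proof. by apply/esym/RRe_real/normr_real. Qed.

Lemma nrm_ge0 (V : normedZmodType R[i]) (v : V) : 0 <= nrm v.
Proof. by rewrite -lecR -nrmE; exact: normr_ge0. Qed.

Lemma ler_nrmD (V : normedZmodType R[i]) (u v : V) : nrm (u + v) <= nrm u + nrm v.
Proof. by rewrite -lecR rmorphD /= -!nrmE ler_normD. Qed.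

Lemma nrmN (V : normedZmodType R[i]) (v : V) : nrm (- v) = nrm v.
Proof. by rewrite /nrm normrN. Qed.

Lemma nrmB (V : normedZmodType R[i]) (u v : V) : nrm (u - v) = nrm (v - u).
Proof. by rewrite /nrm distrC. Qed.

Lemma ler_nrmB (V : normedZmodType R[i]) (u v : V) : nrm (u - v) <= nrm u + nrm v.
Proof. by rewrite -(nrmN v) ler_nrmD. Qed.

Lemma nrm0 (V : normedZmodType R[i]) : nrm (0 : V) = 0.
Proof. by rewrite /nrm normr0. Qed.

Lemma nrm_eq0 (V : normedZmodType R[i]) (v : V) : (nrm v == 0) = (v == 0).
Proof. by rewrite -(inj_eq (@complexI R)) -nrmE normr_eq0. Qed.

Lemma nrmZ (V : normedModType R[i]) (a : R[i]) (v : V) : nrm (a *: v) = nrm a * nrm v.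
Proof. by apply: (@complexI R); rewrite rmorphM /= -!nrmE normrZ. Qed.

Lemma nrmM (a b : R[i]) : nrm (a * b) = nrm a * nrm b.
Proof. by apply: (@complexI R); rewrite rmorphM /= -!nrmE normrM. Qed.

Lemma nrmV (a : R[i]) : nrm a^-1 = (nrm a)^-1.
Proof. by apply: (@complexI R); rewrite fmorphV /= -!nrmE normfV. Qed.

Lemma nrmC (x : R) : nrm x%:C = `|x|.
Proof. by rewrite /nrm normc_def /= expr0n /= addr0 sqrtr_sqr. Qed.

Lemma nrm1 : nrm (1 : R[i]) = 1.
Proof. by rewrite -[1 in LHS]/(1%:C) nrmC normr1. Qed.

Lemma Re_le_nrm (z : R[i]) : `|Re z| <= nrm z.
Proof. by rewrite -lecR -nrmE normc_ge_Re. Qed.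

Lemma sqr_nrm (z : R[i]) : nrm z ^+ 2 = Re z ^+ 2 + Im z ^+ 2.
Proof. by apply: (@complexI R); rewrite rmorphXn /= -nrmE -add_Re2_Im2. Qed.

Lemma Im_le_nrm (z : R[i]) : `|Im z| <= nrm z.
Proof.
apply: ler_of_sqr; first exact: nrm_ge0.
by rewrite sqr_nrm real_normK ?num_real// lerDr sqr_ge0.
Qed.

Lemma nrmJ (z : R[i]) : nrm z^* = nrm z.
Proof. by rewrite /nrm normcJ. Qed.

Lemma nbhs_nrmP (V : normedModType R[i]) (x : V) (A : set V) :
  nbhs x A <-> exists2 d, 0 < d & forall y, nrm (y - x) < d -> A y.
Proof.
split.
  move=> /nbhs_ballP[d /= d0 dA].
  have dr : d = (Re d)%:C by apply/esym/RRe_real/gtr0_real.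
  exists (Re d); first by rewrite -ltcR -dr.
  move=> y yx; apply: dA; rewrite -ball_normE /ball_ /= distrC nrmE dr ltcR.
  by [].
move=> [d d0 dA]; apply/nbhs_ballP; exists d%:C => /=; first by rewrite ltcR.
by move=> y; rewrite -ball_normE /ball_ /= distrC nrmE ltcR => /dA.
Qed.

Lemma differentiable_eps_delta (V W : normedModType R[i]) (f : V -> W) (x : V)
    (e : R) : differentiable f x -> 0 < e ->
  exists2 d, 0 < d & forall y, nrm (y - x) < d -> nrm (f y - f x) < e.
Proof.
move=> df e0.
have ne : nbhs (f x) [set y | nrm (y - f x) < e] by apply/nbhs_nrmP; exists e.
by have /nbhs_nrmP[d d0 dP] := differentiable_continuous df ne; exists d.
Qed.

End RealNorm.

(** * Contraction of the unit circle to a point inside it *)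

Section CauchyCircle.
Context {R : realType}.
Local Notation C := R[i].

Definition cis (t : R) : C := cos t +i* sin t.

Lemma nrm_cis t : nrm (cis t) = 1.
Proof. by rewrite /nrm normc_def /= cos2Dsin2 sqrtr1. Qed.

Lemma lip1_of_derive (f df : R -> R) (x y : R) : (forall t : R, is_derive t 1 f (df t)) ->
  (forall t, `|df t| <= 1) -> `|f y - f x| <= `|y - x|.
Proof.
move=> fd d1.
wlog xy : x y / x <= y.
  by move=> h; case: (leP x y) => [/h//|/ltW /h]; rewrite distrC [in leRHS]distrC.
have [|c _ ->] := @MVT_segment R f df x y xy (fun t _ => fd t).
  by apply: continuous_subspaceT => t; apply: differentiable_continuous;
    exact/derivable1_diffP.
by rewrite normrM ler_piMl.
Qed.

Lemma cis_lip s t : nrm (cis s - cis t) <= 2 * `|s - t|.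
Proof.
have c : `|cos s - cos t| <= `|s - t|.
  apply: (@lip1_of_derive _ (fun t => - sin t)) => u; rewrite normrN sin_max//.
have d : `|sin s - sin t| <= `|s - t|.
  by apply: (@lip1_of_derive _ cos) => u; rewrite cos_max.
rewrite -(ler_pXn2r (ltn0Sn 1)) ?nnegrE ?nrm_ge0 ?mulr_ge0// sqr_nrm.
rewrite exprMn -!(real_normK (num_real (_ - _))) -natrX.
have := ler_pXn2r (ltn0Sn 1) (normr_ge0 (cos s - cos t)) (normr_ge0 (s - t)).
rewrite c => c2.
have := ler_pXn2r (ltn0Sn 1) (normr_ge0 (sin s - sin t)) (normr_ge0 (s - t)).
rewrite d => d2.
have := sqr_ge0 `|s - t|; rewrite /= in c2 d2 *; lra.
Qed.

Lemma cis_taylor u t v : u <= t <= v ->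
  nrm (cis v - cis u - (v - u)%:C * ('i%C * cis t)) <= 2 * (v - u) ^+ 2.
Proof.
move=> /andP[ut tv]; have uv := le_trans ut tv.
have [|x xuv cE] := @MVT_segment R cos (fun t => - sin t) u v uv (fun t _ => is_derive_cos t).
  exact/continuous_subspaceT/continuous_cos.
have [|y yuv sE] := @MVT_segment R sin cos u v uv (fun t _ => is_derive_sin t).
  exact/continuous_subspaceT/continuous_sin.
rewrite !in_itv /= in xuv yuv.
have -> : cis v - cis u - (v - u)%:C * ('i%C * cis t) =
    ((sin t - sin x) * (v - u)) +i* ((cos y - cos t) * (v - u)).
  apply/eqP; rewrite eq_complex /=; apply/andP; split; apply/eqP.
    by rewrite cE; ring.
  by rewrite sE; ring.
have c : `|cos y - cos t| <= `|y - t|.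
  by apply: (@lip1_of_derive _ (fun t => - sin t)) => w; rewrite normrN sin_max.
have d : `|sin t - sin x| <= `|t - x|.
  by apply: (@lip1_of_derive _ cos) => w; rewrite cos_max.
have c' : `|cos y - cos t| <= v - u.
  by apply: le_trans c _; rewrite ler_norml; lra.
have d' : `|sin t - sin x| <= v - u.
  by apply: le_trans d _; rewrite ler_norml; lra.
apply: ler_of_sqr; first by rewrite mulr_ge0// sqr_ge0.
rewrite sqr_nrm /=.
rewrite !exprMn -!(real_normK (num_real (_ - _))) -natrX.
rewrite -(ler_pXn2r (ltn0Sn 1)) ?nnegrE// ?subr_ge0// in c'.
rewrite -(ler_pXn2r (ltn0Sn 1)) ?nnegrE// ?subr_ge0// in d'.
rewrite (ger0_norm (_ : 0 <= v - u)) ?subr_ge0//.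
have := sqr_ge0 (v - u); set w := (v - u) ^+ 2 in c' d' *; nra.
Qed.

Lemma cis2pi : cis (pi *+ 2) = cis 0.
Proof. by rewrite /cis cos2pi sin2pi cos0 sin0. Qed.

Variable a : R.
Hypothesis a01 : 0 <= a < 1.

Definition arm (t : R) : C := cis t - a%:C.

Lemma arm_lb t : 1 - a <= nrm (arm t).
Proof.
have := ler_nrmD (arm t) a%:C; rewrite /arm subrK nrm_cis nrmC.
by rewrite ger0_norm ?(andP a01).1//; lra.
Qed.

Lemma arm_neq0 t : arm t != 0.
Proof.
by rewrite -nrm_eq0 gt_eqF// (lt_le_trans _ (arm_lb t))// subr_gt0 (andP a01).2.
Qed.

Lemma arm_ub t : nrm (arm t) <= 2.
Proof.
have := ler_nrmB (cis t) a%:C; rewrite nrm_cis nrmC ger0_norm ?(andP a01).1//.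
by move/le_trans; apply; have := a01; lra.
Qed.

(** The Cauchy kernel at [a]: with w = [cis t], [kappa t] dt is
    dw / (i (w - a)). *)
Definition kappa (t : R) : C := cis t / arm t.

Lemma kappaE t : kappa t * arm t = cis t.
Proof. by rewrite /kappa divfK// arm_neq0. Qed.

Lemma nrm_kappa t : nrm (kappa t) <= (1 - a)^-1.
Proof.
rewrite nrmM nrm_cis mul1r nrmV lef_pV2 ?arm_lb// posrE.
  by rewrite (lt_le_trans _ (arm_lb t))// subr_gt0 (andP a01).2.
by rewrite subr_gt0 (andP a01).2.
Qed.

Definition spoke (s t : R) : C := a%:C + s%:C * arm t.

Lemma nrm_spoke s t : 0 <= s <= 1 -> nrm (spoke s t) <= 1.
Proof.
move=> /andP[s0 s1].
have -> : spoke s t = ((1 - s) * a)%:C + s%:C * cis t.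
  by rewrite /spoke /arm rmorphM rmorphB /= rmorph1; ring.
apply: le_trans (ler_nrmD _ _) _; rewrite nrmM nrm_cis !nrmC mulr1.
rewrite !ger0_norm ?mulr_ge0 ?subr_ge0 ?(andP a01).1//.
by have /andP[a0 /ltW a1] := a01; nra.
Qed.

Lemma spoke_lip s t s' t' : 0 <= s <= 1 ->
  nrm (spoke s' t' - spoke s t) <= 2 * (`|s' - s| + `|t' - t|).
Proof.
move=> /andP[s0 s1].
have -> : spoke s' t' - spoke s t = (s' - s)%:C * arm t' + s%:C * (cis t' - cis t).
  by rewrite /spoke /arm rmorphB /=; ring.
apply: le_trans (ler_nrmD _ _) _; rewrite !nrmM !nrmC (ger0_norm s0) mulrDr.
apply: lerD; first by rewrite mulrC ler_wpM2r// arm_ub.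
apply: le_trans (cis_lip t' t).
by rewrite ler_piMl ?nrm_ge0.
Qed.

Lemma Re_continuous : continuous (@complex.Re R).
Proof.
move=> z A /nbhs_ballP[d /= d0 dA]; apply/nbhs_nrmP; exists d => // w wz.
apply: dA; rewrite /ball/= distrC -[_ - _]/(Re w - Re z).
apply: le_lt_trans wz; apply: le_trans (Re_le_nrm _).
by case: w z => [? ?] [? ?].
Qed.

Lemma Im_continuous : continuous (@complex.Im R).
Proof.
move=> z A /nbhs_ballP[d /= d0 dA]; apply/nbhs_nrmP; exists d => // w wz.
apply: dA; rewrite /ball/= distrC -[_ - _]/(Im w - Im z).
apply: le_lt_trans wz; apply: le_trans (Im_le_nrm _).
by case: w z => [? ?] [? ?].
Qed.

Lemma lip_cont (g : R -> C) k x : (forall y, nrm (g y - g x) <= k * `|y - x|) ->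
  {for x, continuous g}.
Proof.
move=> gk A /nbhs_nrmP[d d0 dA]; apply/nbhs_ballP.
have k1 : 0 < `|k| + 1 by rewrite ltr_wpDl.
exists (d / (`|k| + 1)) => /=; first by rewrite divr_gt0.
move=> y; rewrite /ball/= distrC => yx; apply: dA.
apply: le_lt_trans (gk y) _; move: yx; rewrite ltr_pdivlMr// mulrC.
apply: le_lt_trans; rewrite ler_wpM2r// (le_trans (ler_norm k))// lerDl//.
Qed.

Lemma differentiable_estP (V : normedModType C) (f : C -> V) z :
  differentiable f z <->
  exists c, forall e, 0 < e -> exists2 d, 0 < d & forall w, nrm (w - z) < d ->
    nrm (f w - f z - (w - z) *: c) <= e * nrm (w - z).
Proof.
split=> [/derivable1_diffP/derivable_nbhsx df|[c fc]].
  exists ('D_1 f z) => e e0.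
  have /eqaddoP dfe : (fun h => f (z + h *: 1)) = (fun h => f z + h *: 'D_1 f z) +o_ (nbhs 0) id.
    by apply/eqaddoE; rewrite funeqE => h; exact: df.
  have e0' : 0 < e%:C by rewrite ltcR.
  have /nbhs_nrmP[d d0 dP] := dfe _ e0'.
  exists d => // w wz; have := dP (w - z); rewrite subr0 => /(_ wz).
  rewrite /= !nrmE -rmorphM lecR; congr (nrm _ <= _).
  rewrite -[LHS]/(f (z + (w - z) * 1) - (f z + (w - z) *: 'D_1 f z)).
  by rewrite mulr1 [z + _]addrC subrK opprD addrA.
apply/derivable1_diffP; apply: (@cvgP _ _ c).
move=> A /nbhs_nrmP[e e0 eA].
have [d d0 dP] := fc _ (divr_gt0 e0 (@ltr0Sn R 1)).
apply/nbhs_nrmP; exists d => // h; rewrite subr0 => hd h0; apply: eA => /=.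
have nh : 0 < nrm h by rewrite lt_neqAle nrm_ge0 eq_sym nrm_eq0 h0.
have := dP (h + z); rewrite addrK => /(_ hd) le.
have -> : h^-1 *: (f (h%:A + z) - f z) - c = h^-1 *: (f (h + z) - f z - h *: c).
  by rewrite [in RHS]scalerBr scalerA mulVf// scale1r -[h%:A]/(h * 1) mulr1.
rewrite nrmZ nrmV ltr_pdivrMl//; apply: le_lt_trans le _.
by rewrite mulrC ltr_pM2l// ltr_pdivrMr// ltr_pMr// ltr1n.
Qed.

Lemma differentiable_est (f : C -> C) z : differentiable f z ->
  exists c, forall e, 0 < e -> exists2 d, 0 < d &
    forall w, nrm (w - z) < d -> nrm (f w - f z - c * (w - z)) <= e * nrm (w - z).
Proof.
move=> /differentiable_estP[c fc]; exists c => e /fc[d d0 dP].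
exists d => // w /dP; by rewrite -[(w - z) *: c]/((w - z) * c) mulrC.
Qed.

Section Mean.
Variable f : C -> C.
Hypothesis df : forall z, nrm z <= 1 -> differentiable f z.

Let F s t := f (spoke s t).

Lemma cis_continuous : continuous cis.
Proof. by move=> t; apply: (@lip_cont _ 2) => s; exact: cis_lip. Qed.

Lemma kappa_continuous : continuous kappa.
Proof.
move=> t; have carm : {for t, continuous arm}.
  apply: (@lip_cont _ 2) => s; rewrite /arm opprB addrA subrK.
  exact: cis_lip.
exact: continuousM (@cis_continuous t) (continuousV (arm_neq0 t) carm).
Qed.

Let F_cont_t s t : 0 <= s <= 1 -> {for t, continuous (F s)}.
Proof.
move=> s01; apply: continuous_comp.
  apply: (@lip_cont _ 2) => t'; have := @spoke_lip s t s t' s01.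
  by rewrite subrr normr0 add0r.
exact/differentiable_continuous/df/nrm_spoke.
Qed.

Let F_cont_s s t : 0 <= s <= 1 -> {for s, continuous (F^~ t)}.
Proof.
move=> s01; apply: (@continuous_comp _ _ _ (spoke^~ t) f).
  apply: (@lip_cont _ 2) => s'; have := @spoke_lip s t s' t s01.
  by rewrite subrr normr0 addr0.
exact/differentiable_continuous/df/nrm_spoke.
Qed.

Let q s t := Re (kappa t * F s t).
Let p s t := Im (F s t) / s.

Lemma circle_integrand_cont s u v : 0 <= s <= 1 ->
  cont_on u v (fun t => Re (kappa t * f (spoke s t))).
Proof.
move=> s01 t _; apply: continuous_comp; last exact: Re_continuous.
by apply: continuousM; [exact: kappa_continuous|exact: F_cont_t].
Qed.

Let p_cont t s0 : 0 < s0 -> cont_on s0 1 (p^~ t).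
Proof.
move=> s00 s /andP[s0s s1]; have s_gt0 := lt_le_trans s00 s0s.
apply: continuousM; last by apply: continuousV; [rewrite gt_eqF|exact: cvg_id].
apply: continuous_comp; last exact: Im_continuous.
by apply: F_cont_s; rewrite s1 ltW.
Qed.

(** On the point z = a + s (cis t - a) put the real part of f z dz / (i (z - a)).
    In the coordinates (s, t) it is q dt + p ds with q and p as above; it is
    closed because [f] is holomorphic, and its sides t = 0 and t = 2 pi cancel,
    so that the integral over t does not depend on s. *)
Lemma spoke_integral_const s0 : 0 < s0 <= 1 ->
  segint 0 (pi *+ 2) (fun t => Re (kappa t * f (spoke 1 t))) =
  segint 0 (pi *+ 2) (fun t => Re (kappa t * f (spoke s0 t))).
Proof.
change (0 < s0 <= 1 ->
  segint 0 (pi *+ 2) (q 1) = segint 0 (pi *+ 2) (q s0)).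
move=> /andP[s0_gt0 s0_le1].
have pi2 : 0 <= pi *+ 2 :> R by rewrite mulrn_wge0// pi_ge0.
apply/eqP; rewrite -subr_eq0 -segintB; try by apply: circle_integrand_cont; lra.
rewrite (@goursat R p q s0 1 0 (pi *+ 2)) //.
- rewrite (@eq_segint _ _ _ _ (fun=> 0)) ?segint_cst ?mul0r// => s _.
  by rewrite /p /F /spoke /arm cis2pi subrr.
- by move=> s s01; apply: circle_integrand_cont; lra.
- by move=> t _; apply: p_cont.
move=> s t /andP[s0s s1] tt.
have s01 : 0 <= s <= 1 by lra.
have [c cP] := differentiable_est (df (nrm_spoke t s01)).
(* q = Re (kappa f) has s-derivative Re (kappa arm f') and p = Im f / s has
   t-derivative Im (i cis t f'), and both are Re (f' cis t). *)
exists (Re (c * cis t)) => e e0.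
pose M := (1 - a)^-1 + s0^-1.
have a1 : 0 < 1 - a by have := a01; lra.
have M1 : (1 - a)^-1 <= M by rewrite lerDl invr_ge0 ltW.
have M2 : s0^-1 <= M by rewrite lerDr invr_ge0 ltW.
have M0 : 0 < M by rewrite addr_gt0 ?invr_gt0.
pose e' := e / (8 * M).
have e'0 : 0 < e' by rewrite divr_gt0// mulr_gt0.
have [d d0 dP] := cP e' e'0.
pose d' := Num.min (d / 4) (e / (4 * (nrm c + 1))).
have c1 : 0 < nrm c + 1 by rewrite ltr_wpDl// nrm_ge0.
exists d'; first by rewrite lt_min !divr_gt0// mulr_gt0.
move=> x b u v s0x /andP[xs sb] b1 u0 /andP[ut tv] v1 bx vu.
have [bx1 bx2] : b - x < d / 4 /\ b - x < e / (4 * (nrm c + 1)).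
  by move: bx; rewrite lt_min => /andP.
have [vu1 vu2] : v - u < d / 4 /\ v - u < e / (4 * (nrm c + 1)).
  by move: vu; rewrite lt_min => /andP.
set S := (b - x) + (v - u).
have est s' t' : x <= s' <= b -> u <= t' <= v ->
    nrm (F s' t' - F s t - c * (spoke s' t' - spoke s t)) <= e' * (2 * S).
  move=> xb uv.
  have A : nrm (spoke s' t' - spoke s t) <= 2 * S.
    apply: le_trans (spoke_lip _ _ _ s01) _.
    have : `|s' - s| <= b - x by rewrite ler_norml; lra.
    have : `|t' - t| <= v - u by rewrite ler_norml; lra.
    by rewrite /S; lra.
  apply: le_trans (dP _ _) _; first by apply: le_lt_trans A _; rewrite /S; lra.
  by rewrite ler_wpM2l// ltW.
have est2 s1' t1' s2' t2' : x <= s1' <= b -> u <= t1' <= v ->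
    x <= s2' <= b -> u <= t2' <= v ->
    nrm (F s1' t1' - F s2' t2' - c * (spoke s1' t1' - spoke s2' t2')) <= e' * (4 * S).
  move=> h1 h2 h3 h4.
  have -> : F s1' t1' - F s2' t2' - c * (spoke s1' t1' - spoke s2' t2') =
     (F s1' t1' - F s t - c * (spoke s1' t1' - spoke s t)) -
     (F s2' t2' - F s t - c * (spoke s2' t2' - spoke s t)) by ring.
  apply: le_trans (ler_nrmB _ _) _.
  have := est _ _ h1 h2; have := est _ _ h3 h4; lra.
have S0 : 0 <= S by rewrite /S; lra.
have e'E : e' * (4 * S) * M = e / 2 * S.
  by rewrite /e'; field; rewrite gt_eqF.
split.
  move=> t' ut'.
  have -> : q b t' - q x t' - Re (c * cis t) * (b - x) =
      Re (kappa t' * (F b t' - F x t' - c * (spoke b t' - spoke x t'))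
          + (b - x)%:C * c * (cis t' - cis t)).
    have -> : kappa t' * (F b t' - F x t' - c * (spoke b t' - spoke x t'))
          + (b - x)%:C * c * (cis t' - cis t) =
        kappa t' * F b t' - kappa t' * F x t' - (b - x)%:C * (c * cis t).
      rewrite -[in X in _ + X](kappaE t') /spoke rmorphB /=; ring.
    rewrite /q; case: (kappa t' * F b t') (kappa t' * F x t') (c * cis t) => [? ?] [? ?] [? ?] /=.
    by rewrite mul0r subr0; ring.
  apply: le_trans (Re_le_nrm _) _; apply: le_trans (ler_nrmD _ _) _.
  rewrite nrmM.
  have E1 := est2 b t' x t' ltac:(lra) ut' ltac:(lra) ut'.
  have : nrm (kappa t') * nrm (F b t' - F x t' - c * (spoke b t' - spoke x t')) <= e / 2 * S.
    rewrite -e'E [leRHS]mulrC ler_pM ?nrm_ge0//.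
    exact: le_trans (nrm_kappa t') M1.
  have : nrm ((b - x)%:C * c * (cis t' - cis t)) <= e / 2 * S.
    rewrite !nrmM nrmC ger0_norm; last by lra.
    have A1 : nrm (cis t' - cis t) <= 2 * S.
      apply: le_trans (cis_lip _ _) _; rewrite ler_pM2l//.
      by rewrite ler_norml /S; lra.
    have A2 : (b - x) * nrm c <= e / 4.
      have : (b - x) * (nrm c + 1) <= e / 4.
        rewrite -ler_pdivlMr// (le_trans (ltW bx2))// invfM mulrA//.
      by have := nrm_ge0 c; nra.
    have : (b - x) * nrm c * nrm (cis t' - cis t) <= (e / 4) * (2 * S).
      by rewrite ler_pM ?nrm_ge0// mulr_ge0 ?nrm_ge0//; lra.
    lra.
  lra.
move=> s' xs'.
have s'0 : 0 < s' by lra.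
have -> : p s' v - p s' u - Re (c * cis t) * (v - u) =
  Im (s'^-1%:C * (F s' v - F s' u - c * (spoke s' v - spoke s' u))
     + c * (cis v - cis u - (v - u)%:C * ('i%C * cis t))).
  have -> : s'^-1%:C * (F s' v - F s' u - c * (spoke s' v - spoke s' u))
     + c * (cis v - cis u - (v - u)%:C * ('i%C * cis t)) =
     s'^-1%:C * F s' v - s'^-1%:C * F s' u - 'i%C * ((v - u)%:C * (c * cis t)).
    have s'n : s'%:C != 0 :> C by rewrite fmorph_eq0 gt_eqF.
    rewrite fmorphV /spoke /arm /=; field.
    by [].
  rewrite /p; case: (F s' v) (F s' u) (c * cis t) => [? ?] [? ?] [? ?] /=.
  by ring.
apply: le_trans (Im_le_nrm _) _; apply: le_trans (ler_nrmD _ _) _.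
have E1 := est2 s' v s' u xs' ltac:(lra) xs' ltac:(lra).
have : nrm (s'^-1%:C * (F s' v - F s' u - c * (spoke s' v - spoke s' u))) <= e / 2 * S.
  rewrite -e'E [leRHS]mulrC nrmM nrmC ler_pM ?nrm_ge0//.
  rewrite ger0_norm ?invr_ge0 ?(ltW s'0)//; apply: le_trans M2.
  by rewrite lef_pV2// ?posrE//; lra.
have : nrm (c * (cis v - cis u - (v - u)%:C * ('i%C * cis t))) <= e / 2 * S.
  rewrite nrmM.
  have A1 := @cis_taylor u t v ltac:(lra).
  have A2 : (v - u) * nrm c <= e / 4.
    have : (v - u) * (nrm c + 1) <= e / 4.
      rewrite -ler_pdivlMr// (le_trans (ltW vu2))// invfM mulrA//.
    by have := nrm_ge0 c; nra.
  apply: (@le_trans _ _ (2 * (v - u) * ((v - u) * nrm c))).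
    apply: le_trans (ler_wpM2l (nrm_ge0 c) A1) _.
    by rewrite expr2 le_eqVlt; apply/orP; left; apply/eqP; ring.
  apply: (@le_trans _ _ (2 * (v - u) * (e / 4))); first by rewrite ler_wpM2l//; lra.
  rewrite /S; nra.
lra.
Qed.

End Mean.
End CauchyCircle.

(** * Cauchy's formula on the unit disc *)

Section CauchyFormula.
Context {R : realType}.
Local Notation C := R[i].
Local Notation cj := (@conjc R).

(** The circle is contracted along the spokes; near [a] the values of [f] are
    close to [f a]. *)
Lemma circle_integral_center (a : R) (f : C -> C) : 0 <= a < 1 ->
  (forall z, nrm z <= 1 -> differentiable f z) ->
  segint 0 (pi *+ 2) (fun t => Re (kappa a t * f (cis t))) =
  segint 0 (pi *+ 2) (fun t => Re (kappa a t * f a%:C)).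
Proof.
move=> a01 df.
pose F s t := f (spoke a s t).
pose q s t := Re (kappa a t * F s t).
have q_cont s u v : 0 <= s <= 1 -> cont_on u v (q s) by exact: circle_integrand_cont.
have a1 : 0 < 1 - a by have := a01; lra.
have pi2 : 0 <= pi *+ 2 :> R by rewrite mulrn_wge0// pi_ge0.
have -> : (fun t => Re (kappa a t * f (cis t))) = q 1.
  by rewrite funeqE => t; rewrite /q /F /spoke /arm mul1r addrC subrK.
have cc u v : cont_on u v (fun t => Re (kappa a t * f a%:C)).
  move=> t _; apply: continuous_comp; last exact: Re_continuous.
  by apply: continuousM; [exact: kappa_continuous|exact: cvg_cst].
apply/eqP; rewrite -subr_eq0 -normr_le0; apply/ler_addgt0Pr => e e0; rewrite add0r.
have na : nrm (a%:C : C) <= 1.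
  by rewrite nrmC ger0_norm; have := a01; lra.
pose e' := e * (1 - a) / (pi *+ 2 + 1).
have pi21 : 0 < pi *+ 2 + 1 :> R by rewrite ltr_wpDl.
have e'0 : 0 < e' by rewrite divr_gt0// mulr_gt0.
have [d d0 dP] := differentiable_eps_delta (df _ na) e'0.
pose s0 := Num.min 1 (d / 4).
have s0_gt0 : 0 < s0 by rewrite lt_min ltr01 divr_gt0.
have s01 : 0 <= s0 <= 1 by rewrite (ltW s0_gt0) ge_min lexx.
have s0d : s0 <= d / 4 by rewrite ge_min lexx orbT.
rewrite (spoke_integral_const a01 df (_ : 0 < s0 <= 1)) ?s0_gt0 ?(andP s01).2//.
rewrite -segintB//; last exact: q_cont.
have -> : e = e / (pi *+ 2 + 1) * (pi *+ 2 + 1) by rewrite divfK// gt_eqF.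
apply: (@le_trans _ _ (e / (pi *+ 2 + 1) * (pi *+ 2 - 0))); last first.
  by rewrite ler_wpM2l ?divr_ge0 ?(ltW e0) ?(ltW pi21)// subr0 lerDl.
apply: segint_norm_le => //; first by apply: cont_onB => //; exact: q_cont.
move=> t _; rewrite /q.
have -> : Re (kappa a t * F s0 t) - Re (kappa a t * f a%:C) = Re (kappa a t * (F s0 t - f a%:C)).
  by rewrite mulrBr; case: (kappa a t * F s0 t) (kappa a t * f a%:C) => [? ?] [? ?].
apply: le_trans (Re_le_nrm _) _; rewrite nrmM.
have A : nrm (F s0 t - f a%:C) <= e'.
  apply/ltW/dP; rewrite /spoke addrC addKr nrmM nrmC ger0_norm ?(ltW s0_gt0)//.
  have := arm_ub a01 t; have := nrm_ge0 (arm a t); nra.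
have := ler_pM (nrm_ge0 _) (nrm_ge0 _) (nrm_kappa a01 t) A.
move/le_trans; apply; rewrite /e' le_eqVlt; apply/orP; left; apply/eqP.
by set P := pi *+ 2 + 1 in pi21 *; field; rewrite !gt_eqF//=.
Qed.

Lemma mean_value (f : C -> C) : (forall z, nrm z <= 1 -> differentiable f z) ->
  segint 0 (pi *+ 2) (fun t => Re (f (cis t))) = pi *+ 2 * Re (f 0).
Proof.
move=> df; have z01 : 0 <= (0 : R) < (1 : R) by rewrite lexx ltr01.
have k1 (t : R) : kappa 0 t = 1.
  have e : arm 0 t = cis t by rewrite /arm subr0.
  by rewrite /kappa e divff// -e; exact: arm_neq0 z01 t.
have := circle_integral_center z01 df.
under eq_segint do rewrite k1 mul1r.
under [in RHS]eq_segint do rewrite k1 mul1r.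
move=> ->; rewrite segint_cst ?subr0 1?mulrC//.
by rewrite mulrn_wge0// pi_ge0.
Qed.

Lemma szego_den_neq0 (a : R) (z : C) : 0 <= a < 1 -> nrm z <= 1 ->
  1 - a%:C * z != 0.
Proof.
move=> a01 z1; rewrite subr_eq0; apply/eqP => /(congr1 (@nrm R _)).
by rewrite nrmM nrm1 nrmC ger0_norm ?(andP a01).1//; have := nrm_ge0 z; nra.
Qed.

Lemma differentiable_szego (a : R) (z : C) : 0 <= a < 1 -> nrm z <= 1 ->
  differentiable (fun z : C => (1 - a%:C * z)^-1 : C) z.
Proof.
move=> a01 z1; apply: differentiableV; last exact: szego_den_neq0.
apply: differentiableB; first exact: differentiable_cst.
by apply: differentiableM; [exact: differentiable_cst|exact: ex_diff].
Qed.

Lemma conj_cis t : cj (cis t) * cis t = 1 :> C.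
Proof.
apply/eqP; rewrite eq_complex /= !mulNr opprK mulrC -!expr2 cos2Dsin2.
by rewrite [sin t * _]mulrC subrr !eqxx.
Qed.

(** Contraction replaces [f] by the constant [f a]. What remains is the integral
    of [kappa a] alone, and its conjugate consists of the boundary values of the
    holomorphic function 1 / (1 - a z), so the mean value property gives it. *)
Lemma cauchy_formula (a : R) (f : C -> C) : 0 <= a < 1 ->
  (forall z, nrm z <= 1 -> differentiable f z) ->
  segint 0 (pi *+ 2) (fun t => Re (kappa a t * f (cis t))) = pi *+ 2 * Re (f a%:C).
Proof.
move=> a01 df; rewrite circle_integral_center//.
pose g (z : C) := cj (f a%:C) * (1 - a%:C * z)^-1.
have dg z : nrm z <= 1 -> differentiable g z.
  move=> z1; apply: differentiableM; first exact: differentiable_cst.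
  exact: differentiable_szego.
have g0 : g 0 = cj (f a%:C) by rewrite /g mulr0 subr0 invr1 mulr1.
have h := mean_value dg; rewrite g0 in h.
have -> : Re (f a%:C) = Re (cj (f a%:C)) by case: (f _).
rewrite -h; apply: eq_segint => t _.
have -> : g (cis t) = cj (kappa a t * f a%:C); last by case: (_ * _).
transitivity (cj (kappa a t) * cj (f a%:C)); last first.
  case: (kappa a t) (f a%:C) => [? ?] [? ?]; apply/eqP; rewrite eq_complex /=.
  by apply/andP; split; apply/eqP; ring.
rewrite /g mulrC; congr (_ * _).
have cr : cj a%:C = a%:C :> C by exact: conjc_real.
have -> : cj (kappa a t) = cj (cis t) / (cj (cis t) - a%:C).
  by rewrite /kappa /arm fmorph_div rmorphB; congr (_ / (_ - _)); exact: cr.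
have c0 : cis t != 0 :> C by rewrite -nrm_eq0 nrm_cis oner_eq0.
have -> : cj (cis t) = (cis t)^-1 :> C.
  by apply: (mulIf c0); rewrite conj_cis mulVf.
have -> : 1 - a%:C * cis t = cis t * ((cis t)^-1 - a%:C).
  by rewrite mulrBr divff// [cis t * _]mulrC.
by rewrite invfM.
Qed.

End CauchyFormula.

(** * Inner products *)

Section RealInner.
Context {R : realType}.
Local Notation C := R[i].
Local Notation cj := (@conjc R).
Variable V : hilbertType R.
Implicit Types u v w : V.

Lemma conjcM (a b : C) : cj (a * b) = cj a * cj b.
Proof. exact: (rmorphM (@conjc R)). Qed.
Lemma innerDl u v w : inner (u + v) w = inner u w + inner v w :> C.
Proof. exact: linearDl. Qed.
Lemma innerDr u v w : inner u (v + w) = inner u v + inner u w :> C.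
Proof. exact: linearDr. Qed.
Lemma innerNl u v : inner (- u) v = - inner u v :> C.
Proof. exact: linearNl. Qed.
Lemma innerBl u v w : inner (u - v) w = inner u w - inner v w :> C.
Proof. exact: linearBl. Qed.
Lemma innerZl (c : C) u v : inner (c *: u) v = c * inner u v.
Proof. exact: linearZl_LR. Qed.
Lemma innerC u v : inner u v = cj (inner v u).
Proof. by rewrite (hermC inner u v) expr0 mul1r. Qed.
Lemma innerZr (c : C) u v : inner u (c *: v) = cj c * inner u v.
Proof. by rewrite innerC innerZl conjcM -innerC. Qed.
Lemma inner0l u : inner 0 u = 0 :> C.
Proof. exact: linear0l. Qed.
Lemma inner0r u : inner u 0 = 0 :> C.
Proof. exact: linear0r. Qed.

Definition rdot u v : R := Re (inner u v).

Lemma innerxx u : inner u u = (nrm u ^+ 2)%:C.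
Proof. by rewrite -normr_inner nrmE rmorphXn. Qed.

Lemma rdotxx u : rdot u u = nrm u ^+ 2.
Proof. by rewrite /rdot innerxx. Qed.
Lemma rdotC u v : rdot u v = rdot v u.
Proof. by rewrite /rdot innerC; case: (inner v u). Qed.
Lemma rdotDl u v w : rdot (u + v) w = rdot u w + rdot v w.
Proof. by rewrite /rdot innerDl; case: (inner u w) (inner v w) => [? ?] [? ?]. Qed.
Lemma rdotNl u v : rdot (- u) v = - rdot u v.
Proof. by rewrite /rdot innerNl; case: (inner u v) => [? ?]. Qed.
Lemma rdotZl (c : R) u v : rdot (c%:C *: u) v = c * rdot u v.
Proof. by rewrite /rdot innerZl; case: (inner u v) => [? ?] /=; rewrite mul0r subr0. Qed.
Lemma rdotDr u v w : rdot w (u + v) = rdot w u + rdot w v.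
Proof. by rewrite rdotC rdotDl !(rdotC w). Qed.
Lemma rdotNr u v : rdot v (- u) = - rdot v u.
Proof. by rewrite rdotC rdotNl (rdotC v). Qed.
Lemma rdotZr (c : R) u v : rdot v (c%:C *: u) = c * rdot v u.
Proof. by rewrite rdotC rdotZl (rdotC v). Qed.
Lemma rdotBl u v w : rdot (u - v) w = rdot u w - rdot v w.
Proof. by rewrite rdotDl rdotNl. Qed.
Lemma rdotBr u v w : rdot w (u - v) = rdot w u - rdot w v.
Proof. by rewrite rdotDr rdotNr. Qed.
Lemma rdot0l u : rdot 0 u = 0.
Proof. by rewrite /rdot inner0l. Qed.
Lemma rdot0r u : rdot u 0 = 0.
Proof. by rewrite /rdot inner0r. Qed.

Lemma sqnrmD u v : nrm (u + v) ^+ 2 = nrm u ^+ 2 + 2 * rdot u v + nrm v ^+ 2.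
Proof. by rewrite -!rdotxx rdotDl !rdotDr (rdotC v u); ring. Qed.

Lemma sqnrmB u v : nrm (u - v) ^+ 2 = nrm u ^+ 2 - 2 * rdot u v + nrm v ^+ 2.
Proof. by rewrite sqnrmD rdotNr nrmN; ring. Qed.

Lemma rdot_le u v : rdot u v <= nrm u * nrm v.
Proof.
have [->|u0] := eqVneq u 0; first by rewrite rdot0l nrm0 mul0r.
have nu : 0 < nrm u by rewrite lt_neqAle nrm_ge0 eq_sym nrm_eq0 u0.
have := sqr_ge0 (nrm ((nrm v)%:C *: u - (nrm u)%:C *: v)).
rewrite sqnrmB !nrmZ !nrmC !ger0_norm ?nrm_ge0// rdotZl rdotZr => h.
have [v0|v0] := eqVneq (nrm v) 0.
  move: v0 => /eqP; rewrite nrm_eq0 => /eqP->; rewrite rdot0r nrm0 mulr0//.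
have nv : 0 < nrm v by rewrite lt_neqAle nrm_ge0 eq_sym v0.
have : 0 <= 2 * (nrm u * nrm v) * (nrm u * nrm v - rdot u v) by nra.
by rewrite pmulr_rge0 ?subr_ge0// !mulr_gt0.
Qed.

Lemma rdot_norm_le u v : `|rdot u v| <= nrm u * nrm v.
Proof.
rewrite ler_norml rdot_le andbT lerNl -rdotNl -[nrm u]nrmN.
exact: rdot_le.
Qed.

Lemma nrm_inner_le u v : nrm (inner u v) <= nrm u * nrm v.
Proof.
have [->|z0] := eqVneq (inner u v) 0; first by rewrite nrm0 mulr_ge0 ?nrm_ge0.
have nz : nrm (inner u v) != 0 by rewrite nrm_eq0.
pose s : C := cj (inner u v) / (nrm (inner u v))%:C.
have s1 : nrm s = 1.
  by rewrite /s nrmM nrmV nrmJ nrmC ger0_norm ?nrm_ge0// divff.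
have := rdot_le (s *: u) v; rewrite nrmZ s1 mul1r /rdot innerZl.
have -> // : s * inner u v = (nrm (inner u v))%:C.
rewrite /s mulrAC [cj _ * _]mulrC.
have -> : inner u v * cj (inner u v) = (nrm (inner u v))%:C ^+ 2.
  by rewrite -nrmE -sqr_normc.
by rewrite expr2 mulfK// fmorph_eq0.
Qed.

End RealInner.

(** * The Pick inequality between two values *)

Section Pick.
Context {R : realType}.
Local Notation C := R[i].
Local Notation cj := (@conjc R).

Lemma Re_circle_cont (f : C -> C) u v :
  (forall z, nrm z <= 1 -> differentiable f z) ->
  cont_on u v (fun t => Re (f (cis t))).
Proof.
move=> df t _; apply: continuous_comp; last exact: Re_continuous.
apply: continuous_comp; first exact: cis_continuous.
by apply/differentiable_continuous/df; rewrite nrm_cis.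
Qed.

Lemma Re_kappa_cont (a : R) (f : C -> C) u v : 0 <= a < 1 ->
  (forall z, nrm z <= 1 -> differentiable f z) ->
  cont_on u v (fun t => Re (kappa a t * f (cis t))).
Proof.
move=> a01 df t _; apply: continuous_comp; last exact: Re_continuous.
apply: continuousM; first exact: kappa_continuous.
apply: continuous_comp; first exact: cis_continuous.
by apply/differentiable_continuous/df; rewrite nrm_cis.
Qed.

Variable a : R.
Hypothesis a01 : 0 < a < 1.
Let t := 1 - a ^+ 2.
Let a0 : a != 0. Proof. by rewrite gt_eqF//; case/andP: a01. Qed.
Let t0 : 0 < t.
Proof. by rewrite subr_gt0 expr_lt1//; case/andP: a01 => // /ltW. Qed.
Let a01' : 0 <= a < 1. Proof. by case/andP: a01 => /ltW -> ->. Qed.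

(** Among the holomorphic functions that vanish at 0 and are 1 at [a] this one has
    the least mean square on the circle: it is a multiple of z / (1 - a z), which
    represents evaluation at [a] on functions vanishing at 0. *)
Definition peak (z : C) : C := (t / a)%:C * (z / (1 - a%:C * z)).

Lemma peak_differentiable z : nrm z <= 1 -> differentiable peak z.
Proof.
move=> z1; apply: differentiableM; first exact: differentiable_cst.
apply: differentiableM; first exact: ex_diff.
exact: differentiable_szego.
Qed.

Lemma peak0 : peak 0 = 0.
Proof. by rewrite /peak mul0r mulr0. Qed.

Lemma peak_a : peak a%:C = 1.
Proof.
have -> : peak a%:C = (t / a)%:C * (a%:C / t%:C).
  by rewrite /peak /t rmorphB rmorphXn rmorph1 expr2.
by rewrite -fmorphV -!rmorphM mulrA divfK// divff// gt_eqF.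
Qed.

Lemma conj_peak s : cj (peak (cis s)) = (t / a ^+ 2)%:C * (kappa a s - 1).
Proof.
have c0 : cis s != 0 :> C by rewrite -nrm_eq0 nrm_cis oner_eq0.
have cV : cj (cis s) = (cis s)^-1.
  by apply: (mulIf c0); rewrite conj_cis mulVf.
have cr (x : R) : cj x%:C = x%:C by exact: conjc_real.
have cV' (x : C) : cj x^-1 = (cj x)^-1 by rewrite (fmorphV (@conjc R)).
have cB x y : cj (x - y) = cj x - cj y by exact: (rmorphB (@conjc R)).
have c1 : cj 1 = 1 by exact: (rmorph1 (@conjc R)).
have ar := arm_neq0 a01' s.
rewrite /peak !conjcM cr cV' cB conjcM c1 cr cV /kappa.
have -> : 1 - a%:C * (cis s)^-1 = arm a s / cis s.
  by rewrite /arm mulrBl divff.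
have -> : (cis s)^-1 / (arm a s / cis s) = (arm a s)^-1.
  by rewrite invf_div mulrA mulVf// mul1r.
have -> : cis s / arm a s - 1 = a%:C / arm a s.
  by rewrite -[1](divff ar) -mulrBl {1}/arm opprB addrC subrK.
rewrite mulrA; congr (_ / _); rewrite -rmorphM; congr _%:C.
by rewrite expr2 invfM mulrA divfK.
Qed.

(** The conjugate of [peak] is on the circle a multiple of [kappa a] - 1, and the
    weights [kappa a] and 1 evaluate [f] at [a] and at 0. *)
Lemma peak_mean (f : C -> C) :
  (forall z, nrm z <= 1 -> differentiable f z) ->
  segint 0 (pi *+ 2) (fun s => Re (cj (peak (cis s)) * f (cis s))) =
  pi *+ 2 * (t / a ^+ 2 * (Re (f a%:C) - Re (f 0))).
Proof.
move=> df; have k1 := @Re_kappa_cont a f 0 (pi *+ 2) a01' df.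
have k2 := @Re_circle_cont f 0 (pi *+ 2) df.
transitivity (t / a ^+ 2 * segint 0 (pi *+ 2)
   (fun s => Re (kappa a s * f (cis s)) - Re (f (cis s)))).
  rewrite -segintZ; last by apply: cont_onB.
  apply: eq_segint => s _; rewrite conj_peak -mulrA mulrBl mul1r.
  move: (kappa a s * f (cis s)) (f (cis s)) => [x y] [z w] /=.
  ring.
rewrite segintB// cauchy_formula// mean_value//; ring.
Qed.

Lemma peak_circle_cont (f : C -> C) u v :
  (forall z, nrm z <= 1 -> differentiable f z) ->
  cont_on u v (fun s => Re (cj (peak (cis s)) * f (cis s))).
Proof.
move=> df.
have -> : (fun s => Re (cj (peak (cis s)) * f (cis s))) =
    (fun s => t / a ^+ 2 * (Re (kappa a s * f (cis s)) - Re (f (cis s)))).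
  rewrite funeqE => s; rewrite conj_peak -mulrA mulrBl mul1r.
  move: (kappa a s * f (cis s)) (f (cis s)) => [x y] [z w] /=.
  ring.
apply: cont_onM; first exact: cont_on_cst.
by apply: cont_onB; [exact: Re_kappa_cont a01' df|exact: Re_circle_cont df].
Qed.

End Pick.

Section TwoPoint.
Context {R : realType}.
Local Notation C := R[i].
Local Notation cj := (@conjc R).
Variables (K H : hilbertType R).

(** The function G z = psi z (x + peak z (y - x)) has the values psi 0 x at 0 and
    psi a y at [a]. Its mean square on the circle is at most that of
    x + peak z (y - x), because each psi z is a contraction, and at least that of
    P z = psi 0 x + peak z (psi a y - psi 0 x), by the minimality of [peak]; the
    two bounds are the two sides of the inequality. The second one is used in the
    form |G|^2 >= 2 Re <G,P> - |P|^2, so that only scalar holomorphic functions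
    have to be integrated. *)
Lemma two_point_pick (a : R) (psi : C -> K -> H) : 0 < a < 1 ->
  (forall z, linear (psi z)) ->
  (forall z x, nrm z <= 1 -> nrm (psi z x) <= nrm x) ->
  (forall x w z, nrm z <= 1 -> differentiable (fun z => inner (psi z x) w : C) z) ->
  forall x y,
    nrm (psi 0 x) ^+ 2 + (1 - a ^+ 2) / a ^+ 2 * nrm (psi a%:C y - psi 0 x) ^+ 2 <=
    nrm x ^+ 2 + (1 - a ^+ 2) / a ^+ 2 * nrm (y - x) ^+ 2.
Proof.
move=> a01 lpsi cpsi dpsi x y; set m := (1 - a ^+ 2) / a ^+ 2.
set d := y - x; set G0 := psi 0 x; set D := psi a%:C y - G0.
pose e := @peak R a.
have psiD z u v : psi z (u + v) = psi z u + psi z v.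
  by have := lpsi z 1 u v; rewrite !scale1r.
have psi00 z : psi z 0 = 0.
  by have := lpsi z (-1) 0 0; rewrite !scaleN1r oppr0 addr0 addNr.
have psiZ z c u : psi z (c *: u) = c *: psi z u.
  by have := lpsi z c u 0; rewrite psi00 !addr0.
pose G z := psi z x + e z *: psi z d.
pose f w z : C := inner (psi z x) w + e z * inner (psi z d) w.
have fE w z : f w z = inner (G z) w by rewrite /f /G innerDl innerZl.
have df w z : nrm z <= 1 -> differentiable (f w) z.
  move=> z1; apply: differentiableD; first exact: dpsi.
  by apply: differentiableM; [exact: peak_differentiable|exact: dpsi].
pose S : R := nrm d ^+ 2 + nrm D ^+ 2.
pose h z : C := (2%:C * (inner x d + inner G0 D) + S%:C * e z) - 2%:C * f D z.
have dh z : nrm z <= 1 -> differentiable h z.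
  move=> z1; apply: differentiableB.
    apply: differentiableD; first exact: differentiable_cst.
    by apply: differentiableM; [exact: differentiable_cst|exact: peak_differentiable].
  by apply: differentiableM; [exact: differentiable_cst|exact: df].
have G00 : G 0 = G0 by rewrite /G /e peak0 scale0r addr0.
have Ga : G a%:C = psi a%:C y.
  by rewrite /G /e peak_a// scale1r -psiD /d addrC subrK.
have pi2 : 0 < pi *+ 2 :> R by rewrite pmulrn_lgt0// pi_gt0.
have c1 := @Re_circle_cont R (f G0) 0 (pi *+ 2) (df G0).
have c2 : cont_on 0 (pi *+ 2) (fun s => Re (cj (e (cis s)) * h (cis s))).
  exact: peak_circle_cont.
have key : 0 <= segint 0 (pi *+ 2) (fun s => ((nrm x ^+ 2 + nrm G0 ^+ 2)
    - 2 * Re (f G0 (cis s))) + Re (cj (e (cis s)) * h (cis s))).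
  have c3 := cont_onM (@cont_on_cst R 0 (pi *+ 2) 2) c1.
  have c4 := cont_onB (@cont_on_cst R 0 (pi *+ 2) (nrm x ^+ 2 + nrm G0 ^+ 2)) c3.
  rewrite -[X in X <= _](_ : segint 0 (pi *+ 2) (fun=> 0) = 0); last first.
    by rewrite segint_cst ?mul0r// ltW.
  apply: le_segint; [exact: cont_on_cst|exact: cont_onD c4 c2|].
  move=> s _; set z := cis s.
  have z1 : nrm z <= 1 by rewrite nrm_cis.
  have P1 : nrm (G z) ^+ 2 <= nrm (x + e z *: d) ^+ 2.
    rewrite ler_pXn2r ?nnegrE ?nrm_ge0// /G -psiZ -psiD.
    exact: cpsi.
  have P2 := sqr_ge0 (nrm (G z - (G0 + e z *: D))).
  have e2 : nrm (e z) ^+ 2 = Re (cj (e z) * e z).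
    by rewrite sqr_nrm; case: (e z) => ? ? /=; ring.
  have rZ (u v : K) : rdot u (e z *: v) = Re (cj (e z) * inner u v) by rewrite /rdot innerZr.
  have rZ' (u v : H) : rdot u (e z *: v) = Re (cj (e z) * inner u v) by rewrite /rdot innerZr.
  rewrite sqnrmD nrmZ exprMn e2 rZ in P1.
  rewrite sqnrmB rdotDr [nrm (G0 + _) ^+ 2]sqnrmD nrmZ exprMn e2 !rZ' -fE /rdot -fE in P2.
  suff : Re (cj (e z) * h z) = 2 * Re (cj (e z) * inner x d) + 2 * Re (cj (e z) * inner G0 D)
      + Re (cj (e z) * e z) * S - 2 * Re (cj (e z) * f D z).
    by move=> ->; rewrite /S; lra.
  rewrite /h; move: (e z) (inner x d) (inner G0 D) (f D z) => [? ?] [? ?] [? ?] [? ?] /=.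
  ring.
move: key.
rewrite segintD//; last first.
  have c3 := cont_onM (@cont_on_cst R 0 (pi *+ 2) 2) c1.
  exact: cont_onB (@cont_on_cst R 0 (pi *+ 2) (nrm x ^+ 2 + nrm G0 ^+ 2)) c3.
rewrite segintB; [|exact: cont_on_cst|exact: cont_onM (@cont_on_cst R 0 (pi *+ 2) 2) c1].
rewrite segintZ// segint_cst ?(ltW pi2)// mean_value; last exact: df.
rewrite peak_mean// !fE G00 -/m innerxx subr0.
have -> : Re (h a%:C) - Re (h 0) = nrm d ^+ 2 - nrm D ^+ 2.
  rewrite /h /e peak0 peak_a// !fE Ga G00.
  have -> : inner (psi a%:C y) D = inner G0 D + inner D D :> C.
    by rewrite -innerDl [G0 + D]addrC subrK.
  rewrite innerxx /S; move: (inner G0 D) (inner x d) => [? ?] [? ?] /=; ring.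
have -> : (nrm x ^+ 2 + nrm G0 ^+ 2) * (pi *+ 2) - 2 * (pi *+ 2 * Re (nrm G0 ^+ 2)%:C)
    + pi *+ 2 * (m * (nrm d ^+ 2 - nrm D ^+ 2)) =
  pi *+ 2 * ((nrm x ^+ 2 + nrm G0 ^+ 2) - 2 * nrm G0 ^+ 2 + m * (nrm d ^+ 2 - nrm D ^+ 2)).
  by rewrite /=; ring.
rewrite pmulr_rge0// => key; lra.
Qed.

End TwoPoint.

(** * Orthonormal bases and sesquilinear forms in finite dimension *)

Section FiniteDimension.
Context {R : realType}.
Local Notation C := R[i].
Variable K : hilbertType R.

Definition orthonormal n (e : 'I_n -> K) :=
  forall i j, inner (e i) (e j) = (i == j)%:R :> C.

Lemma inner_sumr (I : finType) (u : K) (F : I -> K) :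
  inner u (\sum_i F i) = \sum_i inner u (F i) :> C.
Proof. exact: (linear_sumr inner). Qed.

Lemma inner_suml (I : finType) (u : K) (F : I -> K) :
  inner (\sum_i F i) u = \sum_i inner (F i) u :> C.
Proof. exact: (linear_sumlz inner). Qed.

Lemma ortho_coord n (e : 'I_n -> K) (c : 'I_n -> C) j : orthonormal e ->
  inner (\sum_i c i *: e i) (e j) = c j.
Proof.
move=> oe; rewrite inner_suml (bigD1 j)//= innerZl oe eqxx mulr1.
by rewrite big1 ?addr0// => i /negPf ij; rewrite innerZl oe ij mulr0.
Qed.

(** Gram-Schmidt; vectors already in the span of the preceding ones are skipped,
    since a finite spanning family need not be independent. *)
Lemma ortho_span m (f : 'I_m -> K) : exists n (e : 'I_n -> K),
  orthonormal e /\ forall i, f i = \sum_j inner (f i) (e j) *: e j.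
Proof.
elim: m f => [|m ih] f; first by exists 0%N, f; split; case.
have [n [e [oe fe]]] := ih (fun i => f (lift ord0 i)).
pose r := f ord0 - \sum_j inner (f ord0) (e j) *: e j.
have re j : inner r (e j) = 0 by rewrite innerBl ortho_coord// subrr.
have er j : inner (e j) r = 0 by rewrite innerC re; exact: conjc0.
have [r0|r0] := eqVneq r 0.
  exists n, e; split=> // i.
  have [j ->|->] := unliftP ord0 i; first exact: fe.
  by apply/eqP; rewrite -subr_eq0 -/r r0.
have nr : (nrm r)%:C != 0 :> C by rewrite fmorph_eq0 nrm_eq0.
pose r1 := (nrm r)%:C^-1 *: r.
pose e' (i : 'I_n.+1) := if unlift ord0 i is Some j then e j else r1.
have e'0 : e' ord0 = r1 by rewrite /e' unlift_none.
have e'S j : e' (lift ord0 j) = e j by rewrite /e' liftK.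
have cr (x : R) : conjc x%:C = x%:C :> C by exact: conjc_real.
have cV : conjc (nrm r)%:C^-1 = (nrm r)%:C^-1 :> C by rewrite -fmorphV cr.
have r1Z (v : K) : inner v r = 0 -> inner v r1 = 0 :> C by move=> h; rewrite innerZr h mulr0.
exists n.+1, e'; split.
  move=> i j.
  have [i' ->|->] := unliftP ord0 i; have [j' ->|->] := unliftP ord0 j;
    rewrite ?e'0 ?e'S.
  - by rewrite oe (inj_eq lift_inj).
  - by rewrite r1Z ?er.
  - by rewrite innerZl re mulr0.
  rewrite innerZl innerZr innerxx cV rmorphXn /=.
  by rewrite expr2 mulKf// mulVf.
move=> i; rewrite big_ord_recl e'0.
under eq_bigr do rewrite e'S.
have [i' ->|->] := unliftP ord0 i.
  rewrite [X in inner X r1]fe innerC inner_sumr big1 ?rmorph0.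
    by rewrite scale0r add0r -fe.
  by move=> j _; rewrite innerZr [inner r1 _]innerC r1Z ?er// rmorph0 mulr0.
have -> : inner (f ord0) r1 *: r1 = r.
  have -> : f ord0 = r + \sum_j inner (f ord0) (e j) *: e j by rewrite subrK.
  rewrite innerDl inner_suml big1 ?addr0; last first.
    by move=> j _; rewrite innerZl r1Z ?er// mulr0.
  rewrite innerZr innerxx cV scalerA rmorphXn /=.
  by rewrite expr2 mulKf// divff// scale1r.
by rewrite /r subrK.
Qed.

Lemma ortho_basis : finite_dimensional K -> exists n (e : 'I_n -> K),
  orthonormal e /\ forall v, v = \sum_j inner v (e j) *: e j.
Proof.
move=> [m [f fP]]; have [n [e [oe fe]]] := ortho_span f.
exists n, e; split=> // v; have [c ->] := fP v.
under [in RHS]eq_bigr do rewrite inner_suml scaler_suml.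
rewrite exchange_big; apply: eq_bigr => i _ /=.
rewrite [in LHS]fe scaler_sumr; apply: eq_bigr => j _.
by rewrite innerZl scalerA.
Qed.

(** A form with trivial radical has an invertible matrix in an orthonormal basis;
    this gives Riesz representation for forms that need not be positive. *)
Lemma sesqui_solve (beta : K -> K -> C) (l : K -> C) : finite_dimensional K ->
  (forall c u v w, beta (c *: u + v) w = c * beta u w + beta v w) ->
  (forall c u v w, beta w (c *: u + v) = conjc c * beta w u + beta w v) ->
  (forall k, (forall v, beta k v = 0) -> k = 0) ->
  (forall c u v, l (c *: u + v) = conjc c * l u + l v) ->
  exists k, forall v, beta k v = l v.
Proof.
move=> fd bl br bnd ll; have [n [e [oe eP]]] := ortho_basis fd.
have bl0 w : beta 0 w = 0.
  have := bl (-1) 0 0 w; by rewrite scaler0 addr0 mulN1r addNr.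
have br0 w : beta w 0 = 0.
  have := br (-1) 0 0 w; by rewrite scaler0 addr0 rmorphN rmorph1 mulN1r addNr.
have l0 : l 0 = 0.
  have := ll (-1) 0 0; by rewrite scaler0 addr0 rmorphN rmorph1 mulN1r addNr.
have blS (c : 'I_n -> C) w : beta (\sum_i c i *: e i) w = \sum_i c i * beta (e i) w.
  have bD u v : beta (u + v) w = beta u w + beta v w.
    by have := bl 1 u v w; rewrite scale1r mul1r.
  rewrite (big_morph (beta^~ w) bD (bl0 w)); apply: eq_bigr => i _.
  by rewrite -[c i *: _]addr0 bl bl0 addr0.
have brS (c : 'I_n -> C) w : beta w (\sum_i c i *: e i) = \sum_i conjc (c i) * beta w (e i).
  have bD u v : beta w (u + v) = beta w u + beta w v.
    by have := br 1 u v w; rewrite scale1r rmorph1 mul1r.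
  rewrite (big_morph (beta w) bD (br0 w)); apply: eq_bigr => i _.
  by rewrite -[c i *: _]addr0 br br0 addr0.
have lS (c : 'I_n -> C) : l (\sum_i c i *: e i) = \sum_i conjc (c i) * l (e i).
  have lD u v : l (u + v) = l u + l v.
    by have := ll 1 u v; rewrite scale1r rmorph1 mul1r.
  rewrite (big_morph l lD l0); apply: eq_bigr => i _.
  by rewrite -[c i *: _]addr0 ll l0 addr0.
pose B := \matrix_(i, j) beta (e i) (e j).
have uB : B \in unitmx.
  rewrite -row_free_unit; apply: inj_row_free => c cB.
  have k0 : \sum_i c ord0 i *: e i = 0.
    apply: bnd => v; rewrite (eP v) brS big1// => j _.
    have := congr1 (fun M : 'rV_n => M ord0 j) cB; rewrite !mxE.
    by under eq_bigr do rewrite mxE; rewrite -blS => ->; rewrite mulr0.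
  apply/rowP => j; rewrite mxE -(ortho_coord (c ord0) j oe) k0.
  exact: inner0l.
pose c := (\row_j l (e j)) *m invmx B.
exists (\sum_i c ord0 i *: e i) => v; rewrite (eP v) brS lS.
apply: eq_bigr => j _; congr (_ * _); rewrite blS.
have /rowP/(_ j) : c *m B = \row_j l (e j) by rewrite mulmxKV.
rewrite !mxE => <-; apply: eq_bigr => i _; by rewrite [B _ _]mxE.
Qed.

End FiniteDimension.

(** * Bounded operators and the relation of being pseudo-hyperbolically close *)

Section Operators.
Context {R : realType}.
Variables (K H : hilbertType R).
Local Notation V := (boundedOp K H).
Implicit Types (f g : V) (x y : K).

Lemma op_linear f : linear f.
Proof. by have [] := boundedOpP f. Qed.

Lemma opr0 f : f 0 = 0.
Proof. by have := op_linear f (-1) 0 0; rewrite !scaleN1r oppr0 addr0 addNr. Qed.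
Lemma oprD f x y : f (x + y) = f x + f y.
Proof. by have := op_linear f 1 x y; rewrite !scale1r. Qed.
Lemma oprZ f c x : f (c *: x) = c *: f x.
Proof. by have := op_linear f c x 0; rewrite opr0 !addr0. Qed.
Lemma oprN f x : f (- x) = - f x.
Proof. by rewrite -scaleN1r oprZ scaleN1r. Qed.
Lemma oprB f x y : f (x - y) = f x - f y.
Proof. by rewrite oprD oprN. Qed.

Lemma nrm_op_ub f (M : R) : 0 <= M -> (forall x, nrm (f x) <= M * nrm x) -> nrm f <= M.
Proof.
move=> M0 fM; rewrite -[nrm f]/(opnorm f); apply: ge_sup.
  by exists (nrm (f 0)), 0; rewrite normr0 nrmE.
move=> r [x [x1 fx]]; have := fM x; rewrite /nrm fx => /le_trans; apply.
rewrite -/(nrm x); move: x1; rewrite nrmE -[1]/(1%:C) lecR => x1.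
by rewrite ler_piMr.
Qed.

Lemma nrm_op_le f x : nrm (f x) <= nrm f * nrm x.
Proof.
have [M fM'] : exists M : R, forall x, nrm (f x) <= M * nrm x.
  have [_ [M fM]] := boundedOpP f; exists M => y.
  by have := fM y; rewrite !nrmE -rmorphM lecR.
have fM y : nrm (f y) <= `|M| * nrm y.
  by rewrite (le_trans (fM' y))// ler_wpM2r ?nrm_ge0// ler_norm.
have [->|x0] := eqVneq x 0; first by rewrite opr0 !nrm0 mulr0.
have nx : 0 < nrm x by rewrite lt_neqAle nrm_ge0 eq_sym nrm_eq0 x0.
rewrite -ler_pdivrMr// -[nrm f]/(opnorm f).
have xE : nrm ((nrm x)^-1%:C *: x) = 1.
  by rewrite nrmZ nrmC ger0_norm ?invr_ge0 ?nrm_ge0// mulVf// gt_eqF.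
apply: sup_upper_bound; first split.
- by exists (nrm (f 0)), 0; rewrite normr0 nrmE.
- exists `|M| => r [y [y1 fy]]; have := fM y; rewrite {1}/nrm fy => /le_trans; apply.
  by move: y1; rewrite nrmE -[1]/(1%:C) lecR => y1; rewrite ler_piMr.
exists ((nrm x)^-1%:C *: x); rewrite !nrmE xE; split=> //.
by rewrite oprZ nrmZ nrmC ger0_norm ?invr_ge0 ?nrm_ge0// mulrC.
Qed.

Lemma op_exists (F : K -> H) (M : R) : linear F ->
  (forall x, nrm (F x) <= M * nrm x) -> exists f : V, forall x, f x = F x.
Proof.
move=> lF FM; have bF : F \in @bounded_linear_pred R K H.
  by apply/asboolP; split=> //; exists M => x; rewrite !nrmE -rmorphM lecR.
by exists (BoundedOp bF).
Qed.

Lemma op_ext f g : (forall x, f x = g x) -> f = g.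
Proof. by move=> fg; apply/val_inj/funext. Qed.

Lemma nrm_op_lt1 f x : nrm f < 1 -> nrm (f x) <= nrm x.
Proof.
by move=> f1; apply: le_trans (nrm_op_le f x) _; rewrite ler_piMl ?nrm_ge0// ltW.
Qed.

(** Writing [[u,v]] for the indefinite product <k,l> - <k',l'> of two vectors
    u = (k,k') and v = (l,l'), this is the quadratic form
    [[u,u]] + [[v,v]] + 2 s Re [[u,v]] at a pair of points u = (k, f k) and
    v = (l, g l) of the graphs of [f] and [g]. *)
Definition gap (s : R) f g (k l : K) : R :=
  (nrm k ^+ 2 - nrm (f k) ^+ 2) + (nrm l ^+ 2 - nrm (g l) ^+ 2)
  + 2 * s * (rdot k l - rdot (f k) (g l)).

(** On the unit ball and for 0 < s <= 1: the pseudo-hyperbolic distance between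
    [f] and [g] is at most the square root of 1 - s^2. For f = 0 this reads
    |g l|^2 <= (1 - s^2) |l|^2, the distance being the norm of g. *)
Definition phclose (s : R) f g := forall k l, 0 <= gap s f g k l.

Lemma phclose_limit s f g : 0 < s -> (forall s', 0 < s' < s -> phclose s' f g) ->
  phclose s f g.
Proof.
move=> s0 h k l; rewrite leNgt; apply/negP => lt0.
set d := rdot k l - rdot (f k) (g l).
have gE s' : gap s' f g k l = gap s f g k l - 2 * (s - s') * d.
  by rewrite /gap -/d; ring.
set G := gap s f g k l in lt0 gE.
pose eps := Num.min (s / 2) (- G / (4 * (`|d| + 1))).
have d1 : 0 < `|d| + 1 by rewrite ltr_wpDl.
have e0 : 0 < eps by rewrite lt_min !divr_gt0 ?oppr_gt0 ?mulr_gt0.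
have es : eps <= s / 2 by rewrite ge_min lexx.
have ed : eps * (4 * (`|d| + 1)) <= - G.
  by rewrite -ler_pdivlMr ?mulr_gt0// ge_min lexx orbT.
have := h (s - eps) _ k l; rewrite gE => h'.
have := h' ltac:(lra); have := ler_norm (- d); rewrite normrN; nra.
Qed.

End Operators.

(** * The holomorphic disc through two points of the ball *)

Section Geodesic.
Context {R : realType}.
Local Notation C := R[i].
Variables (K H : hilbertType R).
Local Notation V := (boundedOp K H).
Variables (A Z : V) (s : R).
Hypotheses (fdK : finite_dimensional K) (A1 : nrm A < 1) (Z1 : nrm Z < 1).
Hypotheses (s01 : 0 <= s <= 1) (cAZ : phclose s A Z).

Let al := nrm A.
Let al0 : 0 <= al. Proof. exact: nrm_ge0. Qed.

Let form k l : C := inner k l - inner (A k) (A l).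

Let form_lb k : (1 - al ^+ 2) * nrm k ^+ 2 <= nrm k ^+ 2 - nrm (A k) ^+ 2.
Proof.
have : nrm (A k) ^+ 2 <= (al * nrm k) ^+ 2.
  by rewrite ler_pXn2r ?nnegrE ?mulr_ge0 ?nrm_ge0// nrm_op_le.
by rewrite exprMn; lra.
Qed.

Let al2 : 0 < 1 - al ^+ 2.
Proof. by rewrite subr_gt0 expr_lt1. Qed.

Let form_nondeg k : form k k = 0 -> k = 0.
Proof.
rewrite /form !innerxx => /(congr1 (@complex.Re R))/= h; apply/eqP.
rewrite -nrm_eq0 -sqrf_eq0 eq_le sqr_ge0 andbT.
by have := form_lb k; rewrite -(pmulr_rle0 _ al2); lra.
Qed.

(* The projection of the graph of Z onto the graph of A along the orthogonal
   complement of the latter for the indefinite product. *)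
Let proj_ex : exists N : K -> K, forall k v, form (N k) v = inner k v - inner (Z k) (A v).
Proof.
suff /choice[N NP] : forall k, exists n, forall v,
    form n v = inner k v - inner (Z k) (A v) by exists N.
move=> k.
apply: (@sesqui_solve _ _ form) => //.
- by move=> c u v w; rewrite /form oprD oprZ !innerDl !innerZl; ring.
- by move=> c u v w; rewrite /form oprD oprZ !innerDr !innerZr; ring.
- by move=> u /(_ u); exact: form_nondeg.
by move=> c u v; rewrite oprD oprZ !innerDr !innerZr; ring.
Qed.

Let N := projT1 (cid proj_ex).
Let NE k v : form (N k) v = inner k v - inner (Z k) (A v).
Proof. exact: (projT2 (cid proj_ex)). Qed.

Let formBl k k' v : form (k - k') v = form k v - form k' v.
Proof. by rewrite /form oprB !innerBl; ring. Qed.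

Let N_lin c u v : N (c *: u + v) = c *: N u + N v.
Proof.
have h w : form (N (c *: u + v) - (c *: N u + N v)) w = 0.
  have fD k k' : form (c *: k + k') w = c * form k w + form k' w.
    by rewrite /form oprD oprZ !innerDl !innerZl; ring.
  by rewrite formBl fD !NE oprD oprZ !innerDl !innerZl; ring.
by apply/eqP; rewrite -subr_eq0; apply/eqP/form_nondeg/h.
Qed.

Let T (z : C) k := N k + z *: (k - N k).
Let L (z : C) k := A (N k) + z *: (Z k - A (N k)).

Let p k := nrm (N k) ^+ 2 - nrm (A (N k)) ^+ 2.

Let perp k v : inner (k - N k) v - inner (Z k - A (N k)) (A v) = 0 :> C.
Proof.
by have := NE k v; rewrite /form !innerBl => /eqP; rewrite subr_eq => /eqP ->; ring.
Qed.

Let w2 k := nrm (k - N k) ^+ 2 - nrm (Z k - A (N k)) ^+ 2.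

Let T_L z k : nrm (T z k) ^+ 2 - nrm (L z k) ^+ 2 = p k + nrm z ^+ 2 * w2 k.
Proof.
rewrite /T /L !sqnrmD !nrmZ !exprMn /p /w2.
suff : rdot (N k) (z *: (k - N k)) = rdot (A (N k)) (z *: (Z k - A (N k))).
  by move=> ->; ring.
rewrite ![rdot _ (z *: _)]rdotC /rdot !innerZl.
by have /eqP := perp k (N k); rewrite subr_eq0 => /eqP ->.
Qed.

Let gapZ k : nrm k ^+ 2 - nrm (Z k) ^+ 2 = p k + w2 k.
Proof.
have := T_L 1 k; rewrite /T /L !scale1r ![N k + _]addrC ![A (N k) + _]addrC !subrK => ->.
by rewrite nrm1 expr1n mul1r.
Qed.

Let w2_lb k : - w2 k <= (1 - s ^+ 2) * p k.
Proof.
(* the minimum over t of the gap at the pair (t N k, k) is attained at t = - s *)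
have := cAZ ((- s)%:C *: N k) k.
rewrite /gap oprZ !nrmZ nrmC normrN !exprMn gapZ !rdotZl.
have e : rdot (N k) k - rdot (A (N k)) (Z k) = p k.
  rewrite /p -!rdotxx /rdot; have /(congr1 (@complex.Re R)) := perp k (N k).
  rewrite !innerBl ![inner (N k) k]innerC ![inner (A (N k)) (Z k)]innerC.
  move: (inner k (N k)) (inner (N k) (N k)) (inner (Z k) (A (N k))) (inner (A (N k)) (A (N k))).
  by move=> [? ?] [? ?] [? ?] [? ?] /=; lra.
have sn : `|s| ^+ 2 = s ^+ 2 by rewrite real_normK// num_real.
rewrite sn => h.
suff : 0 <= s ^+ 2 * p k + (p k + w2 k) - 2 * s ^+ 2 * (rdot (N k) k - rdot (A (N k)) (Z k)).
  by rewrite e; lra.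
by apply: le_trans h _; rewrite le_eqVlt; apply/orP; left; apply/eqP; rewrite /p; ring.
Qed.

Let p_lb k : (1 - al ^+ 2) * nrm (N k) ^+ 2 <= p k.
Proof. exact: form_lb. Qed.

Let N_lb k : (1 - al) * nrm k <= 2 * nrm (N k).
Proof.
have [->|k0] := eqVneq k 0; first by rewrite nrm0 mulr0 mulr_ge0 ?nrm_ge0.
have nk : 0 < nrm k by rewrite lt_neqAle nrm_ge0 eq_sym nrm_eq0 k0.
rewrite -(ler_pM2r nk).
have /(congr1 (@complex.Re R)) := NE k k; rewrite /form innerxx.
have a1 : rdot (N k) k <= nrm (N k) * nrm k by exact: rdot_le.
have a2 : - rdot (A (N k)) (A k) <= nrm (N k) * nrm k.
  rewrite -rdotNl; apply: le_trans (rdot_le _ _) _; rewrite nrmN.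
  by rewrite ler_pM ?nrm_ge0 ?nrm_op_lt1.
have a3 : rdot (Z k) (A k) <= al * nrm k * nrm k.
  apply: le_trans (rdot_le _ _) _; rewrite mulrC ler_pM ?nrm_ge0 ?nrm_op_lt1//.
  exact: nrm_op_le.
move: a1 a2 a3; rewrite /rdot.
move: (inner (N k) k) (inner (A (N k)) (A k)) (inner (Z k) (A k)).
by move=> [? ?] [? ?] [? ?] /=; lra.
Qed.

Let N_ub k : (1 - al ^+ 2) * nrm (N k) <= 2 * nrm k.
Proof.
have [n0|n0] := eqVneq (nrm (N k)) 0; first by rewrite n0 mulr0 mulr_ge0 ?nrm_ge0.
have nk : 0 < nrm (N k) by rewrite lt_neqAle nrm_ge0 eq_sym n0.
rewrite -(ler_pM2r nk) -mulrA -expr2; apply: le_trans (p_lb k) _.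
have /(congr1 (@complex.Re R)) := NE k (N k); rewrite /form !innerxx.
have a1 : rdot k (N k) <= nrm k * nrm (N k) by exact: rdot_le.
have a2 : - rdot (Z k) (A (N k)) <= nrm k * nrm (N k).
  rewrite -rdotNl; apply: le_trans (rdot_le _ _) _; rewrite nrmN.
  by rewrite ler_pM ?nrm_ge0 ?nrm_op_lt1.
move: a1 a2; rewrite /rdot /p.
move: (inner k (N k)) (inner (Z k) (A (N k))).
by move=> [? ?] [? ?] /=; lra.
Qed.

Variable rho : R.
Hypotheses (rho0 : 1 < rho) (rhos : rho ^+ 2 * (1 - s ^+ 2) < 1).

Let q := 1 - rho ^+ 2 * (1 - s ^+ 2).
Let q0 : 0 < q. Proof. by rewrite subr_gt0. Qed.
Let q1 : q <= 1.
Proof.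
rewrite /q gerBl mulr_ge0 ?sqr_ge0// subr_ge0.
by case/andP: s01 => s0 s1; rewrite expr_le1.
Qed.
Let al1 : 0 < 1 - al. Proof. by rewrite subr_gt0. Qed.
Let c := q * (1 - al ^+ 2) * (1 - al) ^+ 2 / 4.
Let c0 : 0 < c. Proof. by rewrite !(mulr_gt0, divr_gt0, exprn_gt0). Qed.
Let c1 : c <= 1.
Proof.
have a : (1 - al ^+ 2) <= 1 by rewrite gerBl sqr_ge0.
have b : (1 - al) ^+ 2 <= 1 by rewrite expr_le1 ?(ltW al1)// gerBl.
have d : q * (1 - al ^+ 2) <= 1 by rewrite mulr_ile1// ltW.
have e : q * (1 - al ^+ 2) * (1 - al) ^+ 2 <= 1.
  by rewrite mulr_ile1// ?sqr_ge0// mulr_ge0// ltW.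
by rewrite /c; lra.
Qed.

Let T_L_lb z k : nrm z < rho ->
  c * nrm k ^+ 2 <= nrm (T z k) ^+ 2 - nrm (L z k) ^+ 2.
Proof.
move=> zr; rewrite T_L.
have pk : 0 <= p k by apply: le_trans (p_lb k); rewrite mulr_ge0 ?sqr_ge0// ltW.
have z2 : nrm z ^+ 2 <= rho ^+ 2.
  by rewrite ler_pXn2r ?nnegrE ?nrm_ge0 ?ltW// (lt_trans ltr01).
apply: (@le_trans _ _ (q * p k)); last first.
  have h1 : nrm z ^+ 2 * - w2 k <= nrm z ^+ 2 * ((1 - s ^+ 2) * p k).
    by rewrite ler_wpM2l ?sqr_ge0.
  have h2 : nrm z ^+ 2 * ((1 - s ^+ 2) * p k) <= rho ^+ 2 * ((1 - s ^+ 2) * p k).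
    rewrite ler_wpM2r// mulr_ge0// subr_ge0.
    by case/andP: s01 => s0 s1; rewrite expr_le1.
  by rewrite /q; lra.
have h : (1 - al) ^+ 2 * nrm k ^+ 2 <= 4 * nrm (N k) ^+ 2.
  rewrite -exprMn (_ : 4 = 2 ^+ 2); last by rewrite -natrX.
  by rewrite -exprMn ler_pXn2r ?nnegrE ?mulr_ge0 ?nrm_ge0 ?(ltW al1).
have := p_lb k => h'.
rewrite /c -!mulrA ler_pM2l//; apply: le_trans h'; rewrite ler_pM2l//.
by rewrite [leLHS](_ : _ = (1 - al) ^+ 2 * nrm k ^+ 2 / 4); [lra|ring].
Qed.

Let T_lb z k : nrm z < rho -> c * nrm k <= nrm (T z k).
Proof.
move=> zr; apply: ler_of_sqr; first exact: nrm_ge0.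
have := T_L_lb k zr; rewrite exprMn.
have : c ^+ 2 * nrm k ^+ 2 <= c * nrm k ^+ 2.
  by rewrite ler_wpM2r ?sqr_ge0// expr2 ler_piMl// ltW.
have := sqr_ge0 (nrm (L z k)); lra.
Qed.

Let N1 k : nrm (N k) <= 2 / (1 - al ^+ 2) * nrm k.
Proof. by rewrite mulrAC ler_pdivlMr// mulrC N_ub. Qed.

Let b := 2 / (1 - al ^+ 2) + 1.
Let b0 : 0 < b. Proof. by rewrite /b addr_gt0// divr_gt0. Qed.

Let T1_ub k : nrm (k - N k) <= b * nrm k.
Proof.
by apply: le_trans (ler_nrmB _ _) _; have := N1 k; rewrite /b; lra.
Qed.

Let L1_ub k : nrm (Z k - A (N k)) <= b * nrm k.
Proof.
apply: le_trans (ler_nrmB _ _) _; have := N1 k.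
have := nrm_op_lt1 k Z1; have := nrm_op_lt1 (N k) A1; rewrite /b; lra.
Qed.

Let T_lin z a k l : T z (a *: k + l) = a *: T z k + T z l.
Proof.
rewrite /T N_lin opprD addrACA -scalerBr scalerDr scalerA mulrC -scalerA.
by rewrite addrACA -scalerDr.
Qed.

Let L_lin z a k l : L z (a *: k + l) = a *: L z k + L z l.
Proof.
rewrite /L N_lin !oprD !oprZ opprD addrACA -scalerBr scalerDr scalerA mulrC.
by rewrite -scalerA addrACA -scalerDr.
Qed.

Let T_inj z k : nrm z < rho -> T z k = 0 -> k = 0.
Proof.
move=> zr Tk; have := T_lb k zr; rewrite Tk nrm0 pmulr_rle0// => k0.
by apply/eqP; rewrite -nrm_eq0 eq_le k0 nrm_ge0.
Qed.

Let TB l z k : T z (k - l) = T z k - T z l.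
Proof. by have := T_lin z (-1) l k; rewrite !scaleN1r addrC => ->; rewrite addrC. Qed.

Let T_surj z u : nrm z < rho -> exists k, T z k = u.
Proof.
move=> zr; have [||||k kP] := @sesqui_solve _ _ (fun k l => inner (T z k) l) (inner u) fdK.
- by move=> a k l v; rewrite T_lin innerDl innerZl.
- by move=> a k l v; rewrite innerDr innerZr.
- move=> k /(_ (T z k)); rewrite innerxx => /(congr1 (@complex.Re R))/= /eqP.
  by rewrite sqrf_eq0 nrm_eq0 => /eqP; exact: T_inj.
- by move=> a k l; rewrite innerDr innerZr.
exists k; apply/eqP; rewrite -subr_eq0 -nrm_eq0 -sqrf_eq0 -rdotxx /rdot innerBl kP.
by rewrite subrr.
Qed.

(* Since T z is bijective and bounded below, a bounded linear function of k is a
   bounded linear function of u = T z k. *)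
Let op_of_T (z : C) (F : K -> H) (M : R) : nrm z < rho -> 0 <= M ->
  (forall a k l, F (a *: k + l) = a *: F k + F l) ->
  (forall k, nrm (F k) <= M * nrm k) ->
  exists f : V, forall k, f (T z k) = F k.
Proof.
move=> zr M0 F_lin FM.
have /choice[I IP] : forall u, exists k, T z k = u by move=> u; exact: T_surj.
have IT k : I (T z k) = k.
  by apply/eqP; rewrite -subr_eq0; apply/eqP/(T_inj zr); rewrite TB IP subrr.
have [||f fP] := @op_exists R K H (F \o I) (M / c).
- move=> a u v /=; rewrite -F_lin; congr F.
  by rewrite -{1}(IP u) -{1}(IP v) -T_lin IT.
- move=> u /=; apply: le_trans (FM _) _; rewrite -mulrA ler_wpM2l//.
  by rewrite -ler_pdivrMl ?invr_gt0// invrK -{2}(IP u) T_lb.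
by exists f => k; rewrite fP /= IT.
Qed.

Let T_ub z k : nrm z < rho -> nrm (T z k) <= (b + rho * b) * nrm k.
Proof.
move=> zr; apply: le_trans (ler_nrmD _ _) _; rewrite nrmZ mulrDl lerD//.
  by have := N1 k; have := nrm_ge0 k; rewrite /b; lra.
by rewrite -mulrA ler_pM ?nrm_ge0// ?T1_ub// ltW.
Qed.

(** The operator phi z has the graph { u + z w | v in graph of Z }, where
    v = u + w is the decomposition of v along the graph of A and its orthogonal
    complement for the product [[u,v]] of [gap]. As the distance of [A] and [Z]
    is at most sqrt (1 - s^2), the possibly negative term |z|^2 [[w,w]] stays
    below [[u,u]] in size for |z| < 1 / sqrt (1 - s^2), so that phi z is in the
    ball. *)
Lemma geodesic_disc : exists phi : C -> V,
  [/\ phi 0 = A, phi 1 = Z & forall z, nrm z < rho ->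
     nrm (phi z) < 1 /\ differentiable phi z].
Proof.
have /choice[phi phiP] : forall z, exists f : V, nrm z < rho -> forall k, f (T z k) = L z k.
  move=> z; case: (ltP (nrm z) rho) => [zr|]; last by exists 0.
  have [|||f fP] := @op_of_T z (L z) (b + rho * b) zr.
  - by rewrite addr_ge0 ?mulr_ge0 ?(ltW b0)// (le_trans ler01)// ltW.
  - exact: L_lin.
  - move=> k; apply: le_trans (T_ub k zr); apply: ler_of_sqr; first exact: nrm_ge0.
    have : 0 <= c * nrm k ^+ 2 by rewrite mulr_ge0 ?sqr_ge0// ltW.
    by have := T_L_lb k zr; lra.
  by exists f => _.
have phi1 z : nrm z < rho -> nrm (phi z) < 1.
  move=> zr; pose B := b + rho * b.
  have b1 : 1 <= b by rewrite /b lerDr divr_ge0// ltW.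
  have B1 : 1 <= B.
    by rewrite (le_trans b1)// lerDl mulr_ge0 ?(ltW b0)// (le_trans ler01)// ltW.
  have B0 : 0 < B by rewrite (lt_le_trans ltr01).
  pose d := c / B ^+ 2.
  have d0 : 0 < d by rewrite divr_gt0// exprn_gt0.
  have d1 : d <= 1.
    rewrite ler_pdivrMr ?exprn_gt0// mul1r (le_trans c1)// expr_ge1//; exact: ltW.
  apply: (@le_lt_trans _ _ (1 - d / 2)); last by rewrite gtrDl oppr_lt0 divr_gt0.
  have d2 : 0 <= 1 - d / 2 by lra.
  apply: nrm_op_ub => // u; have [k <-] := T_surj u zr; rewrite phiP//.
  apply: ler_of_sqr; first by rewrite mulr_ge0// nrm_ge0.
  have h1 := T_L_lb k zr.
  have h2 : d * nrm (T z k) ^+ 2 <= c * nrm k ^+ 2.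
    have : nrm (T z k) ^+ 2 <= (B * nrm k) ^+ 2.
      by rewrite ler_pXn2r ?nnegrE ?mulr_ge0 ?nrm_ge0 ?(ltW B0)// T_ub.
    rewrite exprMn => h; apply: le_trans (ler_wpM2l (ltW d0) h) _.
    by rewrite mulrA /d divfK// gt_eqF// exprn_gt0.
  rewrite exprMn; have := sqr_ge0 (nrm (T z k)).
  have : (1 - d / 2) ^+ 2 = 1 - d + (d / 2) ^+ 2 by field.
  have := sqr_ge0 (d / 2); move: h1 h2.
  move: (nrm (T z k) ^+ 2) ((1 - d / 2) ^+ 2) ((d / 2) ^+ 2) => X Y W *.
  nra.
exists phi; split.
- apply: op_ext => u; have [|k <-] := @T_surj 0 u; first by rewrite nrm0 (lt_trans ltr01).
  by rewrite phiP ?nrm0 ?(lt_trans ltr01)// /T /L !scale0r !addr0.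
- have n1 : nrm (1 : C) < rho by rewrite nrm1.
  apply: op_ext => k; have := phiP 1 n1 k.
  by rewrite /T /L !scale1r [N k + _]addrC [A (N k) + _]addrC !subrK.
move=> z zr; split; first exact: phi1.
have [|||Q QP] := @op_of_T z (fun k => (Z k - A (N k)) - phi z (k - N k)) (b + b) zr.
- by rewrite addr_ge0 ?ltW.
- move=> a k l; rewrite N_lin [Z (_ + _)]oprD [Z (_ *: _)]oprZ [A (_ + _)]oprD [A (_ *: _)]oprZ.
  rewrite ![- (_ + _)]opprD ![_ *: _ + _ + (- _ - _)]addrACA -!scalerBr.
  by rewrite [phi z (_ + _)]oprD oprZ opprD addrACA -scalerBr.
- move=> k; apply: le_trans (ler_nrmB _ _) _; rewrite mulrDl lerD ?L1_ub//.
  exact: le_trans (nrm_op_lt1 _ (phi1 z zr)) (T1_ub k).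
(* Q is found by differentiating phi z (T z k) = L z k with respect to z *)
apply/differentiable_estP; exists Q => e e0.
pose M := nrm Q * (b / c).
have M0 : 0 <= M by rewrite mulr_ge0 ?nrm_ge0// divr_ge0// ltW.
exists (Num.min (rho - nrm z) (e / (M + 1))).
  by rewrite lt_min subr_gt0 zr divr_gt0// ltr_wpDl.
move=> w; rewrite lt_min => /andP[wz1 wz2].
have wr : nrm w < rho.
  by have := ler_nrmD (w - z) z; rewrite subrK; lra.
apply: (@le_trans _ _ (M * nrm (w - z) ^+ 2)); last first.
  have : nrm (w - z) * (M + 1) <= e by rewrite -ler_pdivlMr ?ltr_wpDl// ltW.
  by have := nrm_ge0 (w - z); rewrite expr2; nra.
apply: nrm_op_ub => [|u]; first by rewrite mulr_ge0 ?sqr_ge0.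
have [k <-] := T_surj u wr.
have TE : T w k = T z k + (w - z) *: (k - N k).
  by rewrite /T -addrA -scalerDl [z + _]addrC subrK.
have LE : L w k = L z k + (w - z) *: (Z k - A (N k)).
  by rewrite /L -addrA -scalerDl [z + _]addrC subrK.
have -> : (phi w - phi z - (w - z) *: Q) (T w k) =
   phi w (T w k) - phi z (T w k) - (w - z) *: Q (T w k) by [].
have -> : phi z (T w k) = L z k + (w - z) *: phi z (k - N k).
  by rewrite TE oprD oprZ phiP.
have -> : Q (T w k) = (Z k - A (N k)) - phi z (k - N k) + (w - z) *: Q (k - N k).
  by rewrite TE oprD oprZ QP.
rewrite phiP// LE.
have -> : L z k + (w - z) *: (Z k - A (N k)) - (L z k + (w - z) *: phi z (k - N k))
     - (w - z) *: ((Z k - A (N k)) - phi z (k - N k) + (w - z) *: Q (k - N k)) =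
     - ((w - z) *: ((w - z) *: Q (k - N k))).
  rewrite opprD addrACA subrr add0r -scalerBr -scalerBr opprD addrA subrr add0r.
  by rewrite scalerN.
rewrite nrmN !nrmZ.
have -> : M * nrm (w - z) ^+ 2 * nrm (T w k) = nrm (w - z) ^+ 2 * (M * nrm (T w k)) by ring.
rewrite mulrA -expr2 ler_wpM2l ?sqr_ge0//.
apply: le_trans (nrm_op_le _ _) _; rewrite /M -mulrA ler_wpM2l ?nrm_ge0//.
apply: le_trans (T1_ub k) _; rewrite -mulrA ler_wpM2l ?(ltW b0)//.
by rewrite -ler_pdivrMl ?invr_gt0// invrK T_lb.
Qed.

End Geodesic.

(** * Holomorphic maps do not increase the pseudo-hyperbolic distance *)

Section SchwarzPick.
Context {R : realType}.
Local Notation C := R[i].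
Variables (K H : hilbertType R).
Local Notation V := (boundedOp K H).
Hypothesis fdK : finite_dimensional K.

Lemma differentiable_inner (F : C -> V) z x w : differentiable F z ->
  differentiable (fun z => inner (F z x) w : C) z.
Proof.
move=> /differentiable_estP[Q FQ]; apply/differentiable_estP.
exists (inner (Q x) w) => e e0.
pose M := nrm x * nrm w.
have M0 : 0 <= M by rewrite mulr_ge0 ?nrm_ge0.
have [d d0 dP] := FQ (e / (M + 1)) (divr_gt0 e0 (ltr_wpDl M0 ltr01)).
exists d => // y /dP h.
have -> : inner (F y x) w - inner (F z x) w - (y - z) *: inner (Q x) w =
    inner ((F y - F z - (y - z) *: Q) x) w.
  by rewrite -[(y - z) *: _]/((y - z) * _) -innerZl -!innerBl.
apply: le_trans (nrm_inner_le _ _) _.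
apply: (@le_trans _ _ (e / (M + 1) * nrm (y - z) * M)).
  rewrite /M mulrA ler_wpM2r ?nrm_ge0//.
  by apply: le_trans (nrm_op_le _ _) _; rewrite ler_wpM2r ?nrm_ge0.
have -> : e / (M + 1) * nrm (y - z) * M = e * nrm (y - z) * (M / (M + 1)) by ring.
rewrite ler_piMr ?mulr_ge0 ?nrm_ge0 ?(ltW e0)//.
by rewrite ler_pdivrMr ?mul1r ?lerDl// ltr_wpDl.
Qed.

(** The image under [g] of the disc through [A] and [Z] is a holomorphic family of
    contractions, and the Pick inequality between its values at the two
    parameters of [A] and [Z] is a multiple of the form in [phclose]. *)
Lemma schwarz_pick (g : V -> V) s (A Z : V) :
  (forall x, nrm x < 1 -> nrm (g x) < 1) ->
  (forall x, nrm x < 1 -> differentiable g x) ->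
  0 < s <= 1 -> nrm A < 1 -> nrm Z < 1 -> phclose s A Z -> phclose s (g A) (g Z).
Proof.
move=> gB dg /andP[s0 s1] A1 Z1 cAZ; apply: phclose_limit => // s' /andP[s'0 s's].
(* The disc is used with the closed radius a^-1, inside the open radius b^-1 on
   which it is holomorphic, inside the radius belonging to s. *)
pose m := (s + s') / 2.
have ms' : s' < m by rewrite /m; lra.
have ms : m < s by rewrite /m; lra.
have m0 : 0 < m by lra.
have sq_lt x y : 0 < x -> x < y -> x ^+ 2 < y ^+ 2 :> R.
  by move=> x0 xy; rewrite ltr_pXn2r ?nnegrE// ltW// (lt_trans x0).
have s2 : s ^+ 2 <= 1 by rewrite expr_le1// ltW.
have ms2 := sq_lt _ _ m0 ms; have ms2' := sq_lt _ _ s'0 ms'.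
have s'2 : 0 < s' ^+ 2 by rewrite exprn_gt0.
pose a := Num.sqrt (1 - s' ^+ 2); pose b := Num.sqrt (1 - m ^+ 2).
have a2 : a ^+ 2 = 1 - s' ^+ 2 by rewrite sqr_sqrtr//; lra.
have b2 : b ^+ 2 = 1 - m ^+ 2 by rewrite sqr_sqrtr//; lra.
have a0 : 0 < a by rewrite sqrtr_gt0; lra.
have b0 : 0 < b by rewrite sqrtr_gt0; lra.
have ba : b < a by rewrite ltr_sqrt; lra.
have a1 : a < 1.
  by rewrite -(ltr_pXn2r (ltn0Sn 1)) ?nnegrE ?(ltW a0)// a2 expr1n; lra.
have b1 : b < 1 by lra.
have [|||phi [phi0 phi1 phiB]] := @geodesic_disc R K H A Z s fdK A1 Z1 _ cAZ b^-1.
- by rewrite (ltW s0).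
- by rewrite invf_gt1.
- by rewrite exprVn b2 mulrC ltr_pdivrMr; lra.
pose psi z : K -> H := g (phi (a^-1%:C * z)).
have za z : nrm z <= 1 -> nrm (a^-1%:C * z) < b^-1.
  move=> z1; rewrite nrmM nrmC ger0_norm ?invr_ge0 ?(ltW a0)//.
  apply: (@le_lt_trans _ _ a^-1); first by rewrite ler_piMr// invr_ge0 ltW.
  by rewrite ltf_pV2.
have psi0 k : psi 0 k = g A k by rewrite /psi mulr0 phi0.
have psia k : psi a%:C k = g Z k.
  by rewrite /psi -rmorphM mulVf ?gt_eqF// phi1.
move=> k l.
(* With y = - l / s' the inequality is 1 / (1 - s'^2) times that of the gap. *)
have := @two_point_pick R K H a psi _ _ _ _ k ((- s'^-1)%:C *: l).
rewrite a0 a1 psi0 psia => /(_ isT) h.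
have {h} : nrm (g A k) ^+ 2 + (1 - a ^+ 2) / a ^+ 2 *
    nrm (g Z ((- s'^-1)%:C *: l) - g A k) ^+ 2 <=
    nrm k ^+ 2 + (1 - a ^+ 2) / a ^+ 2 * nrm ((- s'^-1)%:C *: l - k) ^+ 2.
  apply: h.
  - by move=> z; exact: op_linear.
  - by move=> z x z1; apply: nrm_op_lt1; apply/gB/(phiB _ (za _ z1)).1.
  - move=> x w z z1; apply: (@differentiable_inner (fun z => g (phi (a^-1%:C * z)))).
    have [p1 p2] := phiB _ (za _ z1).
    pose scal (z : C) : C := a^-1%:C * z.
    have dz : differentiable scal z.
      apply/differentiable_estP; exists a^-1%:C => e e0; exists 1 => // y _.
      rewrite /scal -mulrBr -[(y - z) *: _]/((y - z) * _) mulrC subrr nrm0.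
      by rewrite mulr_ge0 ?nrm_ge0// ltW.
    have dp : differentiable (phi \o scal) z := differentiable_comp dz p2.
    exact: (differentiable_comp (f := phi \o scal) dp (dg _ p1)).
rewrite oprZ !sqnrmB !nrmZ nrmC normrN !exprMn !rdotZl.
have sn : `|s'^-1| ^+ 2 = (s' ^+ 2)^-1 by rewrite real_normK ?num_real// exprVn.
rewrite sn a2 /gap.
have -> : 1 - (1 - s' ^+ 2) = s' ^+ 2 by ring.
rewrite (rdotC l k) (rdotC (g Z l)).
move: (nrm (g A k) ^+ 2) (nrm (g Z l) ^+ 2) (nrm k ^+ 2) (nrm l ^+ 2)
  (rdot k l) (rdot (g A k) (g Z l)) => X Y x y p q.
have t0 : 0 < 1 - s' ^+ 2 by lra.
rewrite -subr_ge0 => h.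
have : 0 <= (1 - s' ^+ 2) *
  (x + s' ^+ 2 / (1 - s' ^+ 2) * ((s' ^+ 2)^-1 * y - 2 * (- s'^-1 * p) + x) -
  (X + s' ^+ 2 / (1 - s' ^+ 2) * ((s' ^+ 2)^-1 * Y - 2 * (- s'^-1 * q) + X))).
  by rewrite mulr_ge0// ltW.
congr (_ <= _); field.
by rewrite !gt_eqF.
Qed.

End SchwarzPick.

(** * Completeness of the space of operators *)

Section Completeness.
Context {R : realType}.
Local Notation C := R[i].
Variables (K H : hilbertType R).
Local Notation V := (boundedOp K H).

Lemma complete_seq (W : completeNormedModType C) (u : nat -> W) :
  (forall e : R, 0 < e -> exists N, forall m n, (N <= m)%N -> (N <= n)%N -> nrm (u m - u n) <= e) ->
  exists p, forall e : R, 0 < e -> exists N, forall n, (N <= n)%N -> nrm (u n - p) <= e.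
Proof.
move=> uC.
have cu : cauchy (u @ \oo).
  apply: cauchy_exP => e e0.
  have er : e = (Re e)%:C by apply/esym/RRe_real/gtr0_real.
  have er0 : 0 < Re e by rewrite -ltcR -er.
  have [N NP] := uC _ (divr_gt0 er0 (@ltr0Sn R 1)).
  exists (u N); exists N => // n /= Nn; rewrite -ball_normE /= nrmE er ltcR.
  apply: le_lt_trans (NP _ _ (leqnn N) Nn) _.
  by rewrite ltr_pdivrMr// ltr_pMr// ltr1n.
have /cvg_ex[p up] : cvg (u @ \oo) by exact: cauchy_cvg.
exists p => e e0.
have : nbhs p [set y | nrm (y - p) <= e].
  by apply/nbhs_nrmP; exists e => // y /ltW.
by move=> /up [N _ NP]; exists N => n Nn; exact: NP.
Qed.

Lemma complete_op (u : nat -> V) :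
  (forall e : R, 0 < e -> exists N, forall m n, (N <= m)%N -> (N <= n)%N -> nrm (u m - u n) <= e) ->
  exists p, forall e : R, 0 < e -> exists N, forall n, (N <= n)%N -> nrm (u n - p) <= e.
Proof.
move=> uC.
have uk (k : K) (e : R) : 0 < e ->
    exists N, forall m n, (N <= m)%N -> (N <= n)%N -> nrm (u m k - u n k) <= e.
  move=> e0; have k1 : 0 < nrm k + 1 by rewrite ltr_wpDl// nrm_ge0.
  have [N NP] := uC _ (divr_gt0 e0 k1); exists N => m n Nm Nn.
  have := nrm_op_le (u m - u n) k => /le_trans; apply.
  have := ler_wpM2r (nrm_ge0 k) (NP m n Nm Nn) => /le_trans; apply.
  by rewrite mulrAC ler_pdivrMr// ler_pM2l// lerDl.
have /choice[F FP] : forall k, exists p, forall e : R, 0 < e ->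
    exists N, forall n, (N <= n)%N -> nrm (u n k - p) <= e.
  by move=> k; apply: (@complete_seq H (fun n => u n k)); exact: uk.
have nz (W : hilbertType R) (w : W) : (forall e : R, 0 < e -> nrm w <= e) -> w = 0.
  move=> h; apply/eqP; rewrite -nrm_eq0 eq_le nrm_ge0 andbT.
  by apply/ler_addgt0Pr => e e0; rewrite add0r h.
have Fl : linear F.
  move=> a k l; apply/eqP; rewrite -subr_eq0; apply/eqP/nz => e e0.
  pose d := e / (nrm a + 2).
  have a2 : 0 < nrm a + 2 by rewrite ltr_wpDl// nrm_ge0.
  have d0 : 0 < d by rewrite divr_gt0.
  have [N1 h1] := FP (a *: k + l) _ d0.
  have [N2 h2] := FP k _ d0; have [N3 h3] := FP l _ d0.
  pose n := maxn N1 (maxn N2 N3).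
  have -> : F (a *: k + l) - (a *: F k + F l) =
     (a *: (u n k - F k) + (u n l - F l)) - (u n (a *: k + l) - F (a *: k + l)).
    rewrite oprD oprZ scalerBr [in RHS]addrACA -opprD opprB.
    by rewrite [RHS]addrC addrA subrK.
  apply: le_trans (ler_nrmB _ _) _.
  have := ler_nrmD (a *: (u n k - F k)) (u n l - F l); rewrite nrmZ.
  have := h1 n (leq_maxl _ _).
  have := h2 n ltac:(by rewrite leq_max leq_maxl orbT).
  have := h3 n ltac:(by rewrite /n !leq_max leqnn !orbT).
  have : d * (nrm a + 2) = e by rewrite /d divfK// gt_eqF.
  have := nrm_ge0 a; nra.
have [N0 N0P] := uC 1 ltr01.
have [|p pF] := @op_exists R K H F (nrm (u N0) + 1) Fl.
  move=> k; apply/ler_addgt0Pr => e e0.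
  have [N NP] := FP k _ e0; pose n := maxn N N0.
  have := NP n (leq_maxl _ _); have := N0P n N0 (leq_maxr _ _) (leqnn _).
  have := nrm_op_le (u n - u N0) k; have := nrm_op_le (u N0) k.
  have -> : (u n - u N0) k = u n k - u N0 k by [].
  have := ler_nrmB (u n k) (u n k - F k); rewrite opprB addrC subrK.
  have := ler_nrmD (u n k - u N0 k) (u N0 k); rewrite subrK.
  have := nrm_ge0 k; nra.
exists p => e e0; have [N NP] := uC _ e0; exists N => n Nn.
apply: nrm_op_ub => [|k]; first exact: ltW.
apply/ler_addgt0Pr => d d0.
have [M MP] := FP k _ d0; pose m := maxn N M.
have := MP m (leq_maxr _ _).
have -> : (u n - p) k = (u n - u m) k + (u m k - F k).
  by rewrite [RHS](_ : _ = u n k - u m k + (u m k - F k))// addrA subrK -pF.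
have := ler_nrmD ((u n - u m) k) (u m k - F k).
have := nrm_op_le (u n - u m) k; have := NP n m Nn (leq_maxl _ _).
have := nrm_ge0 k; nra.
Qed.

End Completeness.

(** * The Hilbert-Schmidt product and nearest points *)

Section HilbertSchmidt.
Context {R : realType}.
Variables (K H : hilbertType R).
Local Notation V := (boundedOp K H).
Variables (n : nat) (e : 'I_n -> K).
Hypotheses (oe : orthonormal e) (eP : forall v, v = \sum_j inner v (e j) *: e j).
Implicit Types x y z : V.

Definition hs x y : R := \sum_i rdot (x (e i)) (y (e i)).

Lemma hsC x y : hs x y = hs y x.
Proof. by apply: eq_bigr => i _; rewrite rdotC. Qed.
Lemma hsDl x y z : hs (x + y) z = hs x z + hs y z.
Proof. by rewrite -big_split; apply: eq_bigr => i _; exact: rdotDl. Qed.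
Lemma hsZl (t : R) x y : hs (t%:C *: x) y = t * hs x y.
Proof. by rewrite mulr_sumr; apply: eq_bigr => i _; exact: rdotZl. Qed.
Lemma hsNl x y : hs (- x) y = - hs x y.
Proof. by rewrite -sumrN; apply: eq_bigr => i _; exact: rdotNl. Qed.
Lemma hsDr x y z : hs z (x + y) = hs z x + hs z y.
Proof. by rewrite hsC hsDl !(hsC z). Qed.
Lemma hsZr (t : R) x y : hs y (t%:C *: x) = t * hs y x.
Proof. by rewrite hsC hsZl hsC. Qed.
Lemma hsNr x y : hs y (- x) = - hs y x.
Proof. by rewrite hsC hsNl hsC. Qed.
Definition hsE := (hsDl, hsDr, hsNl, hsNr, hsZl, hsZr).

Lemma hs_ge0 x : 0 <= hs x x.
Proof. by apply: sumr_ge0 => i _; rewrite rdotxx sqr_ge0. Qed.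

Lemma nrm_basis i : nrm (e i) = 1.
Proof.
have := oe i i; rewrite innerxx eqxx => /(congr1 (@complex.Re R))/= /eqP.
by rewrite sqrf_eq1 => /orP[/eqP//|/eqP h]; have := nrm_ge0 (e i); rewrite h; lra.
Qed.

Lemma nrm_le_hs x r : 0 <= r -> hs x x <= r ^+ 2 -> nrm x <= n%:R * r.
Proof.
move=> r0 xr; apply: nrm_op_ub => [|k]; first by rewrite mulr_ge0.
have xe i : nrm (x (e i)) <= r.
  apply: ler_of_sqr => //; apply: le_trans xr.
  rewrite /hs (bigD1 i)//= rdotxx lerDl; apply: sumr_ge0 => j _.
  by rewrite rdotxx sqr_ge0.
rewrite [in leLHS](eP k).
have -> : x (\sum_j inner k (e j) *: e j) = \sum_j inner k (e j) *: x (e j).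
  rewrite (big_morph x (oprD x) (opr0 x)); apply: eq_bigr => j _; exact: oprZ.
apply: (@le_trans _ _ (\sum_(j < n) nrm (inner k (e j) *: x (e j)))).
  by elim/big_ind2 : _ => [|u a v b h1 h2|//]; rewrite ?nrm0//;
    apply: le_trans (ler_nrmD _ _) (lerD h1 h2).
apply: (@le_trans _ _ (\sum_(j < n) r * nrm k)); last first.
  by rewrite sumr_const card_ord -mulrA mulr_natl.
apply: ler_sum => j _; rewrite nrmZ mulrC ler_pM ?nrm_ge0//.
by apply: le_trans (nrm_inner_le _ _) _; rewrite nrm_basis mulr1.
Qed.

Lemma hs_le x y : hs x y <= n%:R * (nrm x * nrm y).
Proof.
rewrite mulr_natl -[n in leRHS]card_ord -sumr_const; apply: ler_sum => i _.
apply: le_trans (rdot_le _ _) _.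
have := nrm_op_le x (e i); have := nrm_op_le y (e i); rewrite nrm_basis !mulr1.
by move=> h1 h2; rewrite ler_pM ?nrm_ge0.
Qed.

Definition convex_op (D : set V) := forall x y (t : R), D x -> D y -> 0 <= t <= 1 ->
  D (x + t%:C *: (y - x)).

Definition closed_op (D : set V) := forall x, (forall r : R, 0 < r ->
  exists2 y, D y & nrm (y - x) <= r) -> D x.

(** The minimiser over [D] of hs y y - 2 l y exists by the parallelogram law
    and completeness. For [l] = [hs x] it is the nearest point projection of
    [x], and for [D] the whole space it is the Riesz representative of [l]. *)
Lemma variational_ineq (D : set V) (l : V -> R) (B : R) :
  0 <= B -> D !=set0 -> convex_op D -> closed_op D ->
  (forall x y, l (x + y) = l x + l y) ->
  (forall (t : R) x, l (t%:C *: x) = t * l x) ->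
  (forall x, l x <= B * nrm x) ->
  exists2 p, D p & forall c, D c -> l (c - p) <= hs p (c - p).
Proof.
move=> B_ge0 [d0 Dd0] cvD clD lD lZ lB.
have lN x : l (- x) = - l x.
  by have := lD x (- x); have := lD 0 0; rewrite subrr addr0; lra.
have B0 : 0 <= B + 1 by lra.
pose f y := hs y y - 2 * l y.
have f_lb y : - (B + 1) ^+ 2 * n%:R ^+ 2 <= f y.
  set r := Num.sqrt (hs y y).
  have r0 : 0 <= r by exact: sqrtr_ge0.
  have r2 : r ^+ 2 = hs y y by rewrite sqr_sqrtr// hs_ge0.
  have := @nrm_le_hs y r r0; rewrite r2 lexx => /(_ isT) h.
  have := lB y; have := nrm_ge0 y => ny ly.
  have : l y <= (B + 1) * (n%:R * r) by nra.
  have := sqr_ge0 (r - (B + 1) * n%:R).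
  by rewrite /f -r2; nra.
pose S := [set f y | y in D].
have Sinf : has_inf S.
  split; first by exists (f d0), d0.
  by exists (- (B + 1) ^+ 2 * n%:R ^+ 2) => _ [y _ <-].
pose m := inf S.
have mle y : D y -> m <= f y.
  by move=> Dy; apply: ge_inf; [exact: Sinf.2|exists y].
have /choice[u uP] : forall i : nat, exists y, D y /\ f y < m + i.+1%:R^-1.
  move=> i; have i0 : 0 < i.+1%:R^-1 :> R by rewrite invr_gt0.
  have [_ [y Dy <-] ym] := inf_adherent i0 Sinf.
  by exists y.
have uD i : D (u i) := (uP i).1.
have half01 : 0 <= (2^-1 : R) <= (1 : R) by lra.
have f_mid x y : f (x + (2^-1)%:C *: (y - x)) = (f x + f y) / 2 - hs (x - y) (x - y) / 4.
  by rewrite /f !hsE !lD !lZ !lD !lN (hsC y x); field.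
have uC i j : hs (u i - u j) (u i - u j) <= 2 * (i.+1%:R^-1 + j.+1%:R^-1).
  have := mle _ (cvD _ _ 2^-1 (uD i) (uD j) half01); rewrite f_mid.
  have := (uP i).2; have := (uP j).2.
  move: (f (u i)) (f (u j)) (i.+1%:R^-1) (j.+1%:R^-1) (hs _ _) => *; lra.
have small (d : R) : 0 < d -> exists N : nat, forall i, (N <= i)%N -> i.+1%:R^-1 <= d.
  move=> d00; exists (Num.truncn d^-1) => i Ni.
  rewrite -[leRHS]invrK lef_pV2 ?posrE ?invr_gt0//.
  apply/ltW/(lt_le_trans (truncnS_gt _)).
  by rewrite ler_nat.
have [d dd0|p up] := @complete_op R K H u.
  pose r := d / (n%:R + 1).
  have n1 : 0 < n%:R + 1 :> R by rewrite ltr_wpDl.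
  have r0 : 0 < r by rewrite divr_gt0.
  have [N NP] := small (r ^+ 2 / 4) ltac:(by rewrite divr_gt0// exprn_gt0).
  exists N => i j Ni Nj.
  apply: (@le_trans _ _ (n%:R * r)).
    apply: nrm_le_hs; first exact: ltW.
    apply: le_trans (uC i j) _; have := NP _ Ni; have := NP _ Nj.
    by move: (i.+1%:R^-1) (j.+1%:R^-1) (r ^+ 2) => *; lra.
  by rewrite /r mulrCA ler_piMr ?(ltW dd0)// ler_pdivrMr// mul1r lerDl.
have Dp : D p.
  by apply: clD => r r0; have [N NP] := up r r0; exists (u N) => //; exact: NP.
have fp : f p <= m.
  apply/ler_addgt0Pr => d dd0.
  pose M := n%:R * (2 * nrm p + 1) + 2 * (B + 1).
  have M0 : 0 <= M.
    by rewrite addr_ge0 ?mulr_ge0// addr_ge0// mulr_ge0 ?nrm_ge0.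
  pose r := Num.min 1 (d / 2 / (M + 1)).
  have M1 : 0 < M + 1 by rewrite ltr_wpDl.
  have r0 : 0 < r by rewrite lt_min ltr01 !divr_gt0.
  have r1 : r <= 1 by rewrite ge_min lexx.
  have rM : r * (M + 1) <= d / 2 by rewrite -ler_pdivlMr// ge_min lexx orbT.
  have [N NP] := up r r0; have [N' NP'] := small (d / 2) ltac:(lra).
  pose i := maxn N N'.
  have ui : nrm (u i - p) <= r by apply: NP; exact: leq_maxl.
  have fi : f (u i) <= m + d / 2.
    have := (uP i).2; have := NP' i (leq_maxr _ _).
    by move: (f (u i)) (i.+1%:R^-1) => *; lra.
  suff : f p - f (u i) <= r * M by nra.
  have -> : f p - f (u i) = hs (p - u i) (p + u i) - 2 * l (p - u i).
    rewrite /f !hsE lD lN (hsC (u i) p); ring.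
  have h1 := hs_le (p - u i) (p + u i).
  have h2 := lB (u i - p).
  have h3 : nrm (p + u i) <= 2 * nrm p + 1.
    have -> : p + u i = p + p + (u i - p) by rewrite addrC -addrA [p + (_ - _)]addrC subrK addrC.
    apply: le_trans (ler_nrmD _ _) _; have := ler_nrmD p p; lra.
  rewrite nrmB in h1.
  have -> : l (p - u i) = - l (u i - p) by rewrite -lN opprB.
  have h4 : nrm (u i - p) * nrm (p + u i) <= r * (2 * nrm p + 1).
    by rewrite ler_pM ?nrm_ge0.
  have h5 : n%:R * (nrm (u i - p) * nrm (p + u i)) <= n%:R * (r * (2 * nrm p + 1)).
    by rewrite ler_wpM2l.
  have := nrm_ge0 (u i - p); rewrite /M; nra.
exists p => // c Dc.
have : forall t : R, 0 <= t <= 1 -> m <= f (p + t%:C *: (c - p)).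
  by move=> t t01; apply: mle; exact: cvD.
move: (c - p) => v mv.
have key (t : R) : 0 < t <= 1 -> 2 * (l v - hs p v) <= t * hs v v.
  move=> /andP[t0 t1].
  have := mv t ltac:(lra).
  have -> : f (p + t%:C *: v) = f p + 2 * t * (hs p v - l v) + t ^+ 2 * hs v v.
    by rewrite /f !hsE lD lZ (hsC v p); ring.
  move=> h; have : 0 <= t * (2 * (hs p v - l v) + t * hs v v) by lra.
  by rewrite pmulr_rge0//; lra.
rewrite -subr_le0; apply/ler_addgt0Pr => d dd0; rewrite add0r.
have v0 := hs_ge0 v.
have v1 : 0 < hs v v + 1 by rewrite ltr_wpDl.
pose t := Num.min 1 (d / (hs v v + 1)).
have t0 : 0 < t by rewrite lt_min ltr01 divr_gt0.
have t1 : t <= 1 by rewrite ge_min lexx.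
have td : t * (hs v v + 1) <= d by rewrite -ler_pdivlMr// ge_min lexx orbT.
have := key t ltac:(lra); nra.
Qed.

End HilbertSchmidt.

(** * Weak limits along ultrafilters *)

Section UltrafilterLimits.
Context {R : realType} (T : Type) (U : set_system T).
Hypothesis UU : UltraFilter U.
Implicit Types f : T -> R.

Lemma ultra_cvg f (M : R) : U [set x | `|f x| <= M] -> exists l : R, f @ U --> l.
Proof.
move=> UM; have Up : ProperFilter (f @ U) by exact: fmap_proper_filter.
have UM' : U (f @^-1` `[- M, M]).
  by apply: filterS UM => x /= h; rewrite in_itv /= -ler_norml.
have [l [_ cl]] := @segment_compact R (- M) M (f @ U) Up UM'.
exists l => A nA.
have [UA|UA] := in_ultra_setVsetC (f @^-1` A) UU; first exact: UA.
by have [y []] := cl (~` A) A UA nA.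
Qed.

Lemma cvg_ge0 f (l : R) : f @ U --> l -> U [set x | 0 <= f x] -> 0 <= l.
Proof. by move=> fl f0; exact: (cvgr_to_ge fl f0). Qed.

Lemma cvg_le f (l M : R) : f @ U --> l -> U [set x | f x <= M] -> l <= M.
Proof. by move=> fl f0; exact: (cvgr_to_le fl f0). Qed.

Lemma cvg_fsum (I : finType) (F : I -> T -> R) (l : I -> R) :
  (forall i, F i @ U --> l i) -> (fun x => \sum_i F i x) @ U --> \sum_i l i.
Proof.
move=> h.
have -> : (fun x => \sum_i F i x) = \sum_i F i.
  by apply/funext => x; rewrite fct_sumE.
elim/big_ind2 : _ => //; first exact: cvg_cst.
by move=> f a g b; exact: cvgD.
Qed.

Lemma ultra_forall (I : finType) (P : I -> T -> Prop) :
  (forall i, U [set x | P i x]) -> U [set x | forall i, P i x].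
Proof.
move=> h.
have : forall s : seq I, U [set x | forall i, i \in s -> P i x].
  elim=> [|i s ih]; first by apply: filterS filterT => x _ i; rewrite in_nil.
  apply: filterS (filterI (h i) ih) => x [Pi Ps] j.
  by rewrite in_cons => /predU1P[->|/Ps].
move=> /(_ (enum I)); apply: filterS => x Px i; apply: Px.
by rewrite mem_enum.
Qed.

End UltrafilterLimits.

Section WeakLimit.
Context {R : realType}.
Local Notation C := R[i].
Variables (K H : hilbertType R).
Local Notation V := (boundedOp K H).
Variables (n : nat) (e : 'I_n -> K).
Hypotheses (oe : orthonormal e) (eP : forall v, v = \sum_j inner v (e j) *: e j).
Variable U : set_system V.
Hypothesis UU : UltraFilter U.

Definition weak_to (p : V) :=
  forall k h, (fun z : V => rdot (z k) h) @ U --> rdot (p k) h.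

Lemma weak_to_hs (p q : V) : weak_to p -> (fun z => hs e z q) @ U --> hs e p q.
Proof. by move=> wp; apply: cvg_fsum => i; exact: wp. Qed.

(** Pairings with rank-one operators turn weak limits for [hs] into weak limits of
    the vectors z k. *)
Lemma rank1_exists (k0 : K) (h : H) : exists v : V, forall x, hs e x v = rdot (x k0) h.
Proof.
have [||v vP] := @op_exists R K H (fun k => inner k k0 *: h) (nrm k0 * nrm h).
- by move=> a u w; rewrite innerDl innerZl scalerDl scalerA.
- move=> k; rewrite nrmZ; have := nrm_inner_le k k0; have := nrm_ge0 h; nra.
exists v => x.
have xk : x k0 = \sum_i inner k0 (e i) *: x (e i).
  rewrite {1}(eP k0) (big_morph x (oprD x) (opr0 x)); apply: eq_bigr => j _; exact: oprZ.
rewrite xk /rdot inner_suml.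
rewrite (big_morph (@complex.Re R) (id1 := 0) (op1 := +%R)) //; last by case=> ? ? [? ?].
apply: eq_bigr => i _; rewrite /rdot vP innerZl innerZr; congr (Re (_ * _)).
by rewrite [in RHS]innerC.
Qed.

(** The limits of [hs e z y] along [U] are a bounded linear function of y; its
    Riesz representative is the weak limit. *)
Lemma weak_limit : U [set z | nrm z <= 1] -> exists p, weak_to p.
Proof.
move=> U1.
have /choice[l lP] : forall y, exists l : R, (fun z => hs e z y) @ U --> l.
  move=> y; apply: (@ultra_cvg _ _ _ UU _ (n%:R * nrm y)).
  apply: filterS U1 => z /= z1.
  have b : forall w, hs e z w <= n%:R * nrm w.
    move=> w; apply: le_trans (hs_le oe z w) _.
    by rewrite ler_wpM2l// ler_piMl ?nrm_ge0.
  rewrite ler_norml b andbT lerNl -hsNr.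
  by apply: le_trans (b _) _; rewrite nrmN.
have uniq (f : V -> R) (a b : R) : f @ U --> a -> f @ U --> b -> a = b.
  by move=> fa fb; exact: (@norm_cvg_unique _ _ (f @ U) _ a b fa fb).
have lD x y : l (x + y) = l x + l y.
  apply: (uniq _ _ _ (lP (x + y))).
  have -> : (fun z => hs e z (x + y)) = (fun z => hs e z x) + (fun z => hs e z y).
    by apply/funext => z; rewrite hsDr.
  exact: cvgD.
have lZ (t : R) x : l (t%:C *: x) = t * l x.
  apply: (uniq _ _ _ (lP _)).
  have -> : (fun z => hs e z (t%:C *: x)) = (fun z => t * hs e z x).
    by apply/funext => z; rewrite hsZr.
  by apply: cvgM; [exact: cvg_cst|exact: lP].
have lB x : l x <= n%:R * nrm x.
  apply: (cvg_le UU (lP x)); apply: filterS U1 => z /= z1.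
  apply: le_trans (hs_le oe z x) _.
  by rewrite ler_wpM2l// ler_piMl ?nrm_ge0.
have [|||||||p _ pP] := @variational_ineq R K H n e oe eP setT l n%:R.
- by [].
- by exists 0.
- by [].
- by [].
- exact: lD.
- exact: lZ.
- exact: lB.
have lp v : l v = hs e p v.
  have h w : l w <= hs e p w by have := pP (p + w) I; rewrite [p + w]addrC addrK.
  apply/eqP; rewrite eq_le h /=.
  have := h (- v); rewrite hsNr; have := lD v (- v); have := lD 0 0.
  by rewrite subrr addr0; lra.
exists p => k h; have [v vP] := rank1_exists k h.
have -> : (fun z : V => rdot (z k) h) = (fun z => hs e z v).
  by apply/funext => z; rewrite vP.
by rewrite -vP -lp; exact: lP.
Qed.

(** Mazur: if q is the point of [D] nearest to [p], all z in [D] lie in the closed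
    half-space <z - q, p - q> <= 0, hence so does their weak limit [p]. *)
Lemma weak_limit_mem (D : set V) p : convex_op D -> closed_op D -> U D ->
  weak_to p -> D p.
Proof.
move=> cvD clD UD wp.
have D0 : D !=set0 by exact: filter_ex UD.
have [|||||||q Dq qP] := @variational_ineq R K H n e oe eP D (hs e p) (n%:R * nrm p).
- by rewrite mulr_ge0// nrm_ge0.
- by [].
- by [].
- by [].
- by move=> x y; exact: hsDr.
- by move=> t x; exact: hsZr.
- by move=> x; rewrite -mulrA; exact: hs_le.
suff : hs e (p - q) (p - q) <= 0.
  move=> h; suff : p - q = 0 by move/eqP; rewrite subr_eq0 => /eqP->.
  apply/eqP; rewrite -nrm_eq0 eq_le nrm_ge0 andbT -(mulr0 n%:R).
  by apply: (nrm_le_hs oe eP) => //; rewrite expr0n.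
have c1 : (fun z => hs e z (p - q) - hs e q (p - q)) @ U --> hs e p (p - q) - hs e q (p - q).
  by apply: cvgB; [exact: weak_to_hs|exact: cvg_cst].
have -> : hs e (p - q) (p - q) = hs e p (p - q) - hs e q (p - q).
  by rewrite hsDl hsNl.
apply: (cvg_le UU c1); apply: filterS UD => z Dz /=.
have := qP z Dz; rewrite !hsE !(hsC e z) (hsC e q p); lra.
Qed.

End WeakLimit.

(** * The Opial property *)

Section Opial.
Context {R : realType}.
Variables (K H : hilbertType R).
Local Notation V := (boundedOp K H).

(** Only real parts of inner products occur in [gap], so real coordinates suffice:
    an orthonormal basis together with its multiples by i. *)
Lemma real_basis : finite_dimensional K -> exists (I : finType) (E : I -> K),
  (forall i, nrm (E i) = 1) /\ forall v, v = \sum_i (rdot v (E i))%:C *: E i.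
Proof.
move=> /ortho_basis[n [e [oe eP]]].
exists ('I_n + 'I_n)%type, (fun i => match i with inl j => e j | inr j => 'i%C *: e j end).
split.
  case=> j; rewrite ?nrmZ (nrm_basis oe) // mulr1.
  by rewrite /nrm normc_def /= expr0n expr1n add0r sqrtr1.
move=> v; rewrite {1}(eP v) big_sumType /= -big_split /=; apply: eq_bigr => j _.
rewrite scalerA -scalerDl; congr (_ *: _).
rewrite /rdot innerZr; case: (inner v (e j)) => x y; apply/eqP; rewrite eq_complex /=.
by apply/andP; split; apply/eqP; ring.
Qed.

Variables (I : finType) (E : I -> K).
Hypotheses (E1 : forall i, nrm (E i) = 1)
  (EP : forall v, v = \sum_i (rdot v (E i))%:C *: E i).

Lemma rdot_expand (x y : V) k l : rdot (x k) (y l) =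
  \sum_(q : I * I) rdot k (E q.1) * rdot l (E q.2) * rdot (x (E q.1)) (y (E q.2)).
Proof.
have op_sum (z : V) u : z u = \sum_i (rdot u (E i))%:C *: z (E i).
  rewrite {1}(EP u) (big_morph z (oprD z) (opr0 z)); apply: eq_bigr => j _; exact: oprZ.
rewrite (op_sum x k) (op_sum y l).
have rS (u : H) (F : I -> H) : rdot (\sum_i F i) u = \sum_i rdot (F i) u.
  by rewrite (big_morph (fun w => rdot w u) (fun a b => rdotDl a b u) (rdot0l u)).
rewrite rS -(pair_big xpredT xpredT (fun i j =>
  rdot k (E i) * rdot l (E j) * rdot (x (E i)) (y (E j)))) /=.
apply: eq_bigr => i _; rewrite rdotZl [rdot (x _) _]rdotC rS mulr_sumr; apply: eq_bigr => j _.
by rewrite rdotZl (rdotC (y _)) mulrA.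
Qed.

Lemma sum_small (d : I * I -> R) (eps : R) k l : (forall q, `|d q| <= eps) ->
  `|\sum_q rdot k (E q.1) * rdot l (E q.2) * d q| <=
  #|{: I * I}|%:R * eps * (nrm k * nrm l).
Proof.
move=> dq; apply: le_trans (ler_norm_sum _ _ _) _.
rewrite -mulrA mulr_natl -sumr_const; apply: ler_sum => q _.
rewrite !normrM mulrC ler_pM ?mulr_ge0//.
have := rdot_norm_le k (E q.1); have := rdot_norm_le l (E q.2).
by rewrite !E1 !mulr1 => h1 h2; rewrite ler_pM.
Qed.

Variable U : set_system V.
Hypothesis UU : UltraFilter U.

(** Opial: the members [z] of an ultrafilter that are asymptotically within the
    distance given by [s] of one another are asymptotically strictly closer to
    their weak limit [p]. With tau k = lim |z k - p k|^2 and
    h k = |k|^2 - |p k|^2, letting both points of a pair tend to [p] gives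
    tau <= (1 - s) h, and as K has finite dimension the convergence to tau is
    uniform; so [gap s2 z p] tends to a form bounded below by
    s h k + h l + 2 s2 h(k,l), which is positive as soon as s2^2 < s. *)
Lemma opial (D : set V) (r s : R) (p : V) : 0 <= r < 1 -> 0 < s < 1 ->
  weak_to U p -> U D -> (forall z, D z -> nrm z <= r) -> nrm p <= r ->
  (forall y s', D y -> 0 < s' < s -> U [set z | phclose s' z y]) ->
  exists2 s2, s < s2 <= 1 & U [set z | phclose s2 z p].
Proof.
move=> /andP[r0 r1] /andP[s0 s1] wp UD Dr pr clD.
have [s2 [ss2 s21 s2s]] : exists s2, [/\ s < s2, s2 <= 1 & s2 ^+ 2 < s].
  exists (s * (3 - s) / 2); split; [nra|nra|].
  have -> : (s * (3 - s) / 2) ^+ 2 = s - s * ((1 - s) ^+ 2 * (4 - s)) / 4 by field.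
  have : 0 < s * ((1 - s) ^+ 2 * (4 - s)).
    by rewrite !mulr_gt0 ?exprn_gt0//; lra.
  lra.
have s2_0 : 0 < s2 ^+ 2 by rewrite exprn_gt0//; lra.
pose s' := (s2 ^+ 2 + s) / 2.
have s's : 0 < s' < s by rewrite /s'; lra.
have s2s' : s2 ^+ 2 < s' by rewrite /s'; lra.
have s'0 : 0 < s' by case/andP: s's.
pose th := (s2 ^+ 2 / s' + 1) / 2.
have th1 : th < 1.
  have : s2 ^+ 2 / s' < 1 by rewrite ltr_pdivrMr ?mul1r.
  by rewrite /th; lra.
have th0 : s2 ^+ 2 / s' < th.
  have : s2 ^+ 2 / s' < 1 by rewrite ltr_pdivrMr ?mul1r.
  by rewrite /th; lra.
have thp : 0 < th by apply: lt_trans th0; rewrite divr_gt0.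
have c1 : s2 ^+ 2 / th < s'.
  by rewrite ltr_pdivrMr// mulrC -ltr_pdivrMr.
pose rho := 1 - r ^+ 2.
have rho0 : 0 < rho by rewrite subr_gt0 expr_lt1.
pose c := Num.min (s' - s2 ^+ 2 / th) (1 - th) * rho.
have c0 : 0 < c by rewrite mulr_gt0// lt_min !subr_gt0 c1 th1.
have nz (z : V) (k : K) : nrm z <= r -> nrm (z k) ^+ 2 <= r ^+ 2 * nrm k ^+ 2.
  move=> zr; rewrite -exprMn ler_pXn2r ?nnegrE ?mulr_ge0 ?nrm_ge0//.
  by apply: le_trans (nrm_op_le _ _) _; rewrite ler_wpM2r ?nrm_ge0.
have UR : U [set z | nrm z <= r] by apply: filterS UD => z; exact: Dr.
(* The limit form tau is known by the limits of finitely many matrix entries. *)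
have /choice[tau tauP] : forall q : I * I, exists t : R,
    (fun z : V => rdot ((z - p) (E q.1)) ((z - p) (E q.2))) @ U --> t.
  move=> q; apply: (@ultra_cvg _ _ _ UU _ ((2 * r) * (2 * r))).
  apply: filterS UR => z /= zr; apply: le_trans (rdot_norm_le _ _) _.
  have b i : nrm ((z - p) (E i)) <= 2 * r.
    apply: le_trans (nrm_op_le _ _) _; rewrite E1 mulr1.
    by apply: le_trans (ler_nrmB _ _) _; lra.
  by rewrite ler_pM ?nrm_ge0 ?b.
pose Tau k := \sum_(q : I * I) rdot k (E q.1) * rdot k (E q.2) * tau q.
have TauP k : (fun z : V => nrm ((z - p) k) ^+ 2) @ U --> Tau k.
  have -> : (fun z : V => nrm ((z - p) k) ^+ 2) = (fun z => \sum_(q : I * I)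
     rdot k (E q.1) * rdot k (E q.2) * rdot ((z - p) (E q.1)) ((z - p) (E q.2))).
    by apply/funext => z; rewrite -rdotxx rdot_expand.
  by apply: cvg_fsum => q; apply: cvgM; [exact: cvg_cst|exact: tauP].
have wp0 k h : (fun z : V => rdot ((z - p) k) h) @ U --> (0 : R).
  have -> : (fun z : V => rdot ((z - p) k) h) = (fun z => rdot (z k) h - rdot (p k) h).
    by apply/funext => z; rewrite -rdotBl.
  by rewrite -(subrr (rdot (p k) h)); apply: cvgB; [exact: wp|exact: cvg_cst].
have sqE (z : V) k : nrm (z k) ^+ 2 =
    nrm ((z - p) k) ^+ 2 + 2 * rdot ((z - p) k) (p k) + nrm (p k) ^+ 2.
  by rewrite -sqnrmD -[(z - p) k]/(z k - p k) subrK.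
have sqP k : (fun z : V => nrm (z k) ^+ 2) @ U --> Tau k + nrm (p k) ^+ 2.
  have -> : (fun z : V => nrm (z k) ^+ 2) = (fun z : V => nrm ((z - p) k) ^+ 2
      + 2 * rdot ((z - p) k) (p k) + nrm (p k) ^+ 2).
    by apply/funext => z; exact: sqE.
  apply: cvgD; last exact: cvg_cst.
  rewrite -[Tau k]addr0; apply: cvgD; first exact: TauP.
  by rewrite -[X in _ --> X](mulr0 2); apply: cvgM; [exact: cvg_cst|exact: wp0].
pose h k := nrm k ^+ 2 - nrm (p k) ^+ 2.
have h_lb k : rho * nrm k ^+ 2 <= h k by have := nz p k pr; rewrite /h /rho; lra.
have Tau_le k : Tau k <= (1 - s') * h k.
  suff : 0 <= 2 * (nrm k ^+ 2 - (Tau k + nrm (p k) ^+ 2)) - 2 * s' * h k.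
    by rewrite /h; lra.
  have step y : D y -> 0 <= (nrm k ^+ 2 - (Tau k + nrm (p k) ^+ 2)) +
      (nrm k ^+ 2 - nrm (y k) ^+ 2) - 2 * s' * (nrm k ^+ 2 - rdot (p k) (y k)).
    move=> Dy.
    have : (fun z : V => (nrm k ^+ 2 - nrm (z k) ^+ 2) +
      (nrm k ^+ 2 - nrm (y k) ^+ 2) - 2 * s' * (nrm k ^+ 2 - rdot (z k) (y k))) @ U -->
      (nrm k ^+ 2 - (Tau k + nrm (p k) ^+ 2)) +
      (nrm k ^+ 2 - nrm (y k) ^+ 2) - 2 * s' * (nrm k ^+ 2 - rdot (p k) (y k)).
      apply: cvgB.
        apply: cvgD; last exact: cvg_cst.
        by apply: cvgB; [exact: cvg_cst|exact: sqP].
      apply: cvgM; first exact: cvg_cst.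
      by apply: cvgB; [exact: cvg_cst|exact: wp].
    move/(cvg_ge0 UU); apply; apply: filterS (clD y s' Dy s's) => z /= /(_ k (- k)).
    by rewrite /gap oprN !nrmN !rdotNr rdotxx; lra.
  have : (fun y : V => (nrm k ^+ 2 - (Tau k + nrm (p k) ^+ 2)) +
      (nrm k ^+ 2 - nrm (y k) ^+ 2) - 2 * s' * (nrm k ^+ 2 - rdot (y k) (p k))) @ U -->
      (nrm k ^+ 2 - (Tau k + nrm (p k) ^+ 2)) +
      (nrm k ^+ 2 - (Tau k + nrm (p k) ^+ 2)) - 2 * s' * (nrm k ^+ 2 - rdot (p k) (p k)).
    apply: cvgB.
      apply: cvgD; first exact: cvg_cst.
      by apply: cvgB; [exact: cvg_cst|exact: sqP].
    apply: cvgM; first exact: cvg_cst.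
    by apply: cvgB; [exact: cvg_cst|exact: wp].
  move/(cvg_ge0 UU).
  have UD' : U [set y | 0 <= (nrm k ^+ 2 - (Tau k + nrm (p k) ^+ 2)) +
      (nrm k ^+ 2 - nrm (y k) ^+ 2) - 2 * s' * (nrm k ^+ 2 - rdot (y k) (p k))].
    by apply: filterS UD => y /step /=; rewrite (rdotC (p k)).
  by move=> /(_ UD'); rewrite rdotxx /h; lra.
exists s2; first by rewrite ss2.
pose N := #|{: I * I}|%:R : R.
have N0 : 0 <= N by rewrite /N.
pose eps := c / (4 * (N + 1)).
have eps0 : 0 < eps by rewrite divr_gt0// mulr_gt0// ltr_wpDl.
have epsN : 4 * (N * eps) <= c.
  have : eps * (4 * (N + 1)) = c by rewrite /eps divfK// gt_eqF// mulr_gt0// ltr_wpDl.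
  lra.
have U1 : U [set z | forall q, `|rdot ((z - p) (E q.1)) ((z - p) (E q.2)) - tau q| <= eps].
  apply: ultra_forall => q; have /cvgrPdist_le/(_ eps eps0) := tauP q.
  by apply: filterS => z /=; rewrite distrC.
have U2 : U [set z | forall q, `|rdot ((z - p) (E q.1)) (p (E q.2))| <= eps].
  apply: ultra_forall => q; have /cvgrPdist_le/(_ eps eps0) := wp0 (E q.1) (p (E q.2)).
  by apply: filterS => z /=; rewrite sub0r normrN.
apply: filterS (filterI U1 U2) => z [/= z1 z2] k l.
have e1 : nrm ((z - p) k) ^+ 2 - Tau k <= N * eps * (nrm k * nrm k).
  apply: le_trans (sum_small k k z1); apply: le_trans (ler_norm _).
  rewrite le_eqVlt; apply/orP; left; apply/eqP.
  rewrite -rdotxx rdot_expand /Tau -sumrB; apply: eq_bigr => q _; ring.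
have e2 m : `|rdot ((z - p) k) (p m)| <= N * eps * (nrm k * nrm m).
  by rewrite rdot_expand; exact: sum_small z2.
have e3 := e2 k; have e4 := e2 l.
have psd : 0 <= s2 ^+ 2 / th * h k + th * h l + 2 * s2 * (rdot k l - rdot (p k) (p l)).
  have := h_lb ((s2 / th)%:C *: k + l).
  have : 0 <= rho * nrm ((s2 / th)%:C *: k + l) ^+ 2 by rewrite mulr_ge0 ?sqr_ge0 ?ltW.
  move=> a b; have {a b} := le_trans a b.
  rewrite /h oprD oprZ !sqnrmD !nrmZ !rdotZl nrmC !exprMn.
  rewrite real_normK ?num_real// => a.
  have := mulr_ge0 (ltW thp) a; congr (_ <= _).
  by field; rewrite gt_eqF.
have gE : gap s2 z p k l = (h k - Tau k) - (nrm ((z - p) k) ^+ 2 - Tau k)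
    - 2 * rdot ((z - p) k) (p k) + h l + 2 * s2 * (rdot k l - rdot (p k) (p l))
    - 2 * s2 * rdot ((z - p) k) (p l).
  have zkl : rdot (z k) (p l) = rdot ((z - p) k) (p l) + rdot (p k) (p l).
    by rewrite -rdotDl -[(z - p) k]/(z k - p k) subrK.
  by rewrite /gap sqE zkl /h; ring.
rewrite gE.
have hk := h_lb k; have hl := h_lb l; have tk := Tau_le k.
have ck : c * nrm k ^+ 2 <= (s' - s2 ^+ 2 / th) * h k.
  have : c <= (s' - s2 ^+ 2 / th) * rho by rewrite ler_wpM2r ?(ltW rho0)// ge_min lexx.
  have := sqr_ge0 (nrm k); nra.
have cl : c * nrm l ^+ 2 <= (1 - th) * h l.
  have : c <= (1 - th) * rho by rewrite ler_wpM2r ?(ltW rho0)// ge_min lexx orbT.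
  have := sqr_ge0 (nrm l); nra.
have Ne0 : 0 <= N * eps by rewrite mulr_ge0// ltW.
have e5 : rdot ((z - p) k) (p k) <= N * eps * (nrm k * nrm k).
  exact: le_trans (ler_norm _) e3.
have e6 : s2 * rdot ((z - p) k) (p l) <= N * eps * (nrm k * nrm l).
  apply: le_trans (ler_norm _) _; rewrite normrM -[leRHS]mul1r ler_pM//.
  by rewrite ger0_norm//; lra.
have kl : 2 * (nrm k * nrm l) <= nrm k ^+ 2 + nrm l ^+ 2.
  by have := sqr_ge0 (nrm k - nrm l); lra.
have e7 : N * eps * (2 * (nrm k * nrm l)) <= N * eps * (nrm k ^+ 2 + nrm l ^+ 2).
  by rewrite ler_wpM2l.
have e8 : 4 * (N * eps) * (nrm k ^+ 2 + nrm l ^+ 2) <= c * (nrm k ^+ 2 + nrm l ^+ 2).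
  by rewrite ler_wpM2r// addr_ge0 ?sqr_ge0.
have e9 : 0 <= N * eps * nrm l ^+ 2 by rewrite mulr_ge0 ?sqr_ge0.
rewrite -expr2 in e1 e5.
lra.
Qed.

End Opial.

(** * Convexity and boundedness of pseudo-hyperbolic balls *)

Section CloseTheory.
Context {R : realType}.
Variables (K H : hilbertType R).
Local Notation V := (boundedOp K H).
Implicit Types x y z : V.

Lemma gap_scale (s s' : R) x y k l : s != 0 ->
  gap s' x y k l = (1 - s' / s) * gap 0 x y k l + s' / s * gap s x y k l.
Proof. by move=> s0; rewrite /gap; field. Qed.

Lemma nrm_op_sqr (r : R) x k : nrm x <= r -> nrm (x k) ^+ 2 <= r ^+ 2 * nrm k ^+ 2.
Proof.
move=> xr; have r0 : 0 <= r by apply: le_trans xr; exact: nrm_ge0.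
rewrite -exprMn ler_pXn2r ?nnegrE ?mulr_ge0 ?nrm_ge0//.
by apply: le_trans (nrm_op_le _ _) _; rewrite ler_wpM2r ?nrm_ge0.
Qed.

Lemma gap0_ge (r : R) x y k l : nrm x <= r -> nrm y <= r ->
  (1 - r ^+ 2) * (nrm k ^+ 2 + nrm l ^+ 2) <= gap 0 x y k l.
Proof.
by move=> /(nrm_op_sqr k) hx /(nrm_op_sqr l) hy; rewrite /gap; lra.
Qed.

Lemma mixed_le (r : R) x y k l : nrm x <= r -> nrm y <= r -> r <= 1 ->
  `|rdot k l - rdot (x k) (y l)| <= nrm k ^+ 2 + nrm l ^+ 2.
Proof.
move=> xr yr r1; apply: le_trans (ler_normB _ _) _.
have h1 := rdot_norm_le k l; have h2 := rdot_norm_le (x k) (y l).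
have h3 : nrm (x k) * nrm (y l) <= nrm k * nrm l.
  have b z m : nrm z <= r -> nrm ((z : V) m) <= nrm m.
    move=> zr; apply: le_trans (nrm_op_le _ _) _.
    by rewrite ler_piMl ?nrm_ge0// (le_trans zr).
  by rewrite ler_pM ?nrm_ge0 ?b.
have := sqr_ge0 (nrm k - nrm l); lra.
Qed.

(** The form is concave in its second point because of the term - |y l|^2, the
    others being affine. *)
Lemma gap_convex s x y1 y2 (t : R) k l : 0 <= t <= 1 ->
  (1 - t) * gap s x y1 k l + t * gap s x y2 k l <= gap s x (y1 + t%:C *: (y2 - y1)) k l.
Proof.
move=> /andP[t0 t1].
have E : (y1 + t%:C *: (y2 - y1)) l = y1 l + t%:C *: (y2 l - y1 l) by [].
rewrite /gap E sqnrmD nrmZ nrmC exprMn real_normK ?num_real// sqnrmB.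
rewrite rdotDr !rdotZr !rdotBr rdotxx (rdotC (y2 l)).
have : 0 <= t * (1 - t) * nrm (y2 l - y1 l) ^+ 2.
  by apply: mulr_ge0; [apply: mulr_ge0; lra|exact: sqr_ge0].
rewrite sqnrmB (rdotC (y2 l)); lra.
Qed.

Lemma phclose_convex s x : convex_op [set y | phclose s x y].
Proof.
move=> y1 y2 t h1 h2 t01 k l; apply: le_trans (gap_convex _ _ _ _ _ _ t01).
by case/andP: t01 => t0 t1; rewrite addr_ge0// mulr_ge0 ?subr_ge0// ?h1 ?h2.
Qed.

(** On the ball of radius r the diagonal part of [gap] is at least 1 - r^2 times a
    bound for the mixed part, so distances there are bounded away from 1. *)
Lemma phclose_small (r : R) x y : nrm x <= r -> nrm y <= r -> r <= 1 ->
  phclose ((1 - r ^+ 2) / 2) x y.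
Proof.
move=> xr yr r1 k l; set s := _ / 2.
have := gap0_ge k l xr yr; have := mixed_le k l xr yr r1.
rewrite ler_norml => /andP[h _].
have r0 : 0 <= r by apply: le_trans xr; exact: nrm_ge0.
have s0 : 0 <= s by rewrite /s divr_ge0// subr_ge0 expr_le1.
have -> : gap s x y k l = gap 0 x y k l + 2 * s * (rdot k l - rdot (x k) (y l)).
  by rewrite /gap; ring.
have -> : 1 - r ^+ 2 = 2 * s by rewrite /s; field.
move: (nrm k ^+ 2 + nrm l ^+ 2) (rdot k l - _) h => N m h; nra.
Qed.

(** The converse of [phclose_small]. If |y l| were near |l| then the gap at the
    pair (- t l, l) would be negative for a small t > 0, because the mixed part is
    at least (1 - r) |l|^2. *)
Lemma phclose_bounded (s r : R) x y : 0 < s <= 1 -> nrm x <= r -> r < 1 -> nrm y <= 1 ->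
  phclose s x y -> nrm y <= 1 - (s * (1 - r)) ^+ 2 / 2.
Proof.
move=> /andP[s0 s1] xr r1 y1 h; set d := s * (1 - r).
have r0 : 0 <= r by apply: le_trans xr; exact: nrm_ge0.
have d0 : 0 < d by rewrite mulr_gt0// subr_gt0.
have d1 : d <= 1 by rewrite /d mulr_ile1//; lra.
have d2 : d ^+ 2 <= 1 by rewrite expr_le1// ltW.
have ds : d = s * (1 - r) by [].
clearbody d.
apply: nrm_op_ub => [|l]; first by lra.
apply: ler_of_sqr; first by rewrite mulr_ge0 ?nrm_ge0//; lra.
(* t = d minimises t^2 - 2 s t (1 - r) *)
rewrite exprMn; have := h ((- d)%:C *: l) l.
rewrite /gap oprZ !nrmZ nrmC normrN !exprMn !rdotZl real_normK ?num_real// rdotxx.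
have xl := sqr_ge0 (nrm (x l)).
have : rdot (x l) (y l) <= r * nrm l ^+ 2.
  apply: le_trans (rdot_le _ _) _; rewrite expr2 mulrA.
  have := nrm_op_le x l; have := nrm_op_le y l; have := nrm_ge0 l => nl yl xxl.
  rewrite ler_pM ?nrm_ge0//.
    by apply: le_trans xxl _; rewrite ler_wpM2r.
  by apply: le_trans yl _; rewrite ler_piMl.
move: (nrm (x l) ^+ 2) (nrm (y l) ^+ 2) (nrm l ^+ 2) (rdot (x l) (y l))
  xl (sqr_ge0 (nrm l)) => X Y L q X0 L0 qL hh.
have hq : 2 * s * d * q <= 2 * s * d * (r * L).
  by rewrite ler_wpM2l//; apply: mulr_ge0; lra.
have e : 2 * s * d * (1 - r) = 2 * d ^+ 2 by rewrite ds; ring.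
have e' : 2 * s * d * L - 2 * s * d * (r * L) = 2 * d ^+ 2 * L by rewrite -e; ring.
have hX : 0 <= d ^+ 2 * X by rewrite mulr_ge0// sqr_ge0.
have hd : 0 <= (d ^+ 2 / 2) ^+ 2 * L by rewrite mulr_ge0// sqr_ge0.
have -> : (1 - d ^+ 2 / 2) ^+ 2 * L = L - d ^+ 2 * L + (d ^+ 2 / 2) ^+ 2 * L by field.
lra.
Qed.

(** Passing from s to s' < s leaves the share 1 - s' / s of the diagonal part of
    [gap], which is positive definite, to absorb a perturbation. *)
Lemma phclose_perturb (s s' r : R) : 0 < s' < s -> r < 1 -> exists2 d : R, 0 < d &
  forall x y y', nrm x <= r -> nrm y <= r -> nrm y' <= r -> nrm (y' - y) <= d ->
    phclose s x y -> phclose s' x y'.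
Proof.
move=> /andP[s'0 s's] r1; have s0 : 0 < s by lra.
have q1 : s' / s < 1 by rewrite ltr_pdivrMr ?mul1r.
have [r0|r0] := ltP r 0.
  by exists 1 => // x y y' xr; have := nrm_ge0 x; lra.
have rr : r ^+ 2 < 1 by rewrite expr_lt1.
pose m := s' + 1.
have m0 : 0 < m by rewrite addr_gt0.
pose d := (1 - s' / s) * (1 - r ^+ 2) / (2 * m).
have dE : d * (2 * m) = (1 - s' / s) * (1 - r ^+ 2).
  by rewrite /d divfK// gt_eqF// mulr_gt0.
have d0 : 0 < d by rewrite divr_gt0 ?mulr_gt0 ?subr_gt0.
exists d => // x y y' xr yr y'r yy' h k l.
have h1 : (1 - s' / s) * (1 - r ^+ 2) * (nrm k ^+ 2 + nrm l ^+ 2) <= gap s' x y k l.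
  rewrite (@gap_scale s) ?gt_eqF//.
  have a1 : (1 - s' / s) * ((1 - r ^+ 2) * (nrm k ^+ 2 + nrm l ^+ 2)) <=
      (1 - s' / s) * gap 0 x y k l.
    by apply: ler_wpM2l; [lra|exact: gap0_ge].
  have a2 : 0 <= s' / s * gap s x y k l by apply: mulr_ge0; [apply: divr_ge0; lra|exact: h].
  lra.
set w := y' l - y l.
have wl : nrm w <= d * nrm l.
  apply: le_trans (nrm_op_le (y' - y) l) _.
  by rewrite ler_wpM2r ?nrm_ge0.
have nl (z : V) m' : nrm z <= r -> nrm (z m') <= nrm m'.
  move=> zr; apply: le_trans (nrm_op_le _ _) _.
  by rewrite ler_piMl ?nrm_ge0//; lra.
have e1 : nrm (y' l) ^+ 2 - nrm (y l) ^+ 2 <= 2 * d * nrm l ^+ 2.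
  have -> : nrm (y' l) ^+ 2 - nrm (y l) ^+ 2 = rdot w (y' l) + rdot w (y l).
    by rewrite /w !rdotBl !rdotxx (rdotC (y l)); ring.
  have b (z : V) : nrm z <= r -> rdot w (z l) <= d * nrm l ^+ 2.
    move=> zr; apply: le_trans (rdot_le _ _) _; rewrite expr2 mulrA.
    by rewrite ler_pM ?nrm_ge0 ?nl.
  have := b _ y'r; have := b _ yr; lra.
have e2 : 2 * rdot (x k) w <= d * (nrm k ^+ 2 + nrm l ^+ 2).
  have b : rdot (x k) w <= nrm k * (d * nrm l).
    by apply: le_trans (rdot_le _ _) _; rewrite ler_pM ?nrm_ge0 ?nl.
  have : 0 <= d * (nrm k - nrm l) ^+ 2 by rewrite mulr_ge0 ?sqr_ge0// ltW.
  lra.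
have e3 : s' * (2 * rdot (x k) w) <= s' * (d * (nrm k ^+ 2 + nrm l ^+ 2)).
  by rewrite ler_wpM2l// ltW.
have -> : gap s' x y' k l = gap s' x y k l - (nrm (y' l) ^+ 2 - nrm (y l) ^+ 2)
    - s' * (2 * rdot (x k) w).
  by rewrite /gap /w rdotBr; ring.
have k2 := sqr_ge0 (nrm k); have l2 := sqr_ge0 (nrm l).
move: (nrm k ^+ 2) (nrm l ^+ 2) k2 l2 h1 e1 e3 => k2 l2 k20 l20.
rewrite -dE /m => h1 e1 e3.
have : 0 <= d * s' * (k2 + l2) by rewrite mulr_ge0 ?addr_ge0// mulr_ge0 ?ltW.
have := mulr_ge0 (ltW d0) k20; lra.
Qed.

(** By concavity the gap at the midpoint is at least the mean of the two. The one
    of y1 at the parameter sg + e < s is positive definite with a constant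
    independent of e, and outweighs the O(e) by which the one of y2 may be
    negative. *)
Lemma phclose_mid (sg s r : R) : 0 < sg < s -> r < 1 -> exists2 e0 : R, 0 < e0 &
  forall e x y1 y2, 0 < e <= e0 -> nrm x <= r -> nrm y1 <= r -> nrm y2 <= r ->
    phclose s x y1 -> phclose (sg - e) x y2 -> phclose (sg + e) x (y1 + 2^-1%:C *: (y2 - y1)).
Proof.
move=> /andP[sg0 sgs] r1; have s0 : 0 < s by lra.
have [r0|r0] := ltP r 0.
  by exists 1 => // e x y1 y2 _ xr; have := nrm_ge0 x; lra.
have rr : r ^+ 2 < 1 by rewrite expr_lt1.
pose q := (sg + s) / 2 / s.
have q1 : q < 1 by rewrite ltr_pdivrMr ?mul1r//; lra.
pose e1 := (1 - q) * (1 - r ^+ 2) / 4.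
have e10 : 0 < e1 by rewrite divr_gt0// mulr_gt0 ?subr_gt0.
exists (Num.min e1 ((s - sg) / 2)).
  by rewrite lt_min e10 divr_gt0// subr_gt0.
move=> e x y1 y2 /andP[e0]; rewrite le_min => /andP[ee1 es] xr y1r y2r h1 h2 k l.
have half01 : 0 <= (2^-1 : R) <= (1 : R) by lra.
apply: le_trans (gap_convex _ _ _ _ _ _ half01).
suff : 0 <= gap (sg + e) x y1 k l + gap (sg + e) x y2 k l by lra.
set N := nrm k ^+ 2 + nrm l ^+ 2.
have N0 : 0 <= N by rewrite addr_ge0 ?sqr_ge0.
have a1 : (1 - q) * ((1 - r ^+ 2) * N) <= gap (sg + e) x y1 k l.
  rewrite (@gap_scale s) ?gt_eqF//.
  have qe : (sg + e) / s <= q by rewrite /q ler_pM2r ?invr_gt0//; lra.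
  have b1 := gap0_ge k l xr y1r.
  have b0 : 0 <= (1 - r ^+ 2) * N by rewrite mulr_ge0// subr_ge0 ltW.
  have b2 : 0 <= (sg + e) / s * gap s x y1 k l.
    by apply: mulr_ge0; [apply: divr_ge0; lra|exact: h1].
  have b3 : (1 - q) * ((1 - r ^+ 2) * N) <= (1 - (sg + e) / s) * gap 0 x y1 k l.
    rewrite ler_pM//; first by rewrite subr_ge0 ltW.
    lra.
  lra.
have a2 : gap (sg + e) x y2 k l = gap (sg - e) x y2 k l + 4 * e * (rdot k l - rdot (x k) (y2 l)).
  by rewrite /gap; ring.
have := mixed_le k l xr y2r (ltW r1); rewrite ler_norml => /andP[a3 _].
have a4 := h2 k l.
have a5 : e * - N <= e * (rdot k l - rdot (x k) (y2 l)) by rewrite ler_wpM2l// ltW.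
have a6 : e * N <= e1 * N by rewrite ler_wpM2r.
have a7 : 4 * (e1 * N) = (1 - q) * ((1 - r ^+ 2) * N) by rewrite /e1; field.
rewrite a2; lra.
Qed.

Lemma phclose_near s x y k : 0 < s <= 1 -> phclose s x y ->
  nrm ((x - y) k) ^+ 2 * s <= 2 * (1 - s) * nrm k ^+ 2.
Proof.
move=> /andP[s0 s1] /(_ k (- k)); rewrite /gap oprN !nrmN !rdotNr rdotxx.
rewrite -[(x - y) k]/(x k - y k) sqnrmB.
have := sqr_ge0 (nrm (x k)); have := sqr_ge0 (nrm (y k)); have := sqr_ge0 (nrm k).
move: (nrm (x k) ^+ 2) (nrm (y k) ^+ 2) (nrm k ^+ 2) (rdot (x k) (y k)) => X Y k2 q *.
nra.
Qed.

End CloseTheory.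

(** * Invariant convex sets of asymptotic centers *)

Section Dynamics.
Context {R : realType}.
Variables (K H : hilbertType R).
Local Notation V := (boundedOp K H).
Implicit Types (x y z : V) (f g : V -> V) (D X Y : set V).

Local Notation ball := [set x : V | nrm x < 1].

Definition op_closure X : set V :=
  [set x | forall r : R, 0 < r -> exists2 y, X y & nrm (y - x) <= r].

Lemma op_closure_sub X : X `<=` op_closure X.
Proof. by move=> x Xx r r0; exists x => //; rewrite subrr nrm0 ltW. Qed.

Lemma op_closure_closed X : closed_op (op_closure X).
Proof.
move=> x h r r0; have r2 : 0 < r / 2 by rewrite divr_gt0.
have [y yX yx] := h _ r2; have [z Xz zy] := yX _ r2; exists z => //.
have -> : z - x = (z - y) + (y - x) by rewrite addrA subrK.
by apply: le_trans (ler_nrmD _ _) _; lra.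
Qed.

Lemma op_closure_min X D : closed_op D -> X `<=` D -> op_closure X `<=` D.
Proof. by move=> cD XD x h; apply: cD => r /h[y /XD]; exists y. Qed.

Lemma op_closure_convex X : convex_op X -> convex_op (op_closure X).
Proof.
move=> cX x y t hx hy /andP[t0 t1] r r0.
have [x' Xx' xx] := hx _ r0; have [y' Xy' yy] := hy _ r0.
exists (x' + t%:C *: (y' - x')); first by apply: cX => //; rewrite t0.
have -> : x' + t%:C *: (y' - x') - (x + t%:C *: (y - x)) =
    (1 - t)%:C *: (x' - x) + t%:C *: (y' - y).
  transitivity ((x' - x) + t%:C *: ((y' - y) - (x' - x))).
    rewrite opprD addrACA -scalerBr; congr (_ + _ *: _).
    by rewrite !opprB addrACA [in RHS]addrACA [- x' - y]addrC.
  rewrite rmorphB rmorph1 scalerBl scale1r scalerBr -[RHS]addrA.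
  by congr (_ + _); rewrite addrC.
apply: le_trans (ler_nrmD _ _) _; rewrite !nrmZ !nrmC !ger0_norm//; last by lra.
have := nrm_ge0 (x' - x); have := nrm_ge0 (y' - y); nra.
Qed.

Lemma nrm_closed (r : R) : closed_op [set x : V | nrm x <= r].
Proof.
move=> x h; apply/ler_addgt0Pr => e /h[y /= yr yx].
have -> : x = y - (y - x) by rewrite opprB addrC subrK.
by apply: le_trans (ler_nrmB _ _) _; lra.
Qed.

Lemma nrm_convex (r : R) : convex_op [set x : V | nrm x <= r].
Proof.
move=> x y t /= xr yr /andP[t0 t1].
have -> : x + t%:C *: (y - x) = (1 - t)%:C *: x + t%:C *: y.
  by rewrite rmorphB rmorph1 scalerBl scale1r scalerBr addrA addrAC.
apply: le_trans (ler_nrmD _ _) _; rewrite !nrmZ !nrmC !ger0_norm//; last by lra.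
nra.
Qed.

Lemma ball_convex : convex_op ball.
Proof.
move=> x y t /= xr yr t01.
have h : forall z, z \in [:: x; y] -> nrm z <= Num.max (nrm x) (nrm y).
  by move=> z; rewrite !inE => /orP[]/eqP->; rewrite le_max lexx ?orbT.
apply: le_lt_trans (_ : Num.max (nrm x) (nrm y) < 1); last by rewrite gt_max xr.
by apply: (@nrm_convex _ x y t) => //=; apply: h; rewrite !inE eqxx ?orbT.
Qed.

Hypothesis fdK : finite_dimensional K.
Variable E : set (V -> V).
Hypothesis Eball : forall f x, E f -> nrm x < 1 -> nrm (f x) < 1.
Hypothesis Ediff : forall f x, E f -> nrm x < 1 -> differentiable f x.
Hypothesis Ecomm : forall f g x, E f -> E g -> nrm x < 1 -> f (g x) = g (f x).

Inductive composite : (V -> V) -> Prop :=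
| composite_id : composite id
| composite_cons f g : E f -> composite g -> composite (fun x => f (g x)).

Lemma composite_comp f g : composite f -> composite g -> composite (fun x => f (g x)).
Proof. by move=> wf wg; elim: wf => // h f' Eh _; exact: composite_cons. Qed.

Lemma composite_inv X f : invariant_set E X -> composite f -> forall x, X x -> X (f x).
Proof.
move=> iX; elim=> // h g Eh _ ih x Xx; apply: (iX _ Eh).
by exists (g x) => //; exact: ih.
Qed.

Lemma composite_ball f x : composite f -> nrm x < 1 -> nrm (f x) < 1.
Proof. by move=> wf; elim: wf x => // h g Eh _ ih x x1; apply: Eball => //; exact: ih. Qed.

Lemma composite_comm f g x : composite f -> composite g -> nrm x < 1 -> f (g x) = g (f x).
Proof.
move=> wf wg; elim: wf x => // h f' Eh wf' ih x x1; rewrite ih//.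
have : nrm (f' x) < 1 by exact: composite_ball.
move: (f' x) => {x1} x x1; elim: wg x x1 => // h' g' Eh' wg' ih' y y1.
by rewrite Ecomm ?ih'//; exact: composite_ball.
Qed.

Lemma composite_close f s x y : composite f -> 0 < s <= 1 -> nrm x < 1 -> nrm y < 1 ->
  phclose s x y -> phclose s (f x) (f y).
Proof.
move=> wf s01 x1 y1 h; elim: wf => // f' g Ef wg ih.
by apply: schwarz_pick => //; [move=> z; exact: Eball|move=> z; exact: Ediff|
  exact: composite_ball..].
Qed.

(** Sublevel sets of the asymptotic radius of [X], the infimum over g of the
    radius of g(X) around y. *)
Definition centers X Y (s : R) : set V :=
  [set y | Y y /\ exists2 g, composite g & forall x, X x -> phclose s (g x) y].

(** If g1 serves for y1 and g2 for y2 then, as the maps commute and preserve [X],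
    their composite serves for both. *)
Lemma centers_convex X Y s : X `<=` ball -> invariant_set E X -> convex_op Y ->
  convex_op (centers X Y s).
Proof.
move=> XB iX cY y1 y2 t [Yy1 [g1 w1 h1]] [Yy2 [g2 w2 h2]] t01.
split; first exact: cY.
exists (fun x => g1 (g2 x)); first exact: composite_comp.
move=> x Xx; apply: phclose_convex => //=.
  by apply: h1; exact: composite_inv iX w2 _ Xx.
rewrite (composite_comm w1 w2); last exact: XB.
by apply: h2; exact: composite_inv iX w1 _ Xx.
Qed.

Lemma centers_inv X Y s : 0 < s <= 1 -> X `<=` ball -> Y `<=` ball ->
  invariant_set E Y -> invariant_set E (centers X Y s).
Proof.
move=> s01 XB YB iY f Ef _ [y [Yy [g wg h]] <-]; split.
  by apply: iY Ef _ _; exists y.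
exists (fun x => f (g x)); first exact: composite_cons.
move=> x Xx; apply: (@composite_close f) => //; last exact: h.
- exact: (composite_cons Ef composite_id).
- by apply: composite_ball => //; exact: XB.
- exact: YB.
Qed.

Lemma closure_inv X (r : R) : r < 1 -> (forall x, X x -> nrm x <= r) ->
  invariant_set E X -> invariant_set E (op_closure X).
Proof.
move=> r1 Xr iX f Ef _ [x cx <-] e e0.
have x1 : nrm x < 1.
  apply: le_lt_trans r1; apply: (op_closure_min (@nrm_closed r) _ cx) => y.
  exact: Xr.
have [d d0 dP] := differentiable_eps_delta (Ediff Ef x1) e0.
have [y Xy yx] := cx (d / 2) ltac:(by rewrite divr_gt0).
exists (f y); first by apply: iX Ef _ _; exists y.
by apply/ltW/dP; lra.
Qed.

Definition admissible (r : R) D :=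
  [/\ D !=set0, convex_op D, closed_op D, invariant_set E D & forall x, D x -> nrm x <= r].

(** Zorn's lemma applies because the intersection of a chain is not empty: it
    contains the weak limit along any ultrafilter refining the chain. *)
Lemma minimal_admissible (r : R) D0 : r < 1 -> admissible r D0 ->
  exists2 D, admissible r D & forall D', D' `<=` D -> admissible r D' -> D' = D.
Proof.
move=> r1 aD0; have [n [e [oe eP]]] := ortho_basis fdK.
have [[x0 D0x0] cv0 cl0 in0 D0r] := aD0.
(* complements in D0, to have a maximal element in place of a minimal one *)
pose P X := admissible r (D0 `\` X).
have [|A [PA Amax]] := @Zorn_bigcup V P.
  move=> F FP Ftot; rewrite /P.
  have [->|/set0P[X0 FX0]] := eqVneq F set0; first by rewrite bigcup_set0 setD0.
  have E0 : D0 `\` \bigcup_(X in F) X = \bigcap_(X in F) (D0 `\` X).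
    apply/seteqP; split=> [x [Dx nx] X FX|x h].
      by split=> // Xx; apply: nx; exists X.
    split; first exact: (h _ FX0).1.
    by move=> [X FX Xx]; exact: (h _ FX).2.
  rewrite E0; split.
  - pose G := filter_from F (fun X => D0 `\` X).
    have FG : Filter G.
      apply: filter_from_filter; first by exists X0.
      move=> X Y FX FY; have [XY|YX] := Ftot _ _ FX FY.
        by exists Y => // x [Dx nY]; split; split=> // /XY.
      by exists X => // x [Dx nX]; split; split=> // /YX.
    have PG : ProperFilter G.
      by apply: filter_from_proper => X /FP[].
    have [U [UU GU]] := ultraFilterLemma PG.
    have UF X : F X -> U (D0 `\` X) by move=> FX; apply: GU; exists X.
    have U1 : U [set z | nrm z <= 1].
      apply: filterS (UF _ FX0) => z [Dz _] /=.
      by apply: le_trans (D0r _ Dz) _; exact: ltW.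
    have [p pU] := weak_limit oe eP UU U1.
    exists p => X FX; have [_ cX clX _ _] := FP _ FX.
    exact: (weak_limit_mem oe eP UU cX clX (UF _ FX) pU).
  - move=> x y t hx hy t01 X FX; have [_ cX _ _ _] := FP _ FX.
    by apply: cX t01; [exact: hx|exact: hy].
  - move=> x hx X FX; have [_ _ cX _ _] := FP _ FX.
    by apply: cX => s s0; have [y /(_ _ FX)] := hx s s0; exists y.
  - move=> f Ef _ [x hx <-] X FX; have [_ _ _ iX _] := FP _ FX.
    by apply: iX Ef _ _; exists x => //; exact: hx.
  by move=> x /(_ _ FX0)[/D0r].
exists (D0 `\` A) => // D' D'D aD'.
apply/seteqP; split=> //; apply: contrapT => nD.
apply: (Amax (A `|` ((D0 `\` A) `\` D'))).
  split; first by move=> x Ax; left.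
  move=> h; apply: nD => x Dx; apply: contrapT => nx.
  by have := h x (or_intror (conj Dx nx)); exact: Dx.2.
rewrite /P; have -> // : D0 `\` (A `|` ((D0 `\` A) `\` D')) = D'.
apply/seteqP; split=> [x [Dx nx]|x D'x].
  by apply: contrapT => nD'; apply: nx; have [Ax|nA] := pselect (A x); [left|right].
have [Dx nAx] := D'D _ D'x; split=> // -[//|[_]].
by apply.
Qed.

End Dynamics.

(** * Common fixed points *)

Section FixedPoint.
Context {R : realType}.
Local Notation C := R[i].
Variables (K H : hilbertType R).
Local Notation V := (boundedOp K H).
Implicit Types (x y z : V) (f g : V -> V) (D X Y : set V).
Hypothesis fdK : finite_dimensional K.
Variable E : set (V -> V).
Hypothesis Eball : forall f x, E f -> nrm x < 1 -> nrm (f x) < 1.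
Hypothesis Ediff : forall f x, E f -> nrm x < 1 -> differentiable f x.
Hypothesis Ecomm : forall f g x, E f -> E g -> nrm x < 1 -> f (g x) = g (f x).
Local Notation composite := (composite E).
Local Notation centers := (centers E).
Local Notation admissible := (admissible E).

Section Minimal.
Variables (r : R) (D : set V).
Hypotheses (r1 : r < 1) (aD : admissible r D).
Hypothesis Dmin : forall D', D' `<=` D -> admissible r D' -> D' = D.

Let D0 : D !=set0. Proof. by case: aD. Qed.
Let Dcv : convex_op D. Proof. by case: aD. Qed.
Let Dcl : closed_op D. Proof. by case: aD. Qed.
Let Din : invariant_set E D. Proof. by case: aD. Qed.
Let Dr x : D x -> nrm x <= r. Proof. by case: aD => _ _ _ _; apply. Qed.
Let D1 x : D x -> nrm x < 1. Proof. by move=> /Dr/le_lt_trans; apply. Qed.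

Let r0 : 0 <= r.
Proof. by have [x /Dr] := D0; apply: le_trans; exact: nrm_ge0. Qed.

(* The closure of the sublevel set is admissible, hence all of D; the loss from s
   to s' pays for passing to the closure. *)
Let centers_full s s' : 0 < s' < s -> s <= 1 -> centers D D s !=set0 -> D `<=` centers D D s'.
Proof.
move=> s's s1 [y0 Cy0].
have s0 : 0 < s <= 1 by rewrite s1 andbT; lra.
have CD : centers D D s `<=` D by move=> x [].
have cE : op_closure (centers D D s) = D.
  apply: Dmin; first exact: op_closure_min.
  split.
  - by exists y0; exact: op_closure_sub.
  - exact/op_closure_convex/centers_convex.
  - exact: op_closure_closed.
  - by apply: (closure_inv Ediff r1) => [x /CD/Dr//|]; exact: centers_inv.
  - by move=> x h; apply/Dr/(op_closure_min Dcl CD).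
move=> y Dy; have cy : op_closure (centers D D s) y by rewrite cE.
have [d d0 dP] := phclose_perturb K H s's r1.
have [y' [Dy' [g wg h]] yy'] := cy d d0.
split=> //; exists g => // x Dx; apply: (dP (g x) y' y).
- exact: Dr (composite_inv Din wg Dx).
- exact: Dr.
- exact: Dr.
- by rewrite nrmB.
- exact: h.
Qed.

Let s0 := (1 - r ^+ 2) / 2.
Let s0_gt0 : 0 < s0. Proof. by rewrite divr_gt0// subr_gt0 expr_lt1. Qed.
Let s0_le1 : s0 <= 1. Proof. by have := sqr_ge0 r; rewrite /s0; lra. Qed.

(* Larger parameters are smaller distances: sg is the parameter of the asymptotic
   radius of D, common to all points of D. *)
Let S := [set s : R | 0 < s <= 1 /\ centers D D s !=set0].

Let Ss0 : S s0.
Proof.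
split; first by rewrite s0_gt0.
have [y Dy] := D0; exists y; split=> //; exists id; first exact: composite_id.
by move=> x Dx; apply: phclose_small; [exact: Dr|exact: Dr|exact: ltW].
Qed.

Let S_ub : ubound S 1. Proof. by move=> s [/andP[]]. Qed.
Let S_sup : has_sup S. Proof. by split; [exists s0|exists 1]. Qed.
Let sg := sup S.
Let sg_gt0 : 0 < sg.
Proof. by apply: lt_le_trans s0_gt0 _; exact: (sup_upper_bound S_sup). Qed.
Let sg_le1 : sg <= 1. Proof. by apply: ge_sup => //; exists s0. Qed.

Let below s y : 0 < s < sg -> D y -> centers D D s y.
Proof.
move=> /andP[sp slt] Dy.
have e0 : 0 < sg - s by rewrite subr_gt0.
have [s' [/andP[s'0 s'1] ne] lt] := sup_adherent e0 S_sup.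
apply: (centers_full _ s'1 ne) => //; rewrite sp /=.
by move: lt; rewrite -/sg; lra.
Qed.

Let above s y g : sg < s <= 1 -> D y -> composite g -> exists2 x, D x & ~ phclose s (g x) y.
Proof.
move=> /andP[slt s1] Dy wg; apply: contrapT => h.
have : S s.
  split; first by rewrite s1 andbT; exact: lt_trans slt.
  exists y; split=> //; exists g => // x Dx; apply: contrapT => nc.
  by apply: h; exists x.
by move/(sup_upper_bound S_sup); rewrite leNgt slt.
Qed.

(* Two points of D are both close to the points g (g' x) = g' (g x). *)
Let singleton : sg = 1 -> forall y y', D y -> D y' -> y = y'.
Proof.
move=> sg1.
suff h y y' : D y -> D y' -> forall k (e : R), 0 < e < 1 ->
    nrm ((y - y') k) <= 2 * e * nrm k.
  move=> y y' Dy Dy'; apply: op_ext => k; apply/eqP; rewrite -subr_eq0 -nrm_eq0.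
  rewrite eq_le nrm_ge0 andbT; apply/ler_addgt0Pr => e e0; rewrite add0r.
  pose d := Num.min (1 / 2) (e / (2 * (nrm k + 1))).
  have k1 : 0 < 2 * (nrm k + 1) by rewrite mulr_gt0// ltr_wpDl// nrm_ge0.
  have d0 : 0 < d by rewrite lt_min !divr_gt0.
  have d1 : d < 1 by rewrite gt_min; apply/orP; left; lra.
  have d2 : d * (2 * (nrm k + 1)) <= e by rewrite -ler_pdivlMr// ge_min lexx orbT.
  have := h y y' Dy Dy' k d; rewrite d0 d1 => /(_ isT).
  rewrite -[(y - y') k]/(y k - y' k); lra.
move=> Dy Dy' k e /andP[e0 e1].
pose s := 1 - e ^+ 2 / 4.
have e2 : e ^+ 2 < 1 by rewrite expr_lt1// ltW.
have e2' : 0 < e ^+ 2 by rewrite exprn_gt0.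
have s01 : 0 < s < sg by rewrite sg1 /s; lra.
have [_ [g wg hg]] := below s01 Dy; have [_ [g' wg' hg']] := below s01 Dy'.
have [x Dx] := D0.
have c1 : phclose s (g (g' x)) y by apply: hg; exact: (composite_inv Din wg').
have c2 : phclose s (g (g' x)) y'.
  rewrite (composite_comm Eball Ecomm wg wg'); last exact: D1.
  by apply: hg'; exact: (composite_inv Din wg).
set u := g (g' x) in c1 c2.
have s01' : 0 < s <= 1 by rewrite /s; lra.
have b z : phclose s u z -> nrm ((u - z) k) <= e * nrm k.
  move=> /(phclose_near k s01') h; apply: ler_of_sqr; first by rewrite mulr_ge0 ?nrm_ge0// ltW.
  have k2 := sqr_ge0 (nrm k); have u2 := sqr_ge0 (nrm ((u - z) k)).
  have hs : 1 / 2 <= s by rewrite /s; lra.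
  rewrite exprMn; move: h; rewrite {2}/s.
  have : nrm ((u - z) k) ^+ 2 * (1 / 2) <= nrm ((u - z) k) ^+ 2 * s by rewrite ler_wpM2l.
  lra.
have -> : (y - y') k = (u - y') k - (u - y) k.
  by rewrite -[(y - y') k]/(y k - y' k) -[(u - y') k]/(u k - y' k)
    -[(u - y) k]/(u k - y k) opprB [RHS]addrC addrA subrK.
by apply: le_trans (ler_nrmB _ _) _; have := b _ c1; have := b _ c2; lra.
Qed.

Let midC z1 z2 : z2 + 2^-1%:C *: (z1 - z2) = z1 + 2^-1%:C *: (z2 - z1).
Proof.
have e : 2^-1%:C = 1 - 2^-1%:C :> C.
  by apply/eqP; rewrite eq_complex /=; apply/andP; split; apply/eqP; field.
by rewrite {1}e scalerBl scale1r addrA [z2 + (z1 - z2)]addrC subrK -scalerN opprB.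
Qed.

(* An ultrafilter whose members stay away from each point of D contradicts [opial]
   at its weak limit. *)
Let not_lt1 : ~ sg < 1.
Proof.
move=> sg1.
(* the points of g(D) that are farther from z than the radius of parameter s > sg,
   for q = (z, g, s); by the definition of sg there are such points *)
pose base (q : V * (V -> V) * R) :=
  [set u | exists2 x, D x & u = q.1.2 x /\ ~ phclose q.2 u q.1.1].
pose idx :=
  [set q : V * (V -> V) * R | [/\ D q.1.1, composite q.1.2 & sg < q.2 <= 1]].
have [y0 Dy0] := D0.
have idx0 : idx (y0, id, 1) by split=> //=; [exact: composite_id|rewrite sg1 lexx].
pose G := filter_from idx base.
have FG : Filter G.
  apply: filter_from_filter; first by exists (y0, id, 1).
  move=> [[z1 g1] s1] [[z2 g2] s2] [/= Dz1 w1 hs1] [/= Dz2 w2 hs2].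
  have /andP[sg_s1 s1_1] := hs1; have /andP[sg_s2 s2_1] := hs2.
  have [e1 e10 e1P] := @phclose_mid _ K H sg s1 r ltac:(by rewrite sg_gt0) r1.
  have [e2 e20 e2P] := @phclose_mid _ K H sg s2 r ltac:(by rewrite sg_gt0) r1.
  pose e := Num.min (Num.min e1 e2) (Num.min (sg / 2) (1 - sg)).
  have e0 : 0 < e by rewrite !lt_min e10 e20 divr_gt0// subr_gt0 sg1.
  have ee1 : e <= e1 by rewrite !ge_min lexx.
  have ee2 : e <= e2 by rewrite !ge_min lexx orbT.
  have es : e <= sg / 2 by rewrite !ge_min lexx !orbT.
  have e1' : e <= 1 - sg by rewrite !ge_min lexx !orbT.
  have hse : 0 < sg - e < sg by lra.
  have [_ [h1 wh1 h1P]] := below hse Dz1; have [_ [h2 wh2 h2P]] := below hse Dz2.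
  have half01 : 0 <= (2^-1 : R) <= (1 : R) by lra.
  (* With h1 and h2 the points of the base set of the midpoint are almost within
     the asymptotic radius of z1 and z2; were one of them within parameter s1 of
     z1, it would be within sg + e of the midpoint by [phclose_mid]. *)
  exists (z1 + 2^-1%:C *: (z2 - z1), fun x => g1 (g2 (h1 (h2 x))), sg + e).
    split=> /=; first exact: Dcv.
      do 2 apply: composite_comp => //.
      exact: composite_comp.
    by apply/andP; split; lra.
  move=> u [x Dx [/= uE nc]].
  have DI g y : composite g -> D y -> D (g y) by move=> wg; exact: (composite_inv Din wg).
  have cm g g' y : composite g -> composite g' -> D y -> g (g' y) = g' (g y).
    by move=> wg wg' Dy; apply: (composite_comm Eball Ecomm wg wg'); exact: D1.
  have d1 := DI _ _ wh1 Dx; have d2 := DI _ _ wh2 Dx.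
  have d12 := DI _ _ wh1 d2.
  have d212 := DI _ _ w2 d12; have d112 := DI _ _ w1 d12.
  have Du : D u by rewrite uE; exact: DI _ _ w1 d212.
  have u2 : u = g2 (g1 (h1 (h2 x))) by rewrite uE (cm g1 g2).
  have c1 : phclose (sg - e) u z1.
    have -> : u = h1 (g1 (g2 (h2 x))).
      by rewrite uE (cm g2 h1)// (cm g1 h1)//; exact: DI.
    by apply: h1P; apply: (DI g1) => //; exact: DI.
  have c2 : phclose (sg - e) u z2.
    have -> : u = h2 (g1 (g2 (h1 x))).
      rewrite uE (cm h1 h2)// (cm g2 h2)// (cm g1 h2)//; exact: DI.
    by apply: h2P; apply: (DI g1) => //; exact: DI.
  split.
    exists (g2 (h1 (h2 x))) => //.
    split=> //= c; apply: nc.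
    by apply: e1P => //; [rewrite e0|exact: Dr|exact: Dr|exact: Dr].
  exists (g1 (h1 (h2 x))) => //.
  split=> //= c; apply: nc; rewrite -midC.
  by apply: e2P => //; [rewrite e0|exact: Dr|exact: Dr|exact: Dr].
have PG : ProperFilter G.
  apply: filter_from_proper => -[[z g] s] [/= Dz wg hs].
  by have [x Dx nc] := above hs Dz wg; exists (g x), x.
have [U [UU GU]] := ultraFilterLemma PG.
have Ub q : idx q -> U (base q) by move=> iq; apply: GU; exists q.
have UD : U D.
  by apply: filterS (Ub _ idx0) => u [x Dx [/= -> _]].
have [n [e [oe eP]]] := ortho_basis fdK.
have U1 : U [set z | nrm z <= 1].
  by apply: filterS UD => z /D1/ltW.
have [p pU] := weak_limit oe eP UU U1.
have Dp : D p := weak_limit_mem oe eP UU Dcv Dcl UD pU.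
have [I [B [B1 BP]]] := real_basis fdK.
have [|||||||s2 hs2 Us2] := @opial _ K H I B B1 BP U UU D r sg p.
- by rewrite r0.
- by rewrite sg_gt0.
- exact: pU.
- exact: UD.
- exact: Dr.
- exact: Dr.
- move=> y s Dy hs; have [_ [g wg gP]] := below hs Dy.
  have iq : idx (y, g, 1) by split=> //=; rewrite sg1 lexx.
  by apply: filterS (Ub _ iq) => u [x Dx [/= -> _]]; exact: gP.
have iq : idx (p, id, s2) by split=> //=; exact: composite_id.
have [u [[x _ [_ /= nc]] c]] := filter_ex (filterI (Ub _ iq) Us2).
exact: nc.
Qed.

Lemma minimal_fixed : exists2 y, D y & forall f, E f -> f y = y.
Proof.
have [y Dy] := D0; exists y => // f Ef.
have sg1 : sg = 1.
  by apply/eqP; rewrite eq_le sg_le1 /= leNgt; apply/negP.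
by apply: singleton => //; apply: Din Ef _ _; exists y.
Qed.

End Minimal.

(** The points within a fixed distance of some g(X): they include [X] when the
    distance bounds its diameter, they form a convex set although [X] need not be
    one, and they are away from the boundary by [phclose_bounded]. *)
Lemma admissible_exists X (r : R) : r < 1 -> X !=set0 -> invariant_set E X ->
  (forall x, X x -> nrm x <= r) -> exists2 r', r' < 1 & exists D, admissible r' D.
Proof.
move=> r1 [x0 Xx0] iX Xr.
have r0 : 0 <= r by apply: le_trans (Xr _ Xx0); exact: nrm_ge0.
pose s := (1 - r ^+ 2) / 2.
have s0 : 0 < s by rewrite divr_gt0// subr_gt0 expr_lt1.
have s1 : s <= 1 by have := sqr_ge0 r; rewrite /s; lra.
pose ball := [set x : V | nrm x < 1].
have XB : X `<=` ball by move=> x /Xr /= xr; exact: le_lt_trans r1.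
have iB : invariant_set E ball by move=> f Ef _ [x x1 <-]; exact: Eball.
have s01 : 0 < s <= 1 by rewrite s0.
pose C0 := centers X ball s.
pose r' := 1 - (s * (1 - r)) ^+ 2 / 2.
have r'1 : r' < 1.
  by rewrite /r' gtrDl oppr_lt0 divr_gt0// exprn_gt0// mulr_gt0// subr_gt0.
have C0r x : C0 x -> nrm x <= r'.
  move=> [x1 [g wg gP]]; apply: (@phclose_bounded _ _ _ s r (g x0)) => //.
  - by apply: Xr; exact: composite_inv iX wg _ Xx0.
  - exact: ltW.
  - exact: gP.
exists r' => //; exists (op_closure C0); split.
- exists x0; apply: op_closure_sub; split; first exact: XB.
  exists id; first exact: composite_id.
  by move=> x Xx; apply: phclose_small; [exact: Xr|exact: Xr|exact: ltW].
- apply: op_closure_convex; apply: centers_convex => //; exact: ball_convex.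
- exact: op_closure_closed.
- by apply: (closure_inv Ediff r'1) => //; exact: centers_inv.
- exact: (op_closure_min (@nrm_closed _ _ _ r') C0r).
Qed.

Lemma common_fixed_point X (r : R) : r < 1 -> X !=set0 -> invariant_set E X ->
  (forall x, X x -> nrm x <= r) ->
  exists2 y, nrm y < 1 & forall f, E f -> f y = y.
Proof.
move=> r1 X0 iX Xr; have [r' r'1 [D aD]] := admissible_exists r1 X0 iX Xr.
have [D' aD' Dmin] := minimal_admissible fdK r'1 aD.
have [y Dy yf] := minimal_fixed r'1 aD' Dmin; exists y => //.
by case: aD' => _ _ _ _ /(_ _ Dy) yr; exact: le_lt_trans r'1.
Qed.

End FixedPoint.

Theorem corollary4p4 (R : realType) (K H : hilbertType R)
    (finK : finite_dimensional K)
    (E : set (boundedOp K H -> boundedOp K H))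
    (finE : finite_set E)
    (holE : forall g, E g ->
      holomorphic_self_map (open_unit_ball (boundedOp K H)) g)
    (commE : commuting_on (open_unit_ball (boundedOp K H)) E) :
  (exists A : boundedOp K H,
     open_unit_ball (boundedOp K H) A /\ forall g, E g -> g A = A) <->
  (exists F : set (boundedOp K H),
     [/\ F `<=` open_unit_ball (boundedOp K H), F !=set0,
         invariant_set E F & separated_from_boundary F]).
Proof.
have ballE (x : boundedOp K H) : open_unit_ball (boundedOp K H) x <-> nrm x < 1.
  by rewrite /open_unit_ball /= nrmE -[1 in X in X <-> _]/(1%:C) ltcR.
split=> [[A [A1 Afix]]|[F [_ F0 iF [r [r1 Fr]]]]].
  exists [set A]; split.
  - by move=> _ ->.
  - by exists A.
  - by move=> g Eg _ [_ -> <-]; exact: Afix.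
  - by exists (nrm A); split; [exact/ballE|move=> _ ->; rewrite nrmE].
have [||||y y1 yfix] := @common_fixed_point R K H finK E _ _ _ F r r1 F0 iF.
- by move=> f x Ef /ballE x1; apply/ballE; exact: (holE _ Ef).1.
- by move=> f x Ef /ballE x1; exact: (holE _ Ef).2.
- by move=> f g x Ef Eg /ballE x1; exact: (commE f g Ef Eg x x1).
- by move=> x /Fr; rewrite nrmE lecR.
by exists y; split=> //; exact/ballE.
Qed.
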